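(* Let $f:\Delta\to\Delta$ be a mixing Young tower over a uniformly expanding full-branch map $F:Y\to Y$ (reference probability measure $m$, not assumed invariant, constants $\lambda,K,\eta$) with return time $\tau:Y\to\mathbb{Z}^+$ and associated data $\{I_k\}$, $\delta$, and let $L$ be the transfer operator of $f$ with respect to $m_\Delta$, all as described in the context. Let $\phi:\Delta\to\mathbb{R}$ satisfy $\|\phi\|_\eta<\infty$ and $\int_\Delta\phi\,dm_\Delta=0$. (1) Suppose that $m(\tau\ge n)\le C_\tau n^{-\beta}$ for some $\beta>1$ and all $n>0$. Then there exists a constant $C>0$ depending continuously on $\lambda$, $K$, $\eta$, $\max\{I_k\}$, $\delta$, $\beta$ and $C_\tau$ such that for all $n\ge1$ $$\int_\Delta|L^n\phi|\,dm_\Delta\le C\|\phi\|_\eta\, n^{-(\beta-1)}.$$ (2) Suppose that $m(\tau\ge n)\le C_\tau e^{-An^\gamma}$ for some $A>0$, $0<\gamma\le1$ and all $n>0$. Then there exist constants $B>0$ and $C>0$ depending continuously on $\lambda$, $K$, $\eta$, $\max\{I_k\}$, $\delta$, $A$, $\gamma$ and $C_\tau$ such that for all $n\ge0$ $$\int_\Delta|L^n\phi|\,dm_\Delta\le C\|\phi\|_\eta\, e^{-Bn^\gamma}.$$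
   Context: Uniformly expanding maps. $(Y,m)$ is a probability space, $F:Y\to Y$ is a nonsingular transformation, and $d$ is a metric on $Y$ with $\operatorname{diam}Y\le 1$. $\alpha$ is an at most countable measurable partition of $Y$ such that $F$ restricts to a measure-theoretic bijection from $a$ onto $Y$ for each $a\in\alpha$. Let $\zeta=\frac{dm}{dm\circ F}$ be the inverse Jacobian of $F$ with respect to $m$. There are constants $\lambda>1$, $K>0$, $\eta\in(0,1]$ such that for all $x,y$ in the same partition element, $d(Fx,Fy)\ge\lambda d(x,y)$ and $|\log\zeta(x)-\log\zeta(y)|\le K d(Fx,Fy)^\eta$. The measure $m$ is not assumed $F$-invariant. Young tower. $\tau:Y\to\mathbb{Z}^+$ is an $m$-integrable function constant on elements of $\alpha$. $\Delta=\{(y,\ell)\in Y\times\mathbb{Z}:0\le\ell\le\tau(y)-1\}$ and $f:\Delta\to\Delta$ is $f(y,\ell)=(y,\ell+1)$ if $\ell\le\tau(y)-2$, $f(y,\ell)=(Fy,0)$ if $\ell=\tau(y)-1$. Let $\bar\tau=\int_Y\tau\,dm$. $m_\Delta$ is the probability measure on $\Delta$ with $m_\Delta(A\times\{\ell\})=\bar\tau^{-1}m(A)$ for all $\ell\ge0$ and measurable $A\subset\{y:\tau(y)\ge\ell+1\}$. The metric on $\Delta$ is $d_\Delta((y,\ell),(y',\ell'))=1$ if $\ell\ne\ell'$ and $=d(y,y')$ if $\ell=\ell'$. For $\phi:\Delta\to\mathbb{R}$, $|\phi|_\eta=\sup_{x\ne y}|\phi(x)-\phi(y)|/d_\Delta(x,y)^\eta$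 and $\|\phi\|_\eta=|\phi|_\eta+|\phi|_\infty$. Transfer operator. $L:L^1(\Delta)\to L^1(\Delta)$ is defined by $\int_\Delta L\phi\,\psi\,dm_\Delta=\int_\Delta\phi\,\psi\circ f\,dm_\Delta$ for $\phi\in L^1$, $\psi\in L^\infty$. Mixing case. The tower is called mixing if $\gcd\{\tau(a):a\in\alpha\}=1$. In that case there exist $\delta>0$ and a finite set of positive integers $\{I_k\}$ with $\gcd\{I_k\}=1$ such that $m(\{y\in Y:\tau(y)=I_k\})\ge\delta$ for every $k$; fix such data. ''Constants depending continuously on parameters'' means that they can be given by continuous functions of those parameters, the same functions for all systems and observables with those parameters. *)

(* Defs.v *)
From HB Require Import structures.
From mathcomp Require Import all_boot all_order all_algebra.
From mathcomp Require Import all_classical all_reals all_analysis.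
Import Order.TTheory GRing.Theory Num.Theory.
Import numFieldNormedType.Exports.

Set Implicit Arguments.
Unset Strict Implicit.
Unset Printing Implicit Defensive.

Local Open Scope classical_set_scope.
Local Open Scope ring_scope.

(* The metric is a bare function: it is not required to generate the
   sigma-algebra of Y, nor a topology attached to the type Y. *)
Definition is_metric (R : realType) (Y : Type) (dist : Y -> Y -> R) : Prop :=
  [/\ forall x y, 0 <= dist x y,
      forall x y, dist x y = 0 <-> x = y,
      forall x y, dist x y = dist y x &
      forall x y z, dist x z <= dist x y + dist y z].

Definition nonsingular (R : realType) (d : measure_display)
    (Y : measurableType d) (m : probability Y R) (F : Y -> Y) : Prop :=
  measurable_fun [set: Y] F /\
  forall A, measurable A -> (m (F @^-1` A) = 0%E <-> m A = 0%E).

Definition countable_measurable_partition (d : measure_display)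
    (Y : measurableType d) (alpha : set (set Y)) : Prop :=
  [/\ countable alpha, alpha `<=` measurable & partition alpha id [set: Y]].

Definition bimeasurable_bij (d : measure_display) (Y : measurableType d)
    (F : Y -> Y) (A B : set Y) : Prop :=
  [/\ measurable A, measurable B, set_bij A B F &
      forall C, measurable C -> C `<=` A -> measurable (F @` C)].

(* F is a bimeasurable bijection from a onto Y after removing m-null sets. *)
Definition full_branch (R : realType) (d : measure_display)
    (Y : measurableType d) (m : probability Y R) (F : Y -> Y)
    (a : set Y) : Prop :=
  exists A B, [/\ A `<=` a, m (a `\` A) = 0%E, m (~` B) = 0%E &
                  bimeasurable_bij F A B].

(* m o F on a set A where F is injective and bimeasurable; it is a measure
   on the measurable sets, concentrated on A. *)
Definition image_measure (R : realType) (d : measure_display)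
    (Y : measurableType d) (m : probability Y R) (F : Y -> Y)
    (A : set Y) : set Y -> \bar R :=
  fun C => m (F @` (C `&` A)).

(* zeta = dm / d(m o F). Bimeasurability on A passes to the measurable
   subsets of A, so the identity over all such A inside a says that zeta is the
   density of m with respect to m o F on a. The version zeta is taken positive
   everywhere, since ln is only meaningful on positive reals. *)
Definition inverse_jacobian (R : realType) (d : measure_display)
    (Y : measurableType d) (m : probability Y R) (F : Y -> Y)
    (alpha : set (set Y)) (zeta : Y -> R) : Prop :=
  [/\ measurable_fun [set: Y] zeta,
      forall x, 0 < zeta x &
      forall a A B, alpha a -> A `<=` a -> bimeasurable_bij F A B ->
        m A = (\int[image_measure m F A]_(x in A) (zeta x)%:E)%E].

Record uniformly_expanding (R : realType) (d : measure_display)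
    (Y : measurableType d) (m : probability Y R) (F : Y -> Y)
    (dist : Y -> Y -> R) (alpha : set (set Y)) (zeta : Y -> R)
    (lambda K eta : R) : Prop := UniformlyExpanding {
  ue_metric : is_metric dist;
  ue_diam : forall x y, dist x y <= 1;
  ue_nonsingular : nonsingular m F;
  ue_partition : countable_measurable_partition alpha;
  ue_full_branch : forall a, alpha a -> full_branch m F a;
  ue_jacobian : inverse_jacobian m F alpha zeta;
  ue_lambda : 1 < lambda;
  ue_K : 0 < K;
  ue_eta : 0 < eta <= 1;
  ue_expansion : forall a x y, alpha a -> a x -> a y ->
    lambda * dist x y <= dist (F x) (F y);
  ue_distortion : forall a x y, alpha a -> a x -> a y ->
    `|ln (zeta x) - ln (zeta y)| <= K * dist (F x) (F y) `^ eta
}.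

Record return_time (R : realType) (d : measure_display)
    (Y : measurableType d) (m : probability Y R) (alpha : set (set Y))
    (tau : Y -> nat) : Prop := ReturnTime {
  rt_gt0 : forall y, (0 < tau y)%N;
  rt_constant : forall a x y, alpha a -> a x -> a y -> tau x = tau y;
  rt_integrable : m.-integrable [set: Y] (fun y => ((tau y)%:R : R)%:E)
}.

(* The tower Delta is a subset of Y * nat; functions on Delta are represented
   by functions on Y * nat, whose values outside Delta never matter. *)
Definition tower (Y : Type) (tau : Y -> nat) : set (Y * nat) :=
  [set x | (x.2 < tau x.1)%N].

Definition tower_map (Y : Type) (F : Y -> Y) (tau : Y -> nat)
    (x : Y * nat) : Y * nat :=
  if (x.2.+1 < tau x.1)%N then (x.1, x.2.+1) else (F x.1, 0%N).

Definition tower_measure (R : realType) (d : measure_display)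
    (Y : measurableType d) (m : probability Y R) (tau : Y -> nat)
    (mD : probability (Y * nat)%type R) : Prop :=
  mD (tower tau) = 1%E /\
  forall (l : nat) (A : set Y), measurable A ->
    A `<=` [set y | (l.+1 <= tau y)%N] ->
    mD (A `*` [set l]) =
      ((fine (\int[m]_y ((tau y)%:R : R)%:E))^-1%:E * m A)%E.

Definition tower_dist (R : realType) (Y : Type) (dist : Y -> Y -> R)
    (x y : Y * nat) : R :=
  if x.2 == y.2 then dist x.1 y.1 else 1.

(* The maximum with 0 makes the supremum over the empty set of pairs 0 when
   Delta is a single point. *)
Definition holder_seminorm (R : realType) (Y : Type) (dist : Y -> Y -> R)
    (tau : Y -> nat) (eta : R) (phi : Y * nat -> R) : \bar R :=
  maxe 0%E (ereal_sup [set r : \bar R | exists x y,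
    [/\ tower tau x, tower tau y, x <> y &
        r = (`|phi x - phi y| / tower_dist dist x y `^ eta)%:E]]).

Definition sup_norm (R : realType) (Y : Type) (tau : Y -> nat)
    (phi : Y * nat -> R) : \bar R :=
  ereal_sup [set (`|phi x|)%:E | x in tower tau].

Definition holder_norm (R : realType) (Y : Type) (dist : Y -> Y -> R)
    (tau : Y -> nat) (eta : R) (phi : Y * nat -> R) : \bar R :=
  (holder_seminorm dist tau eta phi + sup_norm tau phi)%E.

Definition Linfty_on (R : realType) (d : measure_display)
    (T : measurableType d) (mu : probability T R) (D : set T)
    (psi : T -> R) : Prop :=
  measurable_fun D psi /\
  exists M : R, {ae mu, forall x, D x -> `|psi x| <= M}.

(* L acts on representatives: for each integrable phi, L phi is some
   representative of the class in L^1(Delta) determined by duality. *)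
Definition transfer_operator (R : realType) (d : measure_display)
    (T : measurableType d) (mu : probability T R) (D : set T) (f : T -> T)
    (L : (T -> R) -> (T -> R)) : Prop :=
  forall phi : T -> R, mu.-integrable D (EFin \o phi) ->
    mu.-integrable D (EFin \o L phi) /\
    forall psi : T -> R, Linfty_on mu D psi ->
      (\int[mu]_(x in D) (L phi x * psi x)%:E =
       \int[mu]_(x in D) (phi x * psi (f x))%:E)%E.

(* gcd {tau(a) : a in alpha} = 1, for a possibly infinite set of values. *)
Definition mixing (Y : Type) (alpha : set (set Y)) (tau : Y -> nat) : Prop :=
  forall k : nat, (forall a y, alpha a -> a y -> (k %| tau y)%N) -> k = 1%N.

(* The finite set {I_k} is listed by the sequence I. The condition on the gcd
   forces I to be nonempty. *)
Definition mixing_data (R : realType) (d : measure_display)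
    (Y : measurableType d) (m : probability Y R) (tau : Y -> nat)
    (I : seq nat) (delta : R) : Prop :=
  [/\ 0 < delta,
      forall i, i \in I -> (0 < i)%N,
      \big[gcdn/0%N]_(i <- I) i = 1%N &
      forall i, i \in I -> (delta%:E <= m [set y | tau y = i])%E].

(* Domains of the parameters (lambda, K, eta, max I_k, delta, beta, C_tau) and
   (lambda, K, eta, max I_k, delta, A, gamma, C_tau), on which the constants
   are continuous; nat carries the discrete topology. *)
Definition poly_params (R : realType) : set (R * R * R * nat * R * R * R) :=
  [set p | let: (lambda, K, eta, N, delta, beta, Ctau) := p in
    [/\ 1 < lambda, 0 < K & 0 < eta <= 1] /\
    [/\ (0 < N)%N, 0 < delta, 1 < beta & 0 < Ctau]].

Definition exp_params (R : realType) :
    set (R * R * R * nat * R * R * R * R) :=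
  [set p | let: (lambda, K, eta, N, delta, A, gamma, Ctau) := p in
    [/\ 1 < lambda, 0 < K & 0 < eta <= 1] /\
    [/\ (0 < N)%N, 0 < delta, 0 < A, 0 < gamma <= 1 & 0 < Ctau]].

Arguments poly_params : clear implicits.
Arguments exp_params : clear implicits.

(* Main.v *)
(** Every Hoelder observable of mean zero is a multiple of the difference of two
    probability measures on the tower whose densities are bounded and
    log-Hoelder on each piece [a * {l}], so the L^1 norm of [L^n phi] is
    controlled by [|nu1 (f^-n A) - nu2 (f^-n A)|].  The measures are kept in a
    class that is stable under the following coupling step.  Wait until all the
    mass whose residual time [tau - l] is at most [k] has returned to the base.
    Each inflow on the base is log-Hoelder on the whole of [Y], hence its density
    is comparable to its mass; the bounded density keeps at least half of the
    mass at bounded height, and the branches with return times [I_k], of gcd 1,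
    spread it so that a definite time [N0] later the density on the base is at
    least a definite constant.  Subtracting the multiple [c] of [m] from it gives
    another measure of the class.  Since residual times have tails dominated by a
    common sequence [r], both measures can be cut into slices of equal masses
    [r (k-1) - r k], the k-th of which has residual time at most [k], and the
    optimal coupling bound [b] satisfies the renewal inequality
      [b n >= r (n - N0) + (1 - c) * \sum_k (r (k-1) - r k) * b (n - N0 - k)],
    solved by polynomial and stretched exponential sequences.  All constants
    depend only on an integer bounding a continuous complexity of the parameters;
    interpolation in this integer makes them continuous. *)
Require Import Defs.
From HB Require Import structures.
From mathcomp Require Import all_boot all_order all_algebra.
From mathcomp Require Import all_classical all_reals all_analysis.
From mathcomp Require Import measurable_realfun.
From mathcomp Require Import ring lra zify.
Import Order.TTheory GRing.Theory Num.Theory.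
Import numFieldNormedType.Exports.
Local Open Scope classical_set_scope.
Local Open Scope ring_scope.

Set Implicit Arguments.
Unset Strict Implicit.
Unset Printing Implicit Defensive.

(** * Finite measures as real set functions *)

(** The difficulty is to iterate the coupling step without letting the constants deteriorate. Two
    operations do damage. Normalising a thin slice of a measure destroys any bound on its density,
    and subtracting [c * m] worsens its log-Hoelder constant. The first is repaired by waiting: once
    everything has returned to the base, the density is bounded by distortion alone, whatever it was
    before. The second is repaired by expansion: on arrival at the base the constant is
    [K + kappa * Q], which for [Q = (K + 1) / (1 - kappa)] equals [Q - 1], and the spare unit pays
    for the subtraction. The masses of the slices are prescribed by [r] instead of being read off
    from the measures, because two measures with different residual times must release equal masses
    at equal times. Regularity is expressed by cross-multiplied inequalities between masses of sets:
    these make sense for null sets, and they survive countable sums and rescaling. The observable is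
    compared with the constant density, so no invariant density has to be constructed. *)

Record fmeas {R : realType} {d : measure_display} {T : measurableType d}
    (nu : set T -> R) : Prop := Fmeas {
  fm0 : nu set0 = 0;
  fm_ge0 : forall A, measurable A -> 0 <= nu A;
  fm_sigma : forall P : nat -> set T, (forall i, measurable (P i)) ->
    trivIset setT P ->
    (fun n => \sum_(i < n) nu (P i)) @ \oo --> nu (\bigcup_i P i)
}.

Section fmeas_theory.
Context {R : realType} {d : measure_display} {T : measurableType d}.
Implicit Types (nu : set T -> R) (A B : set T).

Lemma fm_additive nu A B : fmeas nu -> measurable A -> measurable B ->
  A `&` B = set0 -> nu (A `|` B) = nu A + nu B.
Proof.
move=> nuM mA mB AB0.
have mP i : measurable (bigcup2 A B i) by rewrite /bigcup2; case: ifP => //; case: ifP.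
have tP : trivIset setT (bigcup2 A B).
  apply/trivIsetP => -[|[|i]] [|[|j]] _ _ //= _; rewrite /bigcup2 /= ?set0I ?setI0 //.
  by rewrite setIC.
have := fm_sigma nuM mP tP; rewrite bigcup2E => h.
have h' : (fun n => \sum_(i < n) nu (bigcup2 A B i)) @ \oo --> nu A + nu B.
  rewrite -(cvg_shiftn 2) /=; apply: cvg_near_cst; apply: nearW => n /=.
  rewrite addn2 !big_ord_recl /= /bigcup2 /= addrA big1 ?addr0 // => i _.
  exact: fm0.
by apply: (cvg_unique _ h h').
Qed.

Lemma fm_split nu A B : fmeas nu -> measurable A -> measurable B ->
  nu A = nu (A `&` B) + nu (A `\` B).
Proof.
move=> nuM mA mB; rewrite -fm_additive //; first by rewrite setUIDK.
- exact: measurableI.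
- exact: measurableD.
- by rewrite setDE setIACA setICr setI0.
Qed.

Lemma fm_le nu A B : fmeas nu -> measurable A -> measurable B ->
  A `<=` B -> nu A <= nu B.
Proof.
move=> nuM mA mB AB; rewrite (fm_split nuM mB mA) (setIidr AB) lerDl.
by apply: fm_ge0 => //; exact: measurableD.
Qed.

Lemma fm_cvg_pieces nu (P : nat -> set T) A : fmeas nu -> measurable A ->
  (forall i, measurable (P i)) -> trivIset setT P -> \bigcup_i P i = setT ->
  (fun n => \sum_(i < n) nu (A `&` P i)) @ \oo --> nu A.
Proof.
move=> nuM mA mP tP cP; rewrite -[in X in _ --> X](setIT A) -cP setI_bigcupr.
apply: fm_sigma => //; first by move=> i; exact: measurableI.
exact: trivIset_setIl.
Qed.

(** Ratio bounds are kept cross-multiplied because a denominator may vanish. In this form they are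
    linear in both measures and can be summed over a countable partition. *)
Lemma fm_le_pieces nu nu' (P : nat -> set T) A B x y :
  fmeas nu -> fmeas nu' -> measurable A -> measurable B ->
  (forall i, measurable (P i)) -> trivIset setT P -> \bigcup_i P i = setT ->
  (forall i, nu (A `&` P i) * x <= y * nu' (B `&` P i)) ->
  nu A * x <= y * nu' B.
Proof.
move=> nuM nuM' mA mB mP tP cP h.
have c1 := fm_cvg_pieces nuM mA mP tP cP.
have c2 := fm_cvg_pieces nuM' mB mP tP cP.
have c1' : (fun n => (\sum_(i < n) nu (A `&` P i)) * x) @ \oo --> nu A * x.
  exact: cvgMr_tmp.
have c2' : (fun n => y * (\sum_(i < n) nu' (B `&` P i))) @ \oo --> y * nu' B.
  exact: cvgMl_tmp.
apply: (ler_cvg_to c1' c2'); apply: nearW => n.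
by rewrite mulr_suml mulr_sumr; apply: ler_sum.
Qed.

Lemma fm_le_bound nu (P : nat -> set T) A y : fmeas nu -> measurable A ->
  (forall i, measurable (P i)) -> trivIset setT P -> \bigcup_i P i = setT ->
  (forall n, \sum_(i < n) nu (A `&` P i) <= y) -> nu A <= y.
Proof.
move=> nuM mA mP tP cP h.
by apply: (cvgr_to_le (fm_cvg_pieces nuM mA mP tP cP)); exact: nearW.
Qed.

Lemma fmeas_scale nu c : 0 <= c -> fmeas nu -> fmeas (fun A => c * nu A).
Proof.
move=> c0 [n0 nge nS]; split => [|A mA|P mP tP].
- by rewrite n0 mulr0.
- by rewrite mulr_ge0 ?nge.
- under eq_fun do rewrite -mulr_sumr.
  by apply: cvgMl_tmp; exact: nS.
Qed.

Lemma fmeas_add nu nu' : fmeas nu -> fmeas nu' -> fmeas (fun A => nu A + nu' A).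
Proof.
move=> [n0 nge nS] [n0' nge' nS']; split => [|A mA|P mP tP].
- by rewrite n0 n0' addr0.
- by rewrite addr_ge0 ?nge ?nge'.
- under eq_fun do rewrite big_split /=.
  by apply: cvgD; [exact: nS|exact: nS'].
Qed.

Lemma fmeas_sub nu nu' : fmeas nu -> fmeas nu' ->
  (forall A, measurable A -> nu' A <= nu A) -> fmeas (fun A => nu A - nu' A).
Proof.
move=> [n0 nge nS] [n0' nge' nS'] h; split => [|A mA|P mP tP].
- by rewrite n0 n0' subrr.
- by rewrite subr_ge0 h.
- under eq_fun do rewrite big_split /= sumrN.
  by apply: cvgB; [exact: nS|exact: nS'].
Qed.

Lemma fmeas_restr nu B : fmeas nu -> measurable B -> fmeas (fun A => nu (A `&` B)).
Proof.
move=> [n0 nge nS] mB; split => [|A mA|P mP tP].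
- by rewrite set0I.
- by apply: nge; exact: measurableI.
- rewrite setI_bigcupl; apply: nS; first by move=> i; exact: measurableI.
  exact: trivIset_setIr.
Qed.

End fmeas_theory.

Lemma fmeas_push {R : realType} {d d' : measure_display} {T : measurableType d}
  {T' : measurableType d'} (nu : set T -> R) (g : T -> T') :
  measurable_fun setT g -> fmeas nu -> fmeas (fun A => nu (g @^-1` A)).
Proof.
move=> mg [n0 nge nS].
have mpre A : measurable A -> measurable (g @^-1` A).
  by move=> mA; rewrite -[X in measurable X]setTI; exact: mg.
split => [|A mA|P mP tP].
- by rewrite preimage_set0.
- by apply/nge/mpre.
- rewrite preimage_bigcup; apply: nS; first by move=> i; exact: mpre.
  apply/trivIsetP => i j _ _ ij; rewrite -preimage_setI.
  by move/trivIsetP: tP => ->//; rewrite preimage_set0.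
Qed.

Lemma fmeas_fine {R : realType} {d : measure_display} {T : measurableType d}
  (mu : {measure set T -> \bar R}) : (mu setT < +oo)%E ->
  fmeas (fun A => fine (mu A)).
Proof.
move=> mfin.
have fin A : measurable A -> mu A \is a fin_num.
  move=> mA; rewrite ge0_fin_numE//; apply: le_lt_trans mfin.
  by apply: le_measure; rewrite ?inE.
split => [|A mA|P mP tP].
- by rewrite measure0.
- exact/fine_ge0.
- have mU := bigcup_measurable (fun i (_ : setT i) => mP i).
  have : (fun n => (\sum_(0 <= i < n) mu (P i))%E) @ \oo --> mu (\bigcup_i P i).
    exact: measure_semi_sigma_additive.
  rewrite -(fineK (fin _ mU)) => h; have [_] := (fine_cvgP _ _).1 h.
  have -> // : fine \o (fun n => (\sum_(0 <= i < n) mu (P i))%E) =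
      (fun n => \sum_(i < n) fine (mu (P i))).
  apply/funext => n /=; rewrite big_mkord sum_fine// => i _; exact: fin.
Qed.

(** * Pushing measures through the tower *)

Lemma regularity_ge0 {R : realType} (kappa K Q : R) :
  0 <= kappa <= 1 -> 0 <= K -> K + kappa * Q + 1 <= Q ->
  0 <= Q /\ 0 <= K + kappa * Q.
Proof.
move=> /andP[k0 k1] K0 QL; have Q0 : 0 <= Q by nra.
by split => //; nra.
Qed.

(* [bm_jac] is bounded distortion of the inverse Jacobian, stated for the masses
   of sets so that neither inverse branches nor densities are needed; [rho] is
   the metric to the power [eta]. *)
Record branch_map {R : realType} {d : measure_display} {Y : measurableType d}
    (m : set Y -> R) (F : Y -> Y) (rho : Y -> Y -> R) (a : nat -> set Y)
    (tau : Y -> nat) (kappa K : R) : Prop := BranchMap {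
  bm_fmeas : fmeas m;
  bm_setT : m setT = 1;
  bm_F : measurable_fun setT F;
  bm_a : forall i, measurable (a i);
  bm_disj : trivIset setT a;
  bm_cover : \bigcup_i a i = setT;
  bm_rho0 : forall x y, 0 <= rho x y;
  bm_rho1 : forall x y, rho x y <= 1;
  bm_kappa : 0 <= kappa <= 1;
  bm_K : 0 <= K;
  bm_exp : forall i x y, a i x -> a i y -> rho x y <= kappa * rho (F x) (F y);
  bm_jac : forall i C D r, measurable C -> measurable D ->
    (forall x y, C x -> D y -> rho x y <= r) ->
    m (a i `&` F @^-1` C) * m D <= expR (K * r) * (m C * m (a i `&` F @^-1` D));
  bm_pos : forall i D, measurable D -> a i !=set0 ->
    m (a i `&` F @^-1` D) = 0 -> m D = 0;
  bm_tau : forall i x y, a i x -> a i y -> tau x = tau y;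
  bm_tau0 : forall y, (0 < tau y)%N
}.

Section product_with_nat.
Context {d : measure_display} {Y : measurableType d}.

Lemma measurable_level (A : set Y) (l : nat) :
  measurable A -> measurable (A `*` [set l]).
Proof. by move=> mA; exact: measurableX. Qed.

Lemma measurable_slice (S : set (Y * nat)) l :
  measurable S -> measurable [set y | S (y, l)].
Proof.
move=> mS; rewrite (_ : [set y | S (y, l)] = ysection S l).
  exact: measurable_ysection.
by apply/seteqP; split => y; rewrite /ysection /= inE.
Qed.

Lemma measurable_slices (S : set (Y * nat)) :
  (forall l, measurable [set y | S (y, l)]) -> measurable S.
Proof.
move=> mS; rewrite (_ : S = \bigcup_l ([set y | S (y, l)] `*` [set l])).
  by apply: bigcup_measurable => l _; exact: measurable_level.
apply/seteqP; split => [[y l] Syl|[y l] [k _ [/= + ->]]] //.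
by exists l.
Qed.

End product_with_nat.

Section branch_map_theory.
Context {R : realType} {d : measure_display} {Y : measurableType d}.
Variables (m : set Y -> R) (F : Y -> Y) (rho : Y -> Y -> R) (a : nat -> set Y).
Variables (tau : Y -> nat) (kappa K : R).
Hypothesis bm : branch_map m F rho a tau kappa K.
Let mm : fmeas m := bm_fmeas bm.
Let ma := bm_a bm.
Local Notation f := (tower_map F tau).
Local Notation T := (Y * nat)%type.

(** Since [tau] is constant on cells, any condition on it selects a countable union of cells. *)
Lemma measurable_tau (P : set nat) : measurable [set y | P (tau y)].
Proof.
rewrite (_ : [set _ | _] = \bigcup_(i in [set i | exists2 y, a i y & P (tau y)]) a i).
  exact: bigcup_measurable.
apply/seteqP; split => [y /= Py|y [i [x ax Px] ay] /=]; last first.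
  by rewrite (bm_tau bm ay ax).
have : [set: Y] y by [].
by rewrite -(bm_cover bm) => -[i _ ay]; exists i => //; exists y.
Qed.

Lemma measurable_tower_rel (P : nat -> nat -> Prop) :
  measurable [set x : T | P x.2 (tau x.1)].
Proof. by apply: measurable_slices => l; exact: (measurable_tau (P l)). Qed.

Lemma preimage_tower_map_slice (S : set T) l :
  [set y | (f @^-1` S) (y, l)] =
  ([set y | (l.+1 < tau y)%N] `&` [set y | S (y, l.+1)]) `|`
  ([set y | ~ (l.+1 < tau y)%N] `&` F @^-1` [set y | S (y, 0%N)]).
Proof.
apply/seteqP; split => y; rewrite /tower_map /=.
  by case: ifPn => h Sy; [left|right]; split => //; exact/negP.
by move=> [[h Sy]|[/negP/negbTE h Sy]]; rewrite h.
Qed.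

Lemma measurable_preimage_F C : measurable C -> measurable (F @^-1` C).
Proof. by move=> mC; rewrite -[X in measurable X]setTI; exact: (bm_F bm). Qed.

Lemma measurable_tower_map : measurable_fun setT f.
Proof.
move=> _ S mS; rewrite setTI; apply: measurable_slices => l.
rewrite preimage_tower_map_slice; apply: measurableU; apply: measurableI.
- exact: (measurable_tau (fun t => (l.+1 < t)%N)).
- exact: measurable_slice.
- exact: (measurable_tau (fun t => ~ (l.+1 < t)%N)).
- by apply: measurable_preimage_F; exact: measurable_slice.
Qed.

Lemma measurable_iter_tower n : measurable_fun setT (iter n f).
Proof.
elim: n => [|n IH]; first exact: measurable_id.
by apply: (measurableT_comp measurable_tower_map).
Qed.

Lemma measurable_preimage_iter n (A : set T) :
  measurable A -> measurable (iter n f @^-1` A).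
Proof. by move=> mA; rewrite -[X in measurable X]setTI; exact: measurable_iter_tower. Qed.

Lemma tower_le_pieces (nu nu' : set T -> R) (A B : set T) x y :
  fmeas nu -> fmeas nu' -> measurable A -> measurable B ->
  (forall i l, nu (A `&` (a i `*` [set l])) * x <=
               y * nu' (B `&` (a i `*` [set l]))) ->
  nu A * x <= y * nu' B.
Proof.
move=> nuM nuM' mA mB h.
apply: (fm_le_pieces (P := fun l => setT `*` [set l])) => //.
- by move=> l; exact: measurable_level.
- by apply/trivIsetP => i j _ _ ij; apply/seteqP; split => // -[z k] [[_ /= ->] [_ /=
    ji]]; move/eqP: ij.
- by apply/seteqP; split => // -[z l] _; exists l.
move=> l; apply: (fm_le_pieces (P := fun i => a i `*` setT)) => //.
- by apply: measurableI => //; exact: measurable_level.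
- by apply: measurableI => //; exact: measurable_level.
- by move=> i; exact: measurableX.
- apply/trivIsetP => i j _ _ ij; apply/seteqP; split => // -[z k] [[/= ai _] [/= aj _]].
  by have /trivIsetP/(_ i j Logic.I Logic.I ij) := bm_disj bm; move/seteqP => -[/(_ z)+
      _]; exact.
- apply/seteqP; split => // -[z k] _.
  have : [set: Y] z by [].
  by rewrite -(bm_cover bm) => -[i _ az]; exists i.
move=> i /=.
have e (S : set T) : S `&` ([set: Y] `*` [set l]) `&` (a i `*` [set: nat]) =
    S `&` (a i `*` [set l]).
  by apply/seteqP; split => -[z k] /=; tauto.
by rewrite !e.
Qed.

(* If [nu] has a density [u] on level [l], this says that [ln u] is [Q]-Lipschitz
   for [rho] on [a i]. *)
Definition regular (Q : R) (nu : set T -> R) : Prop :=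
  forall i l C D r, measurable C -> measurable D -> C `<=` a i -> D `<=` a i ->
  (forall x y, C x -> D y -> rho x y <= r) ->
  nu (C `*` [set l]) * m D <= expR (Q * r) * (m C * nu (D `*` [set l])).

(** Pulling [C] and [D] back through a branch contracts distances by [kappa], so the old regularity
    contributes [kappa * Q], and the distortion of the Jacobian adds [K]. Because every branch is
    full, [C] and [D] need not lie in a common cell. *)
Lemma base_regular Q (nu : set T -> R) C D r : fmeas nu -> regular Q nu ->
  measurable C -> measurable D -> (forall x y, C x -> D y -> rho x y <= r) ->
  nu (f @^-1` (C `*` [set 0%N])) * m D <=
  expR ((K + kappa * Q) * r) * (m C * nu (f @^-1` (D `*` [set 0%N]))).
Proof.
move=> nuM rnu mC mD CDr; rewrite mulrA.
have mpre (A : set Y) : measurable A -> measurable (f @^-1` (A `*` [set 0%N])).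
  by move=> mA; exact: (measurable_preimage_iter 1 (measurable_level _ mA)).
apply: tower_le_pieces => //; [exact: mpre|exact: mpre|move=> i l].
(* The enumeration of cells may contain empty sets, to which [bm_pos] does not apply. *)
have [/seteqP[ai0 _]|/set0P ai0] := eqVneq (a i) set0.
  have e (A : set T) : A `&` (a i `*` [set l]) = set0.
    by apply/seteqP; split => // -[z k] [_ [/= /ai0]].
  by rewrite !e (fm0 nuM) mul0r mulr0.
have [y0 ay0] := ai0.
have tauE z : a i z -> tau z = tau y0 by move=> az; exact: (bm_tau bm az ay0).
(* Below the top level the map climbs, so such a piece sends nothing to the base; the other pieces
   are mapped by [F]. *)
have [lt|ge] := ltnP l.+1 (tau y0).
  have e (A : set Y) : f @^-1` (A `*` [set 0%N]) `&` (a i `*` [set l]) = set0.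
    by apply/seteqP; split => // -[z k] []; rewrite /tower_map /= => /[swap] -[az ->];
        rewrite (tauE z az) lt => -[].
  by rewrite !e (fm0 nuM) mul0r mulr0.
have e (A : set Y) : f @^-1` (A `*` [set 0%N]) `&` (a i `*` [set l]) =
    (a i `&` F @^-1` A) `*` [set l].
  apply/seteqP; split => -[z k] /=; rewrite /tower_map /=.
    by move=> [] /[swap] -[az ->]; rewrite (tauE z az) ltnNge ge /= => -[].
  by move=> [[az Az] ->]; rewrite (tauE z az) ltnNge ge.
rewrite !e.
set C' := a i `&` _; set D' := a i `&` _.
have mC' : measurable C' by apply: measurableI => //; exact: measurable_preimage_F.
have mD' : measurable D' by apply: measurableI => //; exact: measurable_preimage_F.
have j := bm_jac bm i mC mD CDr.
have r1 : nu (C' `*` [set l]) * m D' <= expR (Q * (kappa * r)) * (m C' * nu (D' `*` [set l])).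
  apply: (rnu i) => //; try by move=> ? [].
  move=> x y [ax Cx] [ay Dy]; apply: le_trans (bm_exp bm ax ay) _.
  by rewrite ler_wpM2l ?CDr//; have /andP[] := bm_kappa bm.
(* The mass [m D'] links regularity with distortion and is cancelled at the end; if it vanishes, so
   does [m D]. *)
have [z|nz] := eqVneq (m D') 0.
  rewrite (bm_pos bm mD ai0 z) mulr0.
  by rewrite !mulr_ge0 ?expR_ge0 ?(fm_ge0 mm)// (fm_ge0 nuM)//; exact: measurable_level.
have D'gt : 0 < m D' by rewrite lt_neqAle eq_sym nz (fm_ge0 mm).
rewrite -(ler_pM2r D'gt).
have -> : expR ((K + kappa * Q) * r) = expR (K * r) * expR (Q * (kappa * r)).
  by rewrite -expRD; congr expR; ring.
have nD : 0 <= nu (D' `*` [set l]) by rewrite (fm_ge0 nuM)//; exact: measurable_level.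
have h1 := ler_wpM2r (fm_ge0 mm mD) r1.
have h2 := ler_wpM2l (mulr_ge0 (expR_ge0 (Q * (kappa * r))) nD) j.
set e1 := expR (K * r) in h2 *; set e2 := expR _ in h1 h2 *.
set x1 := nu (C' `*` _) in h1 *; set x2 := nu (D' `*` _) in h1 h2 *.
lra.
Qed.


Definition tower_push n (nu : set T -> R) : set T -> R :=
  fun A => nu (iter n f @^-1` A).

Lemma push_fmeas n nu : fmeas nu -> fmeas (tower_push n nu).
Proof. by move=> nuM; apply: fmeas_push nuM; exact: measurable_iter_tower. Qed.

Lemma pushD p q nu A : tower_push (p + q) nu A = tower_push p (tower_push q nu) A.
Proof. by rewrite /tower_push -comp_preimage; congr (nu (_ @^-1` A)); apply/funext => x
    /=; rewrite iterD. Qed.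

(** Since [rho] takes values in [[0, 1]], a larger [r] can be replaced by [1], and a negative [r]
    forces [C] or [D] to be empty. The bounded range is what allows [expR (Q * r) - 1] to be
    estimated linearly in [r]. *)
Lemma regular_of_le1 Q nu : 0 <= Q -> fmeas nu ->
  (forall i l C D r, measurable C -> measurable D -> C `<=` a i -> D `<=` a i ->
    0 <= r <= 1 -> (forall x y, C x -> D y -> rho x y <= r) ->
    nu (C `*` [set l]) * m D <= expR (Q * r) * (m C * nu (D `*` [set l]))) ->
  regular Q nu.
Proof.
move=> Q0 nuM h i l C D r mC mD Ca Da CDr.
have rhs0 : 0 <= expR (Q * r) * (m C * nu (D `*` [set l])).
  by rewrite !mulr_ge0 ?expR_ge0 ?(fm_ge0 mm)// (fm_ge0 nuM)//; exact: measurable_level.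
have [C0|/set0P[x0 Cx0]] := eqVneq C set0.
  by move: rhs0; rewrite C0 set0X (fm0 nuM) mul0r.
have [D0|/set0P[y0 Dy0]] := eqVneq D set0.
  by move: rhs0; rewrite D0 (fm0 mm) mulr0.
have r0 : 0 <= r by exact: le_trans (bm_rho0 bm x0 y0) (CDr _ _ Cx0 Dy0).
have [r1|/ltW r1] := leP r 1; first by apply: (h i) => //; apply/andP.
have := h i l C D 1 mC mD Ca Da; rewrite ler01 lexx => /(_ isT) h1.
apply: (le_trans (h1 _)); first by move=> x y _ _; exact: bm_rho1 bm _ _.
rewrite ler_wpM2r ?ler_expR ?ler_wpM2l// mulr_ge0 ?(fm_ge0 mm)// (fm_ge0 nuM)//.
exact: measurable_level.
Qed.

Lemma preimage_tower_map_succ C l : f @^-1` (C `*` [set l.+1]) =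
  (C `&` [set y | (l.+1 < tau y)%N]) `*` [set l].
Proof.
apply/seteqP; split => -[z k]; rewrite /tower_map /=.
  by case: ifPn => // h [/= Cz [kl]]; rewrite -kl.
by move=> [[Cz h] ->]; rewrite h.
Qed.

Section fixed_regularity.
Variable Q : R.
Hypothesis Q_large : K + kappa * Q + 1 <= Q.
Local Notation Q1 := (K + kappa * Q).

(** Levels above the base are copies of the level below, and at the base [K + kappa * Q <= Q]. This
    inequality makes the same [Q] work for all times. *)
Lemma push1_regular nu : fmeas nu -> regular Q nu ->
  regular Q (fun A => nu (f @^-1` A)).
Proof.
move=> nuM rnu; have [Q0 Q10] := regularity_ge0 (bm_kappa bm) (bm_K bm) Q_large.
apply: regular_of_le1 => //; first exact: (push_fmeas 1 nuM).
move=> i [|l] C D r mC mD Ca Da /andP[r0 r1] CDr.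
  apply: (le_trans (base_regular nuM rnu mC mD CDr)).
  rewrite ler_wpM2r//; last first.
    by rewrite ler_expR ler_wpM2r//; have := Q_large; lra.
  rewrite mulr_ge0 ?(fm_ge0 mm)// (fm_ge0 nuM)//.
  exact: (measurable_preimage_iter 1 (measurable_level _ mD)).
rewrite !preimage_tower_map_succ.
have [[y0 ay0 y0l]|none] := pselect (exists2 y, a i y & (l.+1 < tau y)%N).
  have e B : B `<=` a i -> B `&` [set y | (l.+1 < tau y)%N] = B.
    by move=> Ba; apply: setIidl => z /Ba az /=; rewrite (bm_tau bm az ay0).
  by rewrite !e//; exact: (rnu i).
have e B : B `<=` a i -> B `&` [set y | (l.+1 < tau y)%N] = set0.
  by move=> Ba; apply/seteqP; split => // z [/Ba az zl]; apply: none; exists z.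
by rewrite !e// set0X (fm0 nuM) mul0r !mulr0.
Qed.

Lemma push_regular n nu : fmeas nu -> regular Q nu -> regular Q (tower_push n nu).
Proof.
move=> nuM rnu; elim: n => [//|n IH].
by have := push1_regular (push_fmeas n nuM) IH.
Qed.

Lemma push_base n nu C D r : fmeas nu -> regular Q nu ->
  measurable C -> measurable D -> (forall x y, C x -> D y -> rho x y <= r) ->
  tower_push n.+1 nu (C `*` [set 0%N]) * m D <=
  expR (Q1 * r) * (m C * tower_push n.+1 nu (D `*` [set 0%N])).
Proof.
move=> nuM rnu mC mD CDr.
exact: (base_regular (push_fmeas n nuM) (push_regular n nuM rnu)).
Qed.

(** Compare [C] with the whole of [Y], where [rho <= 1] and [m] has mass one: the density of the
    inflow is within a factor [expR Q1] of its mass. The lower bound that follows exchanges the two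
    sets. *)
Lemma push_base_upper n nu C : fmeas nu -> regular Q nu -> nu setT <= 1 ->
  measurable C -> tower_push n.+1 nu (C `*` [set 0%N]) <= expR Q1 * m C.
Proof.
move=> nuM rnu nu1 mC.
have := push_base n nuM rnu mC measurableT (fun x y _ _ => bm_rho1 bm x y).
rewrite (bm_setT bm) !mulr1 => /le_trans; apply.
rewrite ler_wpM2l ?expR_ge0// ler_piMr ?(fm_ge0 mm)//.
apply: le_trans nu1; rewrite -[nu setT]/(tower_push n.+1 nu setT).
by apply: fm_le => //; [exact: push_fmeas|exact: measurable_level].
Qed.

Lemma push_base_lower n nu D q : fmeas nu -> regular Q nu ->
  measurable D -> q <= tower_push n.+1 nu (setT `*` [set 0%N]) ->
  expR (- Q1) * q * m D <= tower_push n.+1 nu (D `*` [set 0%N]).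
Proof.
move=> nuM rnu mD qle.
have := push_base n nuM rnu measurableT mD (fun x y _ _ => bm_rho1 bm x y).
rewrite (bm_setT bm) mulr1 mul1r => h.
rewrite expRN -mulrA ler_pdivrMl ?expR_gt0//; apply: le_trans h.
by rewrite ler_wpM2r ?(fm_ge0 mm).
Qed.

(** What sits at height [l] at time [j + l] was on the base at time [j], over the same points of
    [Y]. *)
Lemma push_level j l nu C : fmeas nu -> measurable C ->
  tower_push (j + l) nu (C `*` [set l]) <= tower_push j nu (C `*` [set 0%N]).
Proof.
move=> nuM mC; elim: l => [|l IH]; first by rewrite addn0.
apply: le_trans IH; rewrite addnS.
have -> : tower_push (j + l).+1 nu (C `*` [set l.+1]) =
  tower_push (j + l) nu (f @^-1` (C `*` [set l.+1])) by [].
rewrite preimage_tower_map_succ; apply: (fm_le (push_fmeas _ nuM)).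
- apply: measurable_level; apply: measurableI => //.
  exact: (measurable_tau (fun t => (l.+1 < t)%N)).
- exact: measurable_level.
- by move=> [z k] [[]].
Qed.

End fixed_regularity.

Lemma iter_tower_lt j y l : (l + j < tau y)%N -> iter j f (y, l) = (y, l + j)%N.
Proof.
elim: j => [|j IH] h /=; first by rewrite addn0.
rewrite IH /tower_map /=; last by apply: leq_ltn_trans h; rewrite addnS.
by rewrite -addnS h.
Qed.

Lemma iter_tower_return j y l : (0 < j)%N -> (l + j = tau y)%N ->
  iter j f (y, l) = (F y, 0%N).
Proof.
case: j => // j _ h; rewrite iterS iter_tower_lt -?h ?addnS// /tower_map /=.
by rewrite -h addnS ltnn.
Qed.

Lemma iter_tower_invariant j x : tower tau x -> tower tau (iter j f x).
Proof.
elim: j => // j IH /IH; rewrite iterS; set z := iter j f x => tz.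
rewrite /tower_map /tower; case: ifPn => //= _; exact: bm_tau0 bm _.
Qed.

(** A return to the base at a step [i >= 1] leaves the final height at most [j - i], so a point this
    high has only climbed. For [j = 0] nothing is claimed about [tau], since [x] may lie off the
    tower. *)
Lemma iter_tower_high j x : (j <= (iter j f x).2)%N ->
  iter j f x = (x.1, x.2 + j)%N /\ ((0 < j) ==> (x.2 + j < tau x.1))%N.
Proof.
elim: j => [|j IH]; first by rewrite addn0; case: x.
rewrite iterS; move: IH; set z := iter j f x => IH.
rewrite /tower_map; case: ifPn => [h|_] //= hj.
by have [e _] := IH hj; move: h; rewrite e /= addnS => h; rewrite h.
Qed.

End branch_map_theory.

(** * One coupling step *)

Lemma expR_sub1_le {R : realType} (x : R) : expR x - 1 <= x * expR x.
Proof.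
have := expR_ge1Dx (- x); rewrite expRN => h.
have := expR_gt0 x; set e := expR x in h * => e0.
have : (1 + - x) * e <= 1 by rewrite -ler_pdivlMr// div1r.
lra.
Qed.

(** * Size of the mass coupled in one step *)

Section coupled_mass.
Context {R : realType}.
Variables (kappa K Q delta : R) (k0 N1 : nat).
Local Notation Q1 := (K + kappa * Q).

(** The factors are, in order: distortion of one inflow; half of the mass shared among [k0] possible
    return times; and a cost [delta * expR (- K)] for each prescribed return, whose number is at
    most the elapsed time [k0 + N1]. *)
Definition base_bound : R :=
  expR (- Q1) * (2 * k0%:R)^-1 * (delta * expR (- K)) ^+ (k0 + N1).

(* The factor [1 / (Q * expR Q)] is what keeps [nu - coupled_mass * m] regular
   with constant [Q], given that [nu] is regular with constant [Q - 1]. *)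
Definition coupled_mass : R := base_bound / (Q * expR Q).

Hypothesis kappa01 : 0 <= kappa <= 1.
Hypothesis K0 : 0 <= K.
Hypothesis Q_large : K + kappa * Q + 1 <= Q.
Hypothesis delta01 : 0 < delta <= 1.
Hypothesis k00 : (0 < k0)%N.

Lemma base_bound_bounds : 0 < base_bound <= 2^-1.
Proof.
have /andP[dgt d1] := delta01.
have [Q0 Q10] := regularity_ge0 kappa01 K0 Q_large.
have e1 (x : R) : 0 <= x -> expR (- x) <= 1.
  by move=> x0; rewrite -[1 in leRHS]expR0 ler_expR oppr_le0.
have k1 : 1 <= k0%:R :> R by rewrite ler1n.
have kle : (2 * k0%:R)^-1 <= 2^-1 :> R by rewrite lef_pV2 ?posrE; lra.
have kgt : 0 < (2 * k0%:R)^-1 :> R by rewrite invr_gt0; lra.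
have t0 : 0 < delta * expR (- K) by rewrite mulr_gt0 ?expR_gt0.
have t1 : delta * expR (- K) <= 1 by rewrite mulr_ile1 ?expR_ge0 ?e1// ltW.
apply/andP; split; first by rewrite /base_bound !mulr_gt0 ?expR_gt0 ?exprn_gt0.
have p0 := expR_ge0 (- Q1).
apply: (@le_trans _ _ (expR (- Q1) * (2 * k0%:R)^-1)).
  by rewrite ler_piMr ?mulr_ge0 ?(ltW kgt)// exprn_ile1// ltW.
by apply: le_trans kle; rewrite ler_piMl ?e1 ?(ltW kgt).
Qed.

Lemma coupled_mass_bounds : 0 < coupled_mass /\ coupled_mass <= 2^-1 /\
  coupled_mass * (Q * expR Q) = base_bound /\ coupled_mass <= base_bound.
Proof.
have /andP[b0 b1] := base_bound_bounds.
have [Q0 Q10] := regularity_ge0 kappa01 K0 Q_large.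
have Q1' : 1 <= Q by move: Q_large; have := Q10; lra.
have e1 : 1 <= expR Q by rewrite -[1 in leLHS]expR0 ler_expR.
have p1 : 1 <= Q * expR Q by nra.
have c0 : 0 < coupled_mass by rewrite divr_gt0// (lt_le_trans _ p1).
have cE : coupled_mass * (Q * expR Q) = base_bound.
  by rewrite divfK// gt_eqF// (lt_le_trans _ p1).
split => //; split; last split => //; nra.
Qed.

End coupled_mass.

Section coupling_step.
Context {R : realType} {d : measure_display} {Y : measurableType d}.
Variables (m : set Y -> R) (F : Y -> Y) (rho : Y -> Y -> R) (a : nat -> set Y).
Variables (tau : Y -> nat) (kappa K : R).
Hypothesis bm : branch_map m F rho a tau kappa K.
Let mm : fmeas m := bm_fmeas bm.
Local Notation f := (tower_map F tau).
Local Notation T := (Y * nat)%type.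
Local Notation push := (tower_push F tau).
Local Notation regular := (regular m rho a).
Implicit Types (nu : set T -> R).

(** The tails of [tau] are summed over all levels. This summation costs one power of [n] and turns
    the exponent [beta] into [beta - 1]. *)
Lemma tail_le (tl : R) k M nu : fmeas nu -> 0 <= M ->
  (forall l C, measurable C -> nu (C `*` [set l]) <= M * m C) ->
  (forall N, \sum_(l < N) m [set y | (l + k < tau y)%N] <= tl) ->
  nu [set x | (x.2 + k < tau x.1)%N] <= M * tl.
Proof.
move=> nuM M0 bnu htl.
apply: (fm_le_bound (P := fun l => setT `*` [set l])) => //.
- exact: (measurable_tower_rel bm (fun l t => (l + k < t)%N)).
- by move=> l; exact: measurable_level.
- by apply/trivIsetP => i j _ _ ij; apply/seteqP; split => // -[z l] [[_ /= ->] [_ /=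
    ji]]; move/eqP: ij.
- by apply/seteqP; split => // -[z l] _; exists l.
move=> N; apply: (@le_trans _ _ (M * \sum_(l < N) m [set y | (l + k < tau y)%N])); last first.
  by rewrite ler_wpM2l.
rewrite mulr_sumr; apply: ler_sum => l _.
rewrite (_ : _ `&` _ = [set y | (l + k < tau y)%N] `*` [set (l : nat)]).
  by apply: bnu; exact: (measurable_tau bm (fun t => (l + k < t)%N)).
by apply/seteqP; split => -[z k'] /=; [move=> [h [_ <-]]|move=> [h ->]].
Qed.

(** Pigeonhole: at least half of the mass has one of the [k] residual times [1, ..., k], and all the
    mass of a given residual time returns simultaneously. *)
Lemma some_inflow nu k : fmeas nu -> nu setT = 1 -> nu (~` tower tau) = 0 ->
  (0 < k)%N -> nu [set x | (x.2 + k < tau x.1)%N] <= 2^-1 ->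
  exists2 i, (0 < i <= k)%N &
    (2 * k%:R)^-1 <= push i nu (setT `*` [set 0%N]).
Proof.
move=> nuM nu1 nut k0 nuk; apply: contrapT => none.
(* [G j] collects the tower points of residual time at most [j], and [B j] those of residual time
   exactly [j]. *)
pose G j := [set x : T | (x.2 < tau x.1 <= x.2 + j)%N].
pose B j := [set x : T | tau x.1 = x.2 + j]%N.
have mG j : measurable (G j).
  exact: (measurable_tower_rel bm (fun l t => (l < t <= l + j)%N)).
have mB j : measurable (B j).
  exact: (measurable_tower_rel bm (fun l t => (t = l + j)%N)).
pose q : R := (2 * k%:R)^-1.
have Bq i : (0 < i <= k)%N -> nu (B i) < q.
  move=> hi; rewrite ltNge; apply/negP => qB; apply: none; exists i => //.
  apply: (le_trans qB); rewrite /tower_push; apply: fm_le => //.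
    by apply: (measurable_preimage_iter bm); exact: measurable_level.
  move=> [y l] /= hB; rewrite iter_tower_return//; by case/andP: hi.
have Gq j : (j <= k)%N -> nu (G j) <= j%:R * q /\ ((0 < j)%N -> nu (G j) < j%:R * q).
  elim: j => [_|j IH jk].
    split => //; rewrite mul0r (_ : G 0%N = set0) ?(fm0 nuM)//.
    by apply/seteqP; split => // x /=; rewrite /G /= addn0; lia.
  have [Gj _] := IH (ltnW jk).
  have Bj : nu (B j.+1) < q by apply: Bq; lia.
  have -> : G j.+1 = G j `|` B j.+1.
    by apply/seteqP; split => x; rewrite /G /B /=; lia.
  rewrite fm_additive//; last first.
    by apply/seteqP; split => // x; rewrite /G /B /=; lia.
  by rewrite -natr1 mulrDl mul1r; split => [|_]; lra.
have [_ /(_ k0)] := Gq k (leqnn k).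
have -> : k%:R * q = 2^-1.
  by rewrite /q invfM mulrC -mulrA mulVf ?mulr1// pnatr_eq0 -lt0n.
have mS : measurable [set x : T | (x.2 + k < tau x.1)%N].
  exact: (measurable_tower_rel bm (fun l t => (l + k < t)%N)).
have mt : measurable (tower tau).
  exact: (measurable_tower_rel bm (fun l t => (l < t)%N)).
have : nu setT = nu (tower tau) + nu (~` tower tau).
  by rewrite -fm_additive ?setUCr ?setICr//; exact: measurableC.
rewrite nut nu1 addr0.
have -> : tower tau = G k `|` [set x : T | (x.2 + k < tau x.1)%N].
  by apply/seteqP; split => x; rewrite /tower /G /=; lia.
rewrite fm_additive//; last first.
  by apply/seteqP; split => // x; rewrite /G /=; lia.
by move=> h1 h2; lra.
Qed.

Lemma push_off_tower k nu : fmeas nu -> nu (~` tower tau) = 0 ->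
  push k nu (~` tower tau) = 0.
Proof.
move=> nuM nut.
have mt : measurable (~` tower tau).
  by apply: measurableC; exact: (measurable_tower_rel bm (fun l t => (l < t)%N)).
apply/eqP; rewrite eq_le (fm_ge0 (push_fmeas bm k nuM)) ?andbT//.
rewrite -nut /tower_push; apply: fm_le => //.
  exact: (measurable_preimage_iter bm).
by move=> x h tx; apply: h; exact: (iter_tower_invariant bm).
Qed.

(** Compare [C] with [Y] in each cell where [tau] equals [j]: the image under [F] of the mass of the
    cell has density at least [expR (- K)] times that mass. *)
Lemma return_mass j C : measurable C ->
  m [set y | tau y = j] * m C <= expR K * m ([set y | tau y = j] `&` F @^-1` C).
Proof.
move=> mC.
have mt : measurable [set y | tau y = j] by exact: (measurable_tau bm (fun t => t = j)).
have mF := measurable_preimage_F bm mC.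
apply: (fm_le_pieces (P := a)) => //.
- exact: measurableI.
- exact: bm_a bm.
- exact: bm_disj bm.
- exact: bm_cover bm.
move=> i; have [[y0 ay0 ty0]|none] := pselect (exists2 y, a i y & tau y = j).
  have e B : [set y | tau y = j] `&` B `&` a i = a i `&` B.
    apply/seteqP; split => z /=; first by tauto.
    by move=> [az Bz]; rewrite (bm_tau bm az ay0).
  have := bm_jac bm i measurableT mC (fun x y _ _ => bm_rho1 bm x y).
  by rewrite e (bm_setT bm) mul1r mulr1 preimage_setT setIT -[X in X `&` a i]setIT e setIT.
have e B : [set y | tau y = j] `&` B `&` a i = set0.
  by apply/seteqP; split => // z [[/= tz _] az]; apply: none; exists z.
by rewrite -[X in X `&` a i]setIT !e (fm0 mm) mul0r mulr0.
Qed.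

Lemma climb1 delta j c nu : fmeas nu -> 0 <= c -> (0 < j)%N ->
  delta <= m [set y | tau y = j] ->
  (forall C, measurable C -> c * m C <= nu (C `*` [set 0%N])) ->
  forall C, measurable C ->
    (c * (delta * expR (- K))) * m C <= push j nu (C `*` [set 0%N]).
Proof.
move=> nuM c0 j0 hd hc C mC.
pose C' := [set y | tau y = j] `&` F @^-1` C.
have mC' : measurable C'.
  apply: measurableI; first exact: (measurable_tau bm (fun t => t = j)).
  exact: (measurable_preimage_F bm).
apply: (@le_trans _ _ (nu (C' `*` [set 0%N]))); last first.
  rewrite /tower_push; apply: fm_le => //; first exact: measurable_level.
    by apply: (measurable_preimage_iter bm); exact: measurable_level.
  by move=> [y l] [[/= ty Cy] ->] /=; rewrite iter_tower_return.
apply: (le_trans _ (hc _ mC')); rewrite -!mulrA ler_wpM2l//.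
rewrite expRN mulrCA ler_pdivrMl ?expR_gt0//.
apply: (le_trans _ (return_mass j mC)).
by rewrite ler_wpM2r ?(fm_ge0 mm).
Qed.

(** Each return costs one factor [delta * expR (- K) <= 1]. The exponent counts time instead of
    returns, so that the bound depends on [s] only through its sum. *)
Lemma climb delta (I : seq nat) s c nu : fmeas nu -> 0 <= c -> 0 <= delta <= 1 ->
  (forall i, i \in I -> (0 < i)%N /\ delta <= m [set y | tau y = i]) ->
  {subset s <= I} ->
  (forall C, measurable C -> c * m C <= nu (C `*` [set 0%N])) ->
  forall C, measurable C ->
    c * (delta * expR (- K)) ^+ (sumn s) * m C <= push (sumn s) nu (C `*` [set 0%N]).
Proof.
move=> nuM c0 /andP[d0 d1] HI.
have K0 := bm_K bm.
have e1 : expR (- K) <= 1 by rewrite -[1 in leRHS]expR0 ler_expR; lra.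
have e0 := expR_ge0 (- K).
have t0 : 0 <= delta * expR (- K) by rewrite mulr_ge0.
have t1 : delta * expR (- K) <= 1 by rewrite mulr_ile1.
elim: s => [|j s IH] sI hc C mC /=; first by rewrite expr0 mulr1; exact: hc.
have [j0 dj] := HI j (sI j (mem_head _ _)).
have sI' : {subset s <= I} by move=> i si; apply: sI; rewrite inE si orbT.
rewrite pushD.
have cs0 : 0 <= c * (delta * expR (- K)) ^+ sumn s by rewrite mulr_ge0 ?exprn_ge0.
have := climb1 (push_fmeas bm (sumn s) nuM) cs0 j0 dj (IH sI' hc) mC.
apply: le_trans; rewrite ler_wpM2r ?(fm_ge0 mm)// -mulrA ler_wpM2l//.
by rewrite exprD mulrC ler_wpM2l ?exprn_ge0// -{2}[delta * _]expr1 ler_wiXn2l.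
Qed.

Section fixed_regularity.
Variable Q : R.
Hypothesis Q_large : K + kappa * Q + 1 <= Q.
Local Notation Q1 := (K + kappa * Q).

(** The factor [2] in the density bound leaves room for dividing by [1 - coupled_mass >= 1 / 2]. *)
Record good nu : Prop := Good {
  good_fmeas : fmeas nu;
  good_setT : nu setT = 1;
  good_tower : nu (~` tower tau) = 0;
  good_bounded : forall l C, measurable C ->
    nu (C `*` [set l]) <= 2 * expR Q1 * m C;
  good_regular : regular Q nu
}.

(** After the waiting time nothing is left at heights [l >= j], and lower heights were fed through
    the base. The bound thus involves no density bound on [nu], which a normalised slice would not
    have. *)
Lemma push_bounded nu j k l C : fmeas nu -> regular Q nu -> nu setT = 1 ->
  nu [set x | (x.2 + k < tau x.1)%N] = 0 -> (0 < j)%N -> (k <= j)%N ->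
  measurable C -> push j nu (C `*` [set l]) <= expR Q1 * m C.
Proof.
move=> nuM rnu nu1 nuk j0 kj mC.
have [lj|jl] := ltnP l j.
  have -> : j = ((j - l.+1).+1 + l)%N by lia.
  apply: (le_trans (push_level bm _ _ nuM mC)).
  by apply: (push_base_upper bm Q_large) => //; rewrite nu1.
apply: (@le_trans _ _ 0); last by rewrite mulr_ge0 ?expR_ge0 ?(fm_ge0 mm).
rewrite -nuk /tower_push; apply: fm_le => //.
- by apply: (measurable_preimage_iter bm); exact: measurable_level.
- exact: (measurable_tower_rel bm (fun l t => (l + k < t)%N)).
move=> x [/= _ hl].
have /iter_tower_high[_] : (j <= (iter j f x).2)%N by rewrite hl.
by rewrite j0 /= => h; apply: leq_ltn_trans h; rewrite leq_add2l.
Qed.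

Section with_return_times.
Variables (delta tl : R) (I : seq nat) (k0 N1 : nat).
Hypothesis delta01 : 0 < delta <= 1.
Hypothesis HI : forall i, i \in I -> (0 < i)%N /\ delta <= m [set y | tau y = i].
Hypothesis HN1 : forall j, (N1 <= j)%N -> exists2 s, {subset s <= I} & sumn s = j.
Hypothesis Htl : forall N, \sum_(l < N) m [set y | (l + k0 < tau y)%N] <= tl.
Hypothesis tl_small : expR Q1 * tl <= 2^-1.
Hypothesis k00 : (0 < k0)%N.

Local Notation base_bound := (base_bound kappa K Q delta k0 N1).

Lemma push_base_bound nu k C : fmeas nu -> regular Q nu -> nu setT = 1 ->
  nu (~` tower tau) = 0 -> nu [set x | (x.2 + k < tau x.1)%N] = 0 ->
  (0 < k)%N -> measurable C ->
  base_bound * m C <= push (k + (k0 + N1)) nu (C `*` [set 0%N]).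
Proof.
move=> nuM rnu nu1 nut nuk kpos mC.
have nuM' := push_fmeas bm k nuM.
have t1 := push_off_tower k nuM nut.
have b : push k nu [set x | (x.2 + k0 < tau x.1)%N] <= 2^-1.
  apply: le_trans tl_small; apply: (tail_le nuM' (expR_ge0 _) _ Htl).
  by move=> l C' mC'; exact: (push_bounded l nuM rnu nu1 nuk).
have [i /andP[i0 ik] hi] := some_inflow nuM' nu1 t1 k00 b.
rewrite -pushD in hi.
(* The return times in [s] fill the remaining time exactly, so that the total does not depend on the
   unknown [i]. *)
have [s sI ss] := HN1 (leq_addl (k0 - i) N1).
have -> : (k + (k0 + N1) = sumn s + (i + k))%N by rewrite ss; lia.
rewrite pushD.
have lowb C' : measurable C' ->
    expR (- Q1) * (2 * k0%:R)^-1 * m C' <= push (i + k) nu (C' `*` [set 0%N]).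
  move=> mC'; have -> : (i + k = (i + k).-1.+1)%N by lia.
  apply: (push_base_lower bm Q_large) => //.
  by have <- : (i + k = (i + k).-1.+1)%N by lia.
have c0 : 0 <= expR (- Q1) * (2 * k0%:R)^-1.
  by rewrite mulr_ge0 ?expR_ge0// invr_ge0 mulr_ge0.
have /andP[dgt d1] := delta01.
have d01 : 0 <= delta <= 1 by rewrite ltW.
have := climb (push_fmeas bm (i + k) nuM) c0 d01 HI sI lowb mC.
apply: le_trans; rewrite ler_wpM2r ?(fm_ge0 mm)// /base_bound ler_wpM2l//.
have K0 := bm_K bm.
have e1 : expR (- K) <= 1 by rewrite -[1 in leRHS]expR0 ler_expR; lra.
rewrite ler_wiXn2l//; last by rewrite ss leq_add2r leq_subr.
- by rewrite mulr_ge0 ?expR_ge0// ltW.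
- by rewrite mulr_ile1 ?expR_ge0// ltW.
Qed.

Local Notation coupled_mass := (coupled_mass kappa K Q delta k0 N1).

Definition base_measure : set T -> R := fun A => m [set y | A (y, 0%N)].

Lemma base_measure_fmeas : fmeas base_measure.
Proof. exact: (fmeas_push (g := fun y => (y, 0%N))). Qed.

Lemma base_measure_level0 C : base_measure (C `*` [set 0%N]) = m C.
Proof. by rewrite /base_measure; congr m; apply/seteqP; split => y //= []. Qed.

Lemma base_measure_levelS C l : base_measure (C `*` [set l.+1]) = 0.
Proof.
rewrite /base_measure (_ : [set _ | _] = set0) ?(fm0 mm)//.
by apply/seteqP; split => y //= [].
Qed.

(** The split-off part does not depend on [nu], hence it cancels when two measures are treated at
    the same time; only the factor [1 - coupled_mass] remains in front of their difference. *)
Lemma coupling_step nu k : fmeas nu -> regular Q nu -> nu setT = 1 ->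
  nu (~` tower tau) = 0 -> nu [set x | (x.2 + k < tau x.1)%N] = 0 -> (0 < k)%N ->
  exists2 nu', good nu' & forall A, measurable A ->
    push (k + (k0 + N1)) nu A =
    coupled_mass * base_measure A + (1 - coupled_mass) * nu' A.
Proof.
move=> nuM rnu nu1 nut nuk kpos.
have [c0 [c12 [cE cb]]] := coupled_mass_bounds N1 (bm_kappa bm) (bm_K bm) Q_large delta01
    k00; set c := coupled_mass in c0 c12 cE cb *.
have [Q0 Q10] := regularity_ge0 (bm_kappa bm) (bm_K bm) Q_large.
pose P := push (k + (k0 + N1)) nu.
have PM : fmeas P by exact: (push_fmeas bm _ nuM).
have rP : regular Q P by exact: (push_regular bm Q_large _ nuM rnu).
have hb C : measurable C -> base_bound * m C <= P (C `*` [set 0%N]).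
  by move=> mC; exact: push_base_bound nuM rnu nu1 nut nuk kpos mC.
have Pb l C : measurable C -> P (C `*` [set l]) <= expR Q1 * m C.
  by apply: (push_bounded _ nuM rnu nu1 nuk); [rewrite addn_gt0 kpos|exact: leq_addr].
have bM := base_measure_fmeas.
have cle A : measurable A -> c * base_measure A <= P A.
  move=> mA; have mA0 := measurable_slice 0 mA.
  apply: (@le_trans _ _ (P ([set y | A (y, 0%N)] `*` [set 0%N]))).
    apply: (le_trans _ (hb _ mA0)).
    by rewrite ler_wpM2r ?(fm_ge0 mm).
  apply: (fm_le PM) => //; first exact: measurable_level.
  by move=> [y l] [/= Ay ->].
have c1 : 0 < 1 - c by lra.
exists (fun A => (1 - c)^-1 * (P A - c * base_measure A)); last first.
  by move=> A mA; rewrite mulrA divff ?mul1r ?gt_eqF// addrC subrK.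
split.
- apply: fmeas_scale; first by rewrite invr_ge0 ltW.
  by apply: fmeas_sub => //; apply: fmeas_scale => //; exact: ltW.
- rewrite /P /tower_push preimage_setT nu1 /base_measure (_ : [set _ | _] = setT)//.
  by rewrite (bm_setT bm) mulr1 mulVf// gt_eqF.
- rewrite {1}/P (push_off_tower _ nuM nut) /base_measure (_ : [set _ | _] = set0).
    by rewrite (fm0 mm) mulr0 subr0 mulr0.
  by apply/seteqP; split => // y; rewrite /tower /= (bm_tau0 bm y).
- move=> l C mC; have mCl := measurable_level l mC.
  rewrite mulrC ler_pdivrMr//; have := Pb l C mC; have := fm_ge0 bM mCl.
  have : 0 <= expR Q1 * m C by rewrite mulr_ge0 ?expR_ge0 ?(fm_ge0 mm).
  by move=> h1 h2 h3; nra.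
apply: (regular_of_le1 bm) => //.
  apply: fmeas_scale; first by rewrite invr_ge0 ltW.
  by apply: fmeas_sub => //; apply: fmeas_scale => //; exact: ltW.
move=> i l C D r mC mD Ca Da /andP[r0 r1] CDr.
rewrite -[_^-1 * _ * _]mulrA [m C * _]mulrCA [expR _ * _]mulrCA.
apply: ler_wpM2l; first by rewrite invr_ge0 ltW.
case: l => [|l]; last first.
  by rewrite !base_measure_levelS mulr0 !subr0; exact: (rP i).
rewrite !base_measure_level0.
have hP : P (C `*` [set 0%N]) * m D <= expR (Q1 * r) * (m C * P (D `*` [set 0%N])).
  have := push_base bm Q_large (k + (k0 + N1)).-1 nuM rnu mC mD CDr.
  by rewrite prednK// addn_gt0 kpos.
have hD := hb D mD.
have mC0 := fm_ge0 mm mC; have mD0 := fm_ge0 mm mD.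
set p := P (D `*` _) in hP hD *; set p' := P _ in hP *.
set e1 := expR (Q1 * r) in hP; set e := expR (Q * r).
(* The loss [e - 1] and the gap [e - e1] are both of order [r], the gap because [Q1 <= Q - 1]. Hence
   one [c] serves every [r]. *)
suff h : c * (e - 1) * m D <= (e - e1) * p.
  have := ler_wpM2l mC0 h; lra.
have ee1 : 0 <= e - e1 by rewrite subr_ge0 ler_expR ler_wpM2r//; have := Q_large; lra.
apply: (@le_trans _ _ ((e - e1) * (base_bound * m D))); last by rewrite ler_wpM2l.
rewrite mulrA ler_wpM2r//.
have h1 : e - 1 <= Q * r * expR Q.
  apply: (le_trans (expR_sub1_le _)); rewrite ler_wpM2l ?mulr_ge0//.
  by rewrite ler_expR ler_piMr.
have h2 : r <= e - e1.
  have e1ge : 1 <= e1 by rewrite -[1 in leLHS]expR0 ler_expR mulr_ge0.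
  have -> : e = e1 * expR ((Q - Q1) * r) by rewrite -expRD; congr expR; ring.
  have := expR_ge1Dx ((Q - Q1) * r); set z := expR _ => hz.
  have hr : r <= (Q - Q1) * r by rewrite ler_peMl//; have := Q_large; lra.
  nra.
rewrite -cE; nra.
Qed.

End with_return_times.
End fixed_regularity.
End coupling_step.

(** * The renewal inequality *)

Section renewal.
Context {R : realType} {d : measure_display} {Y : measurableType d}.
Variables (m : set Y -> R) (F : Y -> Y) (rho : Y -> Y -> R) (a : nat -> set Y).
Variables (tau : Y -> nat) (kappa K : R).
Hypothesis bm : branch_map m F rho a tau kappa K.
Local Notation T := (Y * nat)%type.
Local Notation push := (tower_push F tau).
Local Notation regular := (regular m rho a).
Local Notation late k := [set x : T | (x.2 + k < tau x.1)%N].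
Implicit Types (nu : set T -> R).

Lemma regular_scale Q nu s : 0 <= s -> regular Q nu ->
  regular Q (fun A => s * nu A).
Proof.
move=> s0 h i l C D r mC mD Ca Da CDr.
have := ler_wpM2l s0 (h i l C D r mC mD Ca Da CDr); lra.
Qed.

Lemma regular_add Q nu nu' : regular Q nu -> regular Q nu' ->
  regular Q (fun A => nu A + nu' A).
Proof.
move=> h h' i l C D r mC mD Ca Da CDr.
have := h i l C D r mC mD Ca Da CDr; have := h' i l C D r mC mD Ca Da CDr; lra.
Qed.

(* On [a i] at level [l] the return time is constant, so a condition on it
   keeps or discards the whole piece. *)
Lemma regular_restr Q nu (P : nat -> nat -> Prop) : fmeas nu -> regular Q nu ->
  regular Q (fun A => nu (A `&` [set x | P x.2 (tau x.1)])).
Proof.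
move=> nuM h i l C D r mC mD Ca Da CDr.
have [[y0 ay0 py0]|none] := pselect (exists2 y, a i y & P l (tau y)).
  have e B : B `<=` a i ->
      (B `*` [set l]) `&` [set x | P x.2 (tau x.1)] = B `*` [set l].
    move=> Ba; apply: setIidl => -[z k] [/= /Ba az ->].
    by rewrite (bm_tau bm az ay0).
  by rewrite !e//; exact: (h i).
have e B : B `<=` a i -> (B `*` [set l]) `&` [set x | P x.2 (tau x.1)] = set0.
  move=> Ba; apply/seteqP; split => // -[z k] [[/= /Ba az ->] pz].
  by apply: none; exists z.
by rewrite !e// (fm0 nuM) mul0r !mulr0.
Qed.

Lemma late_measurable k : measurable (late k).
Proof. exact: (measurable_tower_rel bm (fun l t => (l + k < t)%N)). Qed.

(** The slice is a constant proportion of the restriction to the early points. Scaling preserves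
    regularity, whereas cutting out a subset of the right mass could destroy it. *)
Lemma peel Q nu k w : fmeas nu -> regular Q nu -> nu (~` tower tau) = 0 ->
  nu (late k) <= w -> 0 <= w <= nu setT ->
  exists nu' nu'', [/\ [/\ fmeas nu', regular Q nu', nu' (~` tower tau) = 0,
      nu' (late k) = 0 & nu' setT = nu setT - w],
    [/\ fmeas nu'', regular Q nu'', nu'' (~` tower tau) = 0,
      nu'' setT = w & forall j, (k <= j)%N -> nu'' (late j) = nu (late j)] &
    forall A, measurable A -> nu A = nu' A + nu'' A].
Proof.
move=> nuM rnu nut nuk /andP[w0 w1].
pose S := ~` late k.
have mL := late_measurable k.
have mS : measurable S by exact: measurableC.
have mt : measurable (~` tower tau).
  by apply: measurableC; exact: (measurable_tower_rel bm (fun l t => (l < t)%N)).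
have sumS A : measurable A -> nu A = nu (A `&` late k) + nu (A `&` S).
  by move=> mA; rewrite (fm_split nuM mA mL) -setDE.
have nuST := sumS _ measurableT; rewrite !setTI in nuST.
have S0 : 0 <= nu S by exact: fm_ge0.
(* If [nu S = 0], the quotient is [0] by convention, which is the right value because then
   [w = nu setT]. *)
pose s := (nu setT - w) / nu S.
have sE : s * nu S = nu setT - w.
  have [z|nz] := eqVneq (nu S) 0; last by rewrite divfK.
  by rewrite z mulr0; lra.
have s01 : 0 <= s <= 1.
  have [z|nz] := eqVneq (nu S) 0; first by rewrite /s z invr0 mulr0 lexx ler01.
  have Sgt : 0 < nu S by rewrite lt_neqAle eq_sym nz.
  by rewrite divr_ge0 ?subr_ge0//= ler_pdivrMr// mul1r; lra.
have /andP[s0 s1] := s01.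
have rS : regular Q (fun A => nu (A `&` S)).
  exact: (regular_restr (fun l t => ~ (l + k < t)%N)).
have rL : regular Q (fun A => nu (A `&` late k)).
  exact: (regular_restr (fun l t => (l + k < t)%N)).
have tS B : measurable B -> nu (~` tower tau `&` B) = 0.
  move=> mB; apply/eqP; rewrite eq_le -{1}nut (fm_ge0 nuM) ?andbT//; last exact: measurableI.
  by apply: (fm_le nuM) => //; exact: measurableI.
have lS j : (k <= j)%N -> late j `&` S = set0.
  by move=> kj; apply/seteqP; split => // x [] /=; rewrite /S /=; lia.
exists (fun A => s * nu (A `&` S)), (fun A => (1 - s) * nu (A `&` S) + nu (A `&` late k)).
split.
- split.
  + by apply: fmeas_scale => //; exact: fmeas_restr.
  + exact: regular_scale.
  + by rewrite tS ?mulr0.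
  + by rewrite lS// (fm0 nuM) mulr0.
  + by rewrite setTI.
- split.
  + apply: fmeas_add; last exact: fmeas_restr.
    by apply: fmeas_scale; [rewrite subr_ge0|exact: fmeas_restr].
  + by apply: regular_add => //; apply: regular_scale => //; rewrite subr_ge0.
  + by rewrite !tS// mulr0 addr0.
  + by rewrite !setTI; lra.
  + move=> j kj; rewrite lS// (fm0 nuM) mulr0 add0r; congr nu.
    by apply: setIidl => x /=; lia.
- by move=> A mA; rewrite (sumS A mA); ring.
Qed.

Variables (Q c : R) (N0 : nat) (mb : set T -> R).
Hypothesis c01 : 0 <= c <= 1.
Local Notation good := (good m rho a tau kappa K Q).
Hypothesis step : forall nu k, fmeas nu -> regular Q nu -> nu setT = 1 ->
  nu (~` tower tau) = 0 -> nu (late k) = 0 -> (0 < k)%N ->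
  exists2 nu', good nu' & forall A, measurable A ->
    push (k + N0) nu A = c * mb A + (1 - c) * nu' A.
Variables (r b : nat -> R).
Hypothesis r0 : r 0%N = 1.
Hypothesis r_ge0 : forall k, 0 <= r k.
Hypothesis r_noninc : forall k, r k.+1 <= r k.
Hypothesis r_late : forall nu k, good nu -> nu (late k) <= r k.
Hypothesis b_renewal : forall n, 1 <= b n \/
  (N0 <= n)%N /\ (1 - c) * (\sum_(0 <= j < n - N0)
    (r j - r j.+1) * b (n - N0 - j.+1)%N) + r (n - N0)%N <= b n.

(** This describes what is left after removing the first [k] slices. The mass is exactly [r k] for
    either measure, and the tail bound guarantees that the next slice can be taken. *)
Definition uncoupled k nu := [/\ fmeas nu, regular Q nu, nu (~` tower tau) = 0,
  nu setT = r k & forall j, (k <= j)%N -> nu (late j) <= r j].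

Lemma push_diff_step n k nu1 nu2 A : measurable A -> (k + N0 < n)%N ->
  (forall n', (n' < n)%N -> forall nu1 nu2, good nu1 -> good nu2 ->
     push n' nu1 A - push n' nu2 A <= b n') ->
  uncoupled k nu1 -> uncoupled k nu2 ->
  exists nu1' nu2', [/\ uncoupled k.+1 nu1', uncoupled k.+1 nu2' &
    push n nu1 A - push n nu2 A <=
    (1 - c) * ((r k - r k.+1) * b (n - N0 - k.+1)%N) +
    (push n nu1' A - push n nu2' A)].
Proof.
move=> mA kn IH.
have main nu : uncoupled k nu -> exists nu' nu'', [/\ uncoupled k.+1 nu'',
    [/\ fmeas nu', regular Q nu', nu' (~` tower tau) = 0,
      nu' (late k.+1) = 0 & nu' setT = r k - r k.+1] &
    forall A, measurable A -> nu A = nu' A + nu'' A].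
  move=> [nuM rnu nut nuT nul].
  have [] := @peel Q nu k.+1 (r k.+1) nuM rnu nut (nul _ (leqnSn k)).
    by rewrite r_ge0 nuT r_noninc.
  move=> nu' [nu'' [[p1 p2 p3 p4 p5] [q1 q2 q3 q4 q5] h]].
  exists nu', nu''; split => //; last by rewrite -nuT.
  by split => // j kj; rewrite q5//; apply: nul; exact: ltnW.
move=> /main[p1 [q1 [u1 [p1M rp1 p1t p1l p11] e1]]].
move=> /main[p2 [q2 [u2 [p2M rp2 p2t p2l p21] e2]]].
exists q1, q2; split => //.
have mA' : measurable (iter n (tower_map F tau) @^-1` A).
  exact: (measurable_preimage_iter bm).
have -> : push n nu1 A = push n p1 A + push n q1 A by exact: e1.
have -> : push n nu2 A = push n p2 A + push n q2 A by exact: e2.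
suff : push n p1 A - push n p2 A <=
    (1 - c) * ((r k - r k.+1) * b (n - N0 - k.+1)%N) by lra.
set w := r k - r k.+1 in p11 p21 *.
have w0 : 0 <= w by rewrite subr_ge0.
(* A slice of mass zero cannot be normalised, but it contributes nothing. *)
have [wz|wnz] := eqVneq w 0.
  have z p : fmeas p -> p setT = w -> push n p A = 0.
    move=> pM pw; apply/eqP; rewrite eq_le (fm_ge0 pM mA') andbT.
    by rewrite -wz -pw; apply: (fm_le pM).
  by rewrite !z// wz mul0r mulr0 subrr.
have wgt : 0 < w by rewrite lt_neqAle eq_sym wnz.
have nrm p : fmeas p -> regular Q p -> p (~` tower tau) = 0 ->
    p (late k.+1) = 0 -> p setT = w ->
    exists2 nu', good nu' & forall B, measurable B ->
      push (k.+1 + N0) p B = w * (c * mb B + (1 - c) * nu' B).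
  move=> pM rp pt pl pw.
  have wi : 0 <= w^-1 by rewrite invr_ge0.
  have [] := @step (fun A => w^-1 * p A) k.+1 (fmeas_scale wi pM) (regular_scale wi rp).
  - by rewrite pw mulVf.
  - by rewrite pt mulr0.
  - by rewrite pl mulr0.
  - by [].
  move=> nu' gnu' h; exists nu' => // B mB; rewrite -h// /tower_push.
  by rewrite mulrA divff// mul1r.
have [n1 g1 h1] := nrm p1 p1M rp1 p1t p1l p11.
have [n2 g2 h2] := nrm p2 p2M rp2 p2t p2l p21.
set n' := (n - N0 - k.+1)%N.
have nE : n = (n' + (k.+1 + N0))%N by rewrite /n'; lia.
have mA'' : measurable (iter n' (tower_map F tau) @^-1` A).
  exact: (measurable_preimage_iter bm).
(* The common terms in [mb] cancel, and the induction hypothesis applies to [n1] and [n2] at the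
   earlier time [n']. *)
have -> : push n p1 A = w * (c * push n' mb A + (1 - c) * push n' n1 A).
  by rewrite nE pushD; exact: h1.
have -> : push n p2 A = w * (c * push n' mb A + (1 - c) * push n' n2 A).
  by rewrite nE pushD; exact: h2.
have hn : (n' < n)%N by rewrite nE addSn addnS ltnS leq_addr.
have := IH n' hn n1 n2 g1 g2 => hb.
have c1 : 0 <= w * (1 - c) by rewrite mulr_ge0// subr_ge0; have /andP[] := c01.
have := ler_wpM2l c1 hb; lra.
Qed.

Lemma push_diff n nu1 nu2 A : measurable A -> good nu1 -> good nu2 ->
  push n nu1 A - push n nu2 A <= b n.
Proof.
move=> mA; elim/ltn_ind: n nu1 nu2 => n IH nu1 nu2 g1 g2.
have le1 k nu : uncoupled k nu -> 0 <= push n nu A <= r k.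
  move=> [nuM _ _ nur _]; have mA' := measurable_preimage_iter bm n mA.
  by apply/andP; split; [exact: (fm_ge0 nuM mA')|rewrite -nur; apply: (fm_le nuM)].
have good0 nu : good nu -> uncoupled 0 nu.
  by move=> g; have [nuM nu1' nut _ nur] := g; split; rewrite ?r0// => j _; exact: r_late.
have [b1|[Nn bn]] := b_renewal n.
  have := le1 _ _ (good0 _ g1); have := le1 _ _ (good0 _ g2); rewrite r0; lra.
apply: le_trans bn; set J := (n - N0)%N.
(* Induction on the number of slices still to be removed. When none is left, the remainders have
   mass [r J] and are bounded trivially. *)
suff H i : (i <= J)%N -> forall nu1 nu2, uncoupled (J - i) nu1 -> uncoupled (J - i) nu2 ->
    push n nu1 A - push n nu2 A <=
    (1 - c) * (\sum_(J - i <= j < J) (r j - r j.+1) * b (J - j.+1)%N) + r J.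
  by have := H J (leqnn J); rewrite subnn; apply; exact: good0.
elim: i => [_|i IHi iJ] {g1 g2} {}nu1 {}nu2 u1 u2.
  rewrite subn0 in u1 u2 *; rewrite big_geq// mulr0 add0r.
  have := le1 _ _ u1; have := le1 _ _ u2; lra.
have kn : (J - i.+1 + N0 < n)%N by rewrite /J in iJ *; lia.
have [n1 [n2 [v1 v2 h]]] := push_diff_step mA kn IH u1 u2.
have e : (J - i.+1).+1 = (J - i)%N by lia.
rewrite e in v1 v2.
have h' := IHi (ltnW iJ) n1 n2 v1 v2.
rewrite big_ltn; last by lia.
by rewrite e -/J in h *; rewrite mulrDr; lra.
Qed.

End renewal.

(** * Numerical semigroups *)

Lemma gcd_seq_le (M : nat) (I : seq nat) :
  (forall i, i \in I -> (0 < i <= M)%N) -> I != [::] ->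
  (0 < \big[gcdn/0%N]_(i <- I) i <= M)%N.
Proof.
case: I => // i I h _; rewrite big_cons gcdn_gt0.
have /andP[i0 iM] := h i (mem_head _ _); rewrite i0 /=.
by apply: leq_trans iM; apply: dvdn_leq => //; exact: dvdn_gcdl.
Qed.

(* The bound grows by at most [M * M] each time a new element makes the gcd
   drop, which keeps it independent of the length of [I]. *)
Lemma semigroup_gcd (M : nat) (I : seq nat) :
  (forall i, i \in I -> (0 < i <= M)%N) -> I != [::] ->
  forall j, (M * M * (M - \big[gcdn/0%N]_(i <- I) i) <= j)%N ->
  (\big[gcdn/0%N]_(i <- I) i %| j)%N ->
  exists2 s, {subset s <= I} & sumn s = j.
Proof.
elim: I => // i I IH h _ j; rewrite big_cons.
have hI k : k \in I -> (0 < k <= M)%N by move=> kI; apply: h; rewrite inE kI orbT.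
have /andP[i0 iM] := h i (mem_head _ _).
have [->|I0] := eqVneq I [::].
  rewrite big_nil gcdn0 => _ /dvdnP[k ->]; exists (nseq k i).
    by move=> x; rewrite mem_nseq inE => /andP[].
  by rewrite sumn_nseq mulnC.
have /andP[g0 gM] := gcd_seq_le hI I0.
set g := \big[gcdn/0%N]_(i <- I) i in IH g0 gM *.
have subI (s : seq nat) : {subset s <= I} -> {subset s <= i :: I}.
  by move=> sI x /sI xI; rewrite inE xI orbT.
move=> jge gj.
have [gi|gi] := boolP (g %| i)%N.
  have e : gcdn i g = g by exact/gcdn_idPr.
  rewrite e in jge gj.
  by have [s sI sj] := IH hI I0 j jge gj; exists s => //; exact: subI.
have g'lt : (gcdn i g < g)%N.
  rewrite ltn_neqAle (dvdn_leq g0 (dvdn_gcdr _ _)) andbT.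
  by apply: contra gi => /eqP <-; exact: dvdn_gcdl.
have [u v uv _] := egcdnP g i0.
(* By Bezout, [k] copies of [i] have the residue of [j] modulo [g]. Reducing [k] modulo [g] keeps
   [k * i] below [M * M]. *)
pose k := ((u * (j %/ gcdn i g)) %% g)%N.
have kg : (k < g)%N by rewrite ltn_mod.
have kij : (k * i = j %[mod g])%N.
  rewrite /k modnMml.
  have -> : (u * (j %/ gcdn i g) * i = v * (j %/ gcdn i g) * g + j)%N.
    by rewrite mulnAC uv mulnDl [(gcdn i g * _)%N]mulnC (divnK gj) mulnAC.
  by rewrite modnMDl.
have kile : (k * i <= M * M)%N by apply: leq_mul => //; exact: leq_trans (ltnW kg) gM.
have jbig : (M * M + M * M * (M - g) <= j)%N.
  by apply: leq_trans jge; rewrite -mulnS leq_mul2l orbC; apply/orP; left; lia.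
have kij' : (k * i <= j)%N.
  by apply: (leq_trans kile); apply: leq_trans jbig; exact: leq_addr.
have [||s sI sj] := IH hI I0 (j - k * i)%N.
- by rewrite leq_subRL//; apply: leq_trans jbig; rewrite leq_add2r.
- by rewrite -eqn_mod_dvd// kij.
exists (nseq k i ++ s).
  move=> x; rewrite mem_cat => /orP[|/(subI _ sI)//].
  by rewrite mem_nseq inE => /andP[_ ->].
by rewrite sumn_cat sumn_nseq sj mulnC subnKC.
Qed.

Lemma semigroup_gcd1 (M : nat) (I : seq nat) :
  (forall i, i \in I -> (0 < i <= M)%N) -> \big[gcdn/0%N]_(i <- I) i = 1%N ->
  forall j, (M * M * M <= j)%N -> exists2 s, {subset s <= I} & sumn s = j.
Proof.
move=> h g1 j hj; apply: (@semigroup_gcd M) => //.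
- by apply/eqP => I0; move: g1; rewrite I0 big_nil.
- by apply: leq_trans hj; rewrite leq_mul2l leq_subr orbT.
- by rewrite g1 dvd1n.
Qed.

(** * Polynomial rates *)

Section polynomial_rate.
Context {R : realType}.
Implicit Types (s C c : R).

(** A discrete integral comparison that makes the tail sum telescope; it rests on
    [ln ((x + 1) / x) >= 1 / (x + 1)]. *)
Lemma powR_step s (x : R) : 0 < s -> 0 < x ->
  (x + 1) `^ (- (s + 1)) <= s^-1 * (x `^ (- s) - (x + 1) `^ (- s)).
Proof.
move=> s0 x0; have x1 : 0 < x + 1 by lra.
rewrite -ler_pdivrMl ?invr_gt0// invrK.
have -> : (x + 1) `^ (- (s + 1)) = (x + 1) `^ (- s) / (x + 1).
  by rewrite opprD powRD ?powR_inv1 ?(gt_eqF x1) ?implybT// ltW.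
have e : x `^ (- s) = (x + 1) `^ (- s) * ((x + 1) / x) `^ s.
  rewrite powRM ?invr_ge0 ?ltW// mulrA -powRD ?addNr ?powRr0 ?mul1r; last first.
    by rewrite (gt_eqF x1) implybT.
  by rewrite -[x^-1]powR_inv1 ?ltW// -powRrM mulN1r.
have p0 : 0 < (x + 1) `^ (- s) by rewrite powR_gt0.
suff h : 1 + s / (x + 1) <= ((x + 1) / x) `^ s.
  by rewrite e; have := ler_wpM2l (ltW p0) h; lra.
have hl : (x + 1)^-1 <= ln ((x + 1) / x).
  have -> : ln ((x + 1) / x) = - ln (x / (x + 1)).
    by rewrite -lnV ?invf_div// posrE divr_gt0.
  have -> : x / (x + 1) = 1 + (- (x + 1)^-1).
    by field; rewrite gt_eqF.
  rewrite lerNr; apply: le_ln1Dx; rewrite ltrN2 invf_lt1//; lra.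
rewrite /powR gt_eqF ?divr_gt0//; apply: le_trans (expR_ge1Dx _).
by rewrite lerD2l ler_wpM2l// ltW.
Qed.

Lemma sum_powR_tail s (k N : nat) : 0 < s -> (0 < k)%N ->
  \sum_(l < N) (l + k).+1%:R `^ (- (s + 1)) <= s^-1 * k%:R `^ (- s).
Proof.
move=> s0 k0; have si : 0 < s^-1 by rewrite invr_gt0.
suff h : \sum_(l < N) (l + k).+1%:R `^ (- (s + 1)) <=
    s^-1 * (k%:R `^ (- s) - (N + k)%:R `^ (- s)).
  apply: (le_trans h); rewrite ler_wpM2l ?(ltW si)// gerBl; exact: powR_ge0.
elim: N => [|N IH]; first by rewrite big_ord0 add0n subrr mulr0.
rewrite big_ord_recr /=.
have Nk : 0 < (N + k)%:R :> R by rewrite ltr0n addn_gt0 k0 orbT.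
have := powR_step s0 Nk; rewrite addSn -!natr1; lra.
Qed.

(** A nonzero power of [0] is [0] by convention, so the value at [k = 0] has to be set
    separately. *)
Definition poly_rate C s (k : nat) : R :=
  if k == 0%N then 1 else Num.min 1 (C * k%:R `^ (- s)).

Lemma poly_rate_ge0 C s k : 0 <= C -> 0 <= poly_rate C s k.
Proof.
move=> C0; rewrite /poly_rate; case: ifP => _ //.
by rewrite le_min ler01 mulr_ge0 ?powR_ge0.
Qed.

Lemma poly_rate_le1 C s k : poly_rate C s k <= 1.
Proof. by rewrite /poly_rate; case: ifP => _ //; rewrite ge_min lexx. Qed.

Lemma poly_rate_le C s k : (0 < k)%N -> poly_rate C s k <= C * k%:R `^ (- s).
Proof. by rewrite /poly_rate; case: k => // k _ /=; rewrite ge_min lexx orbT. Qed.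

Lemma powRN_noninc s (x y : R) : 0 <= s -> 0 < x -> x <= y ->
  y `^ (- s) <= x `^ (- s).
Proof.
move=> s0 x0 xy; rewrite !powRN lef_pV2 ?posrE ?powR_gt0//; last by lra.
by apply: ge0_ler_powR; rewrite // nnegrE; lra.
Qed.

Lemma poly_rate_noninc C s j k : 0 <= C -> 0 <= s -> (j <= k)%N ->
  poly_rate C s k <= poly_rate C s j.
Proof.
move=> C0 s0; case: j => [_|j]; first exact: poly_rate_le1.
case: k => // k jk; rewrite /poly_rate /= le_min2// ler_wpM2l//.
by apply: powRN_noninc => //; rewrite ?ltr0n ?ler_nat.
Qed.

Lemma expr_lower (M : nat) (q : R) : 0 <= q <= 1 -> 1 - M%:R * q <= (1 - q) ^+ M.
Proof.
move=> /andP[q0 q1]; elim: M => [|M IH]; first by rewrite expr0 mul0r subr0.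
have M0 : 0 <= M%:R * q by rewrite mulr_ge0.
rewrite exprS -natr1; have h : 0 <= 1 - q by lra.
have := ler_wpM2l h IH; nra.
Qed.

Lemma poly_rate_far C s (M : nat) (w : R) n j : 1 <= C -> 0 < s <= M%:R ->
  0 < w < 1 -> (0 < n)%N -> (1 - w) * n%:R <= j%:R ->
  (1 - w) ^+ M * poly_rate C s j <= C * n%:R `^ (- s).
Proof.
move=> C1 /andP[s0 sM] /andP[w0 w1] n0 hj.
have n0R : 0 < n%:R :> R by rewrite ltr0n.
have wn : 0 < (1 - w) * n%:R by rewrite mulr_gt0// subr_gt0.
have j0 : (0 < j)%N by rewrite -(ltr0n R); exact: lt_le_trans hj.
have C0 : 0 <= C by lra.
apply: (@le_trans _ _ ((1 - w) ^+ M * (C * ((1 - w) * n%:R) `^ (- s)))).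
  rewrite ler_wpM2l ?exprn_ge0 ?subr_ge0 ?(ltW w1)//.
  apply: (le_trans (poly_rate_le _ _ j0)); rewrite ler_wpM2l//.
  by apply: powRN_noninc => //; exact: ltW.
rewrite mulrCA ler_wpM2l// powRM ?(ltW n0R) ?subr_ge0 ?(ltW w1)// mulrA.
rewrite ler_piMl ?powR_ge0// powRN ler_pdivrMr ?powR_gt0 ?subr_gt0// mul1r.
rewrite -powR_mulrn ?subr_ge0 ?(ltW w1)//; apply: ger_powR => //.
by rewrite subr_gt0 w1/=; lra.
Qed.

Lemma sum_weights (r b : nat -> R) (x : R) (j0 j1 : nat) : (j0 <= j1)%N ->
  (forall j, r j.+1 <= r j) ->
  (forall j, (j0 <= j < j1)%N -> b j <= x) ->
  \sum_(j0 <= j < j1) (r j - r j.+1) * b j <= (r j0 - r j1) * x.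
Proof.
move=> jj hr hb; rewrite -opprB -(telescope_sumr r jj) -sumrN mulr_suml.
apply: ler_sum_nat => j hj; rewrite opprB ler_wpM2l ?subr_ge0//; exact: hb.
Qed.

Lemma quotient_block (q N0 n : nat) : (3 <= q)%N -> (q * N0.+1 < n)%N ->
  let k := (n %/ q)%N in
  [/\ (N0 < k)%N, (k <= n - N0)%N, (k < n - N0)%N, ((N0 + k) * q <= 2 * n)%N &
      (n <= k * (2 * q))%N].
Proof.
move=> q3 nbig k; have q0 : (0 < q)%N by lia.
have kq : (k * q <= n)%N by exact: leq_trunc_div.
have kq' : (n < k.+1 * q)%N by exact: ltn_ceil.
have Nk : (N0.+1 <= k)%N by rewrite leq_divRL// mulnC ltnW.
have k3 : (k * 3 <= n)%N by apply: leq_trans kq; rewrite leq_mul2l q3 orbT.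
have k1 : (k < n - N0)%N by lia.
split => //; first exact: ltnW.
  by rewrite mulnDl mul2n -addnn leq_add//; apply: leq_trans kq; rewrite leq_mul2r; lia.
rewrite mulnCA mul2n -addnn; apply: (leq_trans (ltnW kq')).
by rewrite mulSn leq_add2r leq_pmull//; lia.
Qed.

(** The sum is split at [n / q]. For small [j] the remaining time is nearly [n], and the loss uses
    up half of the gain [c]. For large [j] the weights add up to at most [r (n / q)], which a large
    [C] absorbs. *)
Lemma poly_renewal c C1 (N0 M : nat) : 0 < c <= 2^-1 -> 0 <= C1 ->
  exists2 C, 1 <= C & forall s, 0 < s <= M%:R -> forall n,
    1 <= poly_rate C s n \/ (N0 <= n)%N /\
    (1 - c) * (\sum_(0 <= j < n - N0)
      (poly_rate C1 s j - poly_rate C1 s j.+1) * poly_rate C s (n - N0 - j.+1)) +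
    poly_rate C1 s (n - N0) <= poly_rate C s n.
Proof.
move=> /andP[c0 c12] C10.
(* With [w = 2 / q] this makes [M * w <= c / 2], so Bernoulli's inequality bounds the power of
   [1 - w] from below. *)
have [q [q_large q3']] : exists q : nat, 4 * M%:R / c <= q%:R /\ (3 <= q)%N.
  exists (Num.bound (4 * M%:R / c) + 3)%N; split; last exact: leq_addl.
  have h : 0 <= 4 * M%:R / c by rewrite divr_ge0 ?mulr_ge0// ltW.
  by rewrite natrD; have := archi_boundP h; lra.
have q3 : 3 <= q%:R :> R by rewrite ler_nat.
pose w : R := 2 / q%:R.
have w01 : 0 < w < 1 by rewrite divr_gt0 ?ltr_pdivrMr//=; lra.
have wM : 1 - c / 2 <= (1 - w) ^+ M.
  apply: le_trans (expr_lower _ _); last by case/andP: w01 => /ltW -> /ltW ->.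
  rewrite lerD2l lerN2 /w mulrA ler_pdivrMr; last by lra.
  by move: q_large; rewrite ler_pdivrMr//; lra.
have cwM : 1 - c <= (1 - c / 2) * (1 - w) ^+ M by nra.
(* The first entry keeps the rate equal to [1] until [n] exceeds [q * N0.+1]; the second gives
   [r (n / q)] at most a proportion [c / 4] of the target. *)
pose C := Num.max ((q * N0.+1)%:R ^+ M) (4 * C1 * (2 * q%:R) ^+ M / c).
have Ca : (q * N0.+1)%:R ^+ M <= C by rewrite le_max lexx.
have Cb : 4 * C1 * (2 * q%:R) ^+ M / c <= C by rewrite le_max lexx orbT.
have C1' : 1 <= C.
  by apply: le_trans Ca; rewrite exprn_ege1// ler1n muln_gt0 andbT (leq_trans _ q3').
have C0 : 0 <= C by lra.
exists C => // s s0M [|n]; first by left; rewrite /poly_rate.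
set n' := n.+1; have [b1|bn] := leP 1 (poly_rate C s n'); [by left|right].
have /andP[s0 sM] := s0M.
have bE : poly_rate C s n' = C * n'%:R `^ (- s).
  by move: bn; rewrite /poly_rate /= minEle; case: ifP; rewrite ?ltxx.
have n'0 : 0 < n'%:R :> R by rewrite ltr0n.
have Cn : C < n'%:R `^ s.
  by move: bn; rewrite bE powRN ltr_pdivrMr ?powR_gt0// mul1r.
have nbig : (q * N0.+1 < n')%N.
  have h : (q * N0.+1)%:R ^+ M < n'%:R ^+ M :> R.
    apply: (le_lt_trans Ca); apply: (lt_le_trans Cn).
    by rewrite -powR_mulrn//; apply: ler_powR; rewrite ?ler1n.
  rewrite ltnNge; apply/negP => le; move: h; apply/negP; rewrite -leNgt.
  by rewrite lerXn2r ?nnegrE// ler_nat.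
have [NK KJ KJ' NKq nKq] := quotient_block q3' nbig.
set K1 := (n' %/ q)%N in NK KJ KJ' NKq nKq.
have Nn : (N0 <= n')%N by apply: ltnW; apply: leq_trans nbig; rewrite ltnS -{1}[N0]mul1n
    leq_mul// (leq_trans _ q3').
have NKn : (N0 + K1 <= n')%N by rewrite -leq_subRL.
split => //.
set J := (n' - N0)%N in KJ KJ' *.
rewrite (big_cat_nat (leq0n K1) KJ)/=.
have rn j : poly_rate C1 s j.+1 <= poly_rate C1 s j.
  by apply: poly_rate_noninc => //; exact: ltW.
have S2 : \sum_(K1 <= j < J) (poly_rate C1 s j - poly_rate C1 s j.+1) *
    poly_rate C s (J - j.+1) <= poly_rate C1 s K1.
  apply: (le_trans (@sum_weights _ (fun j => poly_rate C s (J - j.+1)) 1 _ _ KJ rn _)).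
    by move=> j _; exact: poly_rate_le1.
  by rewrite mulr1 gerBl poly_rate_ge0.
have nw : (1 - w) * n'%:R <= (J - K1)%:R.
  have -> : (J - K1 = n' - (N0 + K1))%N by rewrite /J subnDA.
  rewrite natrB//.
  rewrite mulrBl mul1r lerD2l lerN2 /w mulrAC ler_pdivlMr; last by lra.
  by rewrite -natrM -[2]/(2%:R) -natrM ler_nat.
have J0 : (0 < J - K1)%N by rewrite subn_gt0.
have S1 : \sum_(0 <= j < K1) (poly_rate C1 s j - poly_rate C1 s j.+1) *
    poly_rate C s (J - j.+1) <= poly_rate C s (J - K1).
  apply: (le_trans (@sum_weights _ (fun j => poly_rate C s (J - j.+1))
    (poly_rate C s (J - K1)) _ _ (leq0n _) rn _)).
    by move=> j hj; apply: poly_rate_noninc => //; [exact: ltW|by rewrite leq_sub2l//;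
        case/andP: hj].
  rewrite ler_piMl ?poly_rate_ge0//.
  have := poly_rate_ge0 s K1 C10; rewrite {2}/poly_rate/=; lra.
have rJ : poly_rate C1 s J <= poly_rate C1 s K1 by apply: poly_rate_noninc => //; exact: ltW.
have far := @poly_rate_far C s M w n' (J - K1) C1' s0M w01 (ltn0Sn _) nw.
rewrite bE; set X := C * _ in far *.
have rK : poly_rate C1 s K1 <= c / 4 * X.
  apply: (le_trans (poly_rate_le _ _ (leq_trans (ltn0Sn _) NK))).
  have h : n'%:R / (2 * q%:R) <= K1%:R :> R.
    rewrite ler_pdivrMr; last by lra.
    by rewrite -[2]/(2%:R) -!natrM ler_nat.
  have hp : 0 < n'%:R / (2 * q%:R) :> R by rewrite divr_gt0//; lra.
  have h' : K1%:R `^ (- s) <= n'%:R `^ (- s) * (2 * q%:R) ^+ M.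
    apply: (le_trans (powRN_noninc (ltW s0) hp h)).
    have q2 : 1 <= 2 * q%:R :> R by lra.
    have q2' : 0 <= 2 * q%:R :> R by lra.
    rewrite powRM ?invr_ge0 ?(ltW n'0)// ler_wpM2l ?powR_ge0//.
    rewrite -[(2 * q%:R)^-1]powR_inv1// -powRrM mulN1r opprK -powR_mulrn//.
    exact: ler_powR.
  apply: (le_trans (ler_wpM2l C10 h')).
  have -> : C1 * (n'%:R `^ (- s) * (2 * q%:R) ^+ M) =
    c / 4 * (4 * C1 * (2 * q%:R) ^+ M / c * n'%:R `^ (- s)).
    by field; rewrite gt_eqF.
  by rewrite ler_wpM2l ?ler_wpM2r ?powR_ge0//; lra.
set y := poly_rate C s (J - K1) in S1 far *.
have y0 : 0 <= y by exact: poly_rate_ge0.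
have hy : (1 - c) * y <= (1 - c / 2) * X.
  apply: (@le_trans _ _ ((1 - c / 2) * (1 - w) ^+ M * y)); first by rewrite ler_wpM2r.
  by rewrite -mulrA ler_wpM2l//; lra.
set s1 := \sum_(0 <= j < K1) _ in S1 *; set s2 := \sum_(K1 <= j < J) _ in S2 *.
have r0 : 0 <= poly_rate C1 s K1 by exact: poly_rate_ge0.
have c1 : 0 <= 1 - c by lra.
have h1 : (1 - c) * (s1 + s2) <= (1 - c) * y + poly_rate C1 s K1.
  rewrite mulrDr lerD// ?ler_wpM2l//; apply: (@le_trans _ _ ((1 - c) * poly_rate C1 s K1)).
    by rewrite ler_wpM2l.
  by rewrite ler_piMl//; lra.
lra.
Qed.

End polynomial_rate.

(** * Stretched exponential rates *)

Section stretched_exponential_rate.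
Context {R : realType}.
Implicit Types (g c A B C : R).

(** A number in [[0, 1]] is at most its power of exponent [g]; this is applied to the fractions
    [x / (x + y)] and [y / (x + y)]. *)
Lemma powR_subadd g (x y : R) : 0 < g <= 1 -> 0 <= x -> 0 <= y ->
  (x + y) `^ g <= x `^ g + y `^ g.
Proof.
move=> /andP[g0 g1] x0 y0.
have [xy0|xy0] := eqVneq (x + y) 0.
  have -> : x + y = 0 by [].
  by rewrite powR0 ?gt_eqF// addr_ge0 ?powR_ge0.
have z0 : 0 < x + y by rewrite lt_neqAle eq_sym xy0 addr_ge0.
have key (u : R) : 0 <= u -> u <= x + y -> u / (x + y) * (x + y) `^ g <= u `^ g.
  move=> u0 uz; have t0 : 0 <= u / (x + y) by rewrite divr_ge0// ltW.
  have t1 : u / (x + y) <= 1 by rewrite ler_pdivrMr// mul1r.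
  have {2}-> : u = u / (x + y) * (x + y) by rewrite divfK.
  rewrite powRM ?(ltW z0)// ler_wpM2r ?powR_ge0//.
  have [->|tn] := eqVneq (u / (x + y)) 0; first exact: powR_ge0.
  by apply: ger1_powR => //; rewrite t1 lt_neqAle eq_sym tn t0.
have hx := key x x0 (ltac:(lra)).
have hy := key y y0 (ltac:(lra)).
apply: le_trans (lerD hx hy); rewrite -mulrDl -mulrDl divff// mul1r//.
Qed.

Lemma powR_nat_noninc g (j k : nat) : 0 <= g -> (j <= k)%N ->
  j%:R `^ g <= k%:R `^ g :> R.
Proof. by move=> g0 jk; apply: ge0_ler_powR; rewrite // ?nnegrE// ler_nat. Qed.

Lemma expR_ge_pow (y : R) n : 0 <= y -> (0 < n)%N -> (y / n%:R) ^+ n <= expR y.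
Proof.
move=> y0 n0; have nR : 0 < n%:R :> R by rewrite ltr0n.
have {2}-> : y = n%:R * (y / n%:R) by rewrite mulrC divfK// gt_eqF.
rewrite expRM_natl; apply: lerXn2r; rewrite ?nnegrE ?expR_ge0 ?divr_ge0 ?(ltW nR)//.
by have := expR_ge1Dx (y / n%:R); lra.
Qed.

Lemma sum_inv_sqr_le2 N : \sum_(l < N) (l.+1%:R ^+ 2)^-1 <= 2 :> R.
Proof.
suff h : \sum_(l < N) (l.+1%:R ^+ 2)^-1 <= 2 - 2 / N.+1%:R :> R.
  by apply: (le_trans h); rewrite gerBl divr_ge0.
elim: N => [|N IH]; first by rewrite big_ord0 divr1 subrr.
rewrite big_ord_recr /=.
suff h : (N.+1%:R ^+ 2)^-1 <= 2 / N.+1%:R - 2 / N.+2%:R :> R.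
  by apply: (le_trans (lerD IH h)); rewrite addrA subrK.
have x1 : 1 <= N.+1%:R :> R by rewrite ler1n.
rewrite -[N.+2%:R]natr1; set x : R := N.+1%:R in x1 *.
have -> : 2 / x - 2 / (x + 1) = 2 / (x * (x + 1)).
  by field; apply/andP; split; rewrite gt_eqF//; lra.
have -> : 2 / (x * (x + 1)) = (x * (x + 1) / 2)^-1 by rewrite invf_div.
have xx : 0 < x * (x + 1) by rewrite mulr_gt0; lra.
have x2 : 0 < x ^+ 2 by rewrite exprn_gt0//; lra.
by rewrite lef_pV2 ?posrE ?divr_gt0// expr2; nra.
Qed.

(** The exponential dominates a power of order [2 * M], and [g >= 1 / M] turns the terms into
    multiples of inverse squares, uniformly in [g]. *)
Lemma sum_exp_powR (M L' : nat) : (0 < M)%N -> (0 < L')%N ->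
  exists2 S : R, 0 <= S & forall g, M%:R^-1 <= g -> forall N,
    \sum_(l < N) expR (- (L'%:R^-1 * l.+1%:R `^ g)) <= S.
Proof.
move=> M0 L0; pose n := (M * 2)%N; have n0 : (0 < n)%N by rewrite /n; lia.
have LR : 0 < L'%:R :> R by rewrite ltr0n.
have nR : 0 < n%:R :> R by rewrite ltr0n.
exists ((n%:R * L'%:R) ^+ n * 2); first by rewrite mulr_ge0 ?exprn_ge0 ?mulr_ge0.
move=> g Mg N; apply: (@le_trans _ _ (\sum_(l < N) (n%:R * L'%:R) ^+ n * (l.+1%:R ^+ 2)^-1)).
  apply: ler_sum => l _; set j : R := l.+1%:R.
  have j1 : 1 <= j by rewrite ler1n.
  pose x := j `^ M%:R^-1.
  have x0 : 0 < x by rewrite powR_gt0//; lra.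
  apply: (@le_trans _ _ (expR (- (L'%:R^-1 * x)))).
    by rewrite ler_expR lerN2 ler_wpM2l ?invr_ge0 ?(ltW LR)//; apply: ler_powR.
  rewrite expRN; apply: (@le_trans _ _ ((L'%:R^-1 * x / n%:R) ^+ n)^-1).
    rewrite lef_pV2 ?posrE ?expR_gt0 ?exprn_gt0 ?divr_gt0 ?mulr_gt0 ?invr_gt0//.
    by apply: expR_ge_pow => //; rewrite mulr_ge0 ?invr_ge0 ?ltW.
  have -> : L'%:R^-1 * x / n%:R = x / (n%:R * L'%:R).
    by field; rewrite !gt_eqF.
  have xn : x ^+ n = j ^+ 2.
    have j0 : 0 <= j by lra.
    have MR : M%:R != 0 :> R by rewrite pnatr_eq0 -lt0n.
    have xM : x ^+ M = j by rewrite -powR_mulrn ?(ltW x0)// -powRrM mulVf// powRr1.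
    by rewrite /n exprM xM.
  by rewrite expr_div_n xn invf_div.
by rewrite -mulr_sumr ler_wpM2l ?sum_inv_sqr_le2// exprn_ge0 ?mulr_ge0.
Qed.

Definition exp_rate C A g (k : nat) : R := C * expR (- (A * k%:R `^ g)).

(** Half of the exponent is spent on summability in [l], and the other half remains as decay in
    [k]. *)
Lemma sum_exp_tail (M : nat) : (0 < M)%N ->
  exists2 S : R, 0 <= S & forall g, M%:R^-1 <= g <= 1 -> forall k N,
    \sum_(l < N) expR (- (M%:R^-1 * (l + k).+1%:R `^ g)) <=
    exp_rate S (2 * M)%:R^-1 g k.
Proof.
move=> M0; have [|S S0 hS] := @sum_exp_powR M (2 * M)%N M0; first by lia.
exists S => // g /andP[Mg g1] k N.
have MR : 0 < M%:R :> R by rewrite ltr0n.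
have g0 : 0 <= g by apply: le_trans Mg; rewrite invr_ge0 ltW.
apply: (@le_trans _ _ (\sum_(l < N) expR (- ((2 * M)%:R^-1 * l.+1%:R `^ g)) *
    expR (- ((2 * M)%:R^-1 * k%:R `^ g)))); last first.
  by rewrite -mulr_suml /exp_rate ler_wpM2r ?expR_ge0 ?hS.
apply: ler_sum => l _; rewrite -expRD ler_expR -opprD lerN2 -mulrDr natrM invfM.
have h1 : l.+1%:R `^ g <= (l + k).+1%:R `^ g :> R by apply: powR_nat_noninc => //; lia.
have h2 : k%:R `^ g <= (l + k).+1%:R `^ g :> R by apply: powR_nat_noninc => //; lia.
have Mi : 0 < M%:R^-1 :> R by rewrite invr_gt0.
rewrite [_^-1 * M%:R^-1]mulrC -mulrA ler_wpM2l ?(ltW Mi)//; lra.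
Qed.

(** The point is that the coefficient of the exponential tends to [0] with [B], while [B'] stays
    fixed. *)
Lemma expR_affine_bound B B' (x : R) : 0 <= x -> 0 < B -> B <= B' / 2 ->
  expR (B * x) <= 1 + 2 * B / B' * expR (B' * x).
Proof.
move=> x0 B0 BB'; have B'0 : 0 < B' by lra.
have h1 := expR_sub1_le (B * x).
have h2 : x <= 2 / B' * expR (B' / 2 * x).
  have h := expR_ge1Dx (B' / 2 * x).
  apply: (@le_trans _ _ (2 / B' * (B' / 2 * x))).
    by rewrite le_eqVlt; apply/orP; left; apply/eqP; field; rewrite gt_eqF.
  by rewrite ler_wpM2l ?divr_ge0 ?(ltW B'0)//; lra.
have h3 : expR (B * x) <= expR (B' / 2 * x) by rewrite ler_expR ler_wpM2r.
have h4 : expR (B' * x) = expR (B' / 2 * x) * expR (B' / 2 * x).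
  by rewrite -expRD; congr expR; field.
have e0 := expR_ge0 (B * x).
have h5 : x * expR (B * x) <= 2 / B' * expR (B' * x).
  by rewrite h4 mulrA ler_pM.
have := ler_wpM2l (ltW B0) h5; move: h1.
have -> : B * (2 / B' * expR (B' * x)) = 2 * B / B' * expR (B' * x) by ring.
by move=> u v; lra.
Qed.

Lemma exp_rate_ge0 C A g k : 0 <= C -> 0 <= exp_rate C A g k.
Proof. by move=> C0; rewrite mulr_ge0 ?expR_ge0. Qed.

Lemma exp_rate_noninc C A g j k : 0 <= C -> 0 <= A -> 0 <= g -> (j <= k)%N ->
  exp_rate C A g k <= exp_rate C A g j.
Proof.
move=> C0 A0 g0 jk; rewrite ler_wpM2l// ler_expR lerN2 ler_wpM2l//.
exact: powR_nat_noninc.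
Qed.

(** The weights add up to at most one, and the excess vanishes with [B]. The rate [B' + B'] of [r]
    pays for the factor [expR (B' * x)] and still leaves a summable series. *)
Lemma sum_exp_weights (r : nat -> R) C1 B B' S g J : 0 <= C1 -> 0 < g ->
  0 < B -> B <= B' / 2 -> r 0%N = 1 -> (forall k, 0 <= r k) ->
  (forall k, r k.+1 <= r k) ->
  (forall k, r k <= exp_rate C1 (B' + B') g k) ->
  (forall N, \sum_(l < N) expR (- (B' * l.+1%:R `^ g)) <= S) ->
  \sum_(0 <= j < J) (r j - r j.+1) * expR (B * j%:R `^ g) <=
  1 + 2 * B / B' * (C1 * (1 + S)).
Proof.
move=> C10 g0 B0 BB' r0 r_ge0 r_dec r_le hS.
have B'0 : 0 < B' by lra.
have S0 : 0 <= S by have := hS 0%N; rewrite big_ord0.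
have k0 : 0 <= 2 * B / B' by rewrite divr_ge0// ?mulr_ge0// ltW.
have powg0 (k : nat) : 0 <= k%:R `^ g :> R by exact: powR_ge0.
apply: (@le_trans _ _ (\sum_(0 <= j < J) ((r j - r j.+1) * 1 +
    2 * B / B' * (C1 * expR (- (B' * j%:R `^ g)))))).
  apply: ler_sum_nat => j _.
  have rj : 0 <= r j - r j.+1 by rewrite subr_ge0.
  have h := ler_wpM2l rj (expR_affine_bound (powg0 j) B0 BB').
  apply: (le_trans h); rewrite mulrDr lerD2l mulrCA ler_wpM2l//.
  apply: (@le_trans _ _ (exp_rate C1 (B' + B') g j * expR (B' * j%:R `^ g))).
    by rewrite ler_wpM2r ?expR_ge0//; apply: le_trans (r_le j); rewrite gerBl.
  by rewrite /exp_rate -mulrA -expRD mulrDl opprD addrNK.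
rewrite big_split /= -mulr_sumr -mulr_sumr; apply: lerD.
  apply: (le_trans (sum_weights (b := fun=> 1) (x := 1) (leq0n J) r_dec _)) => //.
  by rewrite mulr1 r0 gerBl.
rewrite ler_wpM2l// ler_wpM2l//.
case: J => [|J]; first by rewrite big_geq//; lra.
rewrite big_nat_recl// lerD//.
  by rewrite powR0 ?gt_eqF// mulr0 oppr0 expR0.
by rewrite big_mkord; apply: hS.
Qed.

Lemma renewal_index (n N0 j : nat) : (N0 <= n)%N -> (j < n - N0)%N ->
  (n <= n - N0 - j.+1 + j + N0.+1)%N.
Proof. lia. Qed.

Lemma exp_renewal_arith c C C1 (X : R) : 0 < c <= 2^-1 -> 0 <= C -> 0 <= C1 ->
  0 <= X -> 8 * C1 <= c * C -> forall th, th = c / 4 ->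
  (1 - c) * (C * ((1 + th) * X) * (1 + th)) + C1 * ((1 + th) * X) <= C * X.
Proof.
move=> /andP[c0 c12] C0 C10 X0 Cc th thE; have th18 : th <= 8^-1 by lra.
suff h : (1 - c) * (C * (1 + th) * (1 + th)) + C1 * (1 + th) <= C.
  have := ler_wpM2r X0 h; lra.
have h1 : (1 - c) * ((1 + th) * (1 + th)) <= 1 - c / 4 by rewrite thE; nra.
have := ler_wpM2l C0 h1; nra.
Qed.

(** By subadditivity of the power, going back [j] steps costs at most [expR (B * j%:R ^ g)]. For
    small [B] the weighted sum of these costs barely exceeds one, so the factor [1 - c] prevails. *)
Lemma exp_renewal c C1 (N0 M L' : nat) : 0 < c <= 2^-1 -> 1 <= C1 ->
  (0 < M)%N -> (0 < L')%N ->
  exists B C, [/\ 0 < B, 1 <= C & forall g, M%:R^-1 <= g <= 1 ->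
    let r k := Num.min 1 (exp_rate C1 L'%:R^-1 g k) in
    forall n, 1 <= exp_rate C B g n \/ (N0 <= n)%N /\
    (1 - c) * (\sum_(0 <= j < n - N0)
      (r j - r j.+1) * exp_rate C B g (n - N0 - j.+1)) +
    r (n - N0)%N <= exp_rate C B g n].
Proof.
move=> /andP[c0 c12] C11 M0 L0; have c1 : 0 <= 1 - c by lra.
have LR : 0 < L'%:R :> R by rewrite ltr0n.
have MR : 0 < M%:R :> R by rewrite ltr0n.
have [|S S0 hS] := @sum_exp_powR M (2 * L')%N M0; first by lia.
pose B' : R := (2 * L')%:R^-1.
have B'0 : 0 < B' by rewrite invr_gt0 ltr0n; lia.
have AB' : L'%:R^-1 = B' + B'.
  by rewrite /B' natrM; field; rewrite gt_eqF.
pose th := c / 4; have th0 : 0 < th by rewrite /th; lra.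
pose e : R := expR 1.
have e1 : 1 <= e by rewrite /e; have := expR_ge1Dx (1 : R); lra.
pose n1 : R := N0.+1%:R.
have n11 : 1 <= n1 by rewrite ler1n.
pose D := 2 * (C1 * (1 + S)).
have D0 : 0 < D by rewrite /D; nra.
(* The three bounds serve [expR_affine_bound], the cost of the delay [N0 + 1], and the weighted sum;
   each of the last two then costs a factor at most [1 + th]. *)
pose B := Num.min (B' / 2) (Num.min (th / (e * n1)) (th * B' / D)).
have Bb : B <= B' / 2 by rewrite ge_min lexx.
have Ba : B <= th / (e * n1) by rewrite !ge_min lexx orbT.
have Bc : B <= th * B' / D by rewrite !ge_min lexx !orbT.
have en0 : 0 < e * n1 by nra.
have B0 : 0 < B.
  by rewrite !lt_min !divr_gt0 ?mulr_gt0//; lra.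
have Ba' : B * n1 * e <= th by move: Ba; rewrite ler_pdivlMr//; lra.
have Bn1 : B * n1 <= 1 by rewrite /th in Ba'; nra.
have Bc' : 2 * B / B' * (C1 * (1 + S)) <= th.
  move: Bc; rewrite ler_pdivlMr// /D => h.
  rewrite mulrAC ler_pdivrMr//; lra.
pose E0 := expR (B * n1).
have E0th : E0 <= 1 + th.
  have := expR_sub1_le (B * n1); rewrite -/E0 => h.
  have : E0 <= e by rewrite /E0 /e ler_expR.
  have Bn0 : 0 <= B * n1 by nra.
  by move=> h'; have := ler_wpM2l Bn0 h'; lra.
(* The summand [e] makes the rate at least [1] for [n < N0]; the other one absorbs the uncoupled
   remainder. *)
pose C := e + 8 * C1 / c.
have Cc : 8 * C1 <= c * C.
  by rewrite /C mulrDr mulrCA divff ?gt_eqF// mulr1; nra.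
have Ce : e <= C by rewrite /C lerDl divr_ge0//; lra.
have C0 : 0 <= C by lra.
exists B, C; split => //; first by lra.
move=> g /andP[Mg g1] r n.
have g0 : 0 < g by apply: lt_le_trans Mg; rewrite invr_gt0.
have g01 : 0 < g <= 1 by rewrite g0.
have n1g : n1 `^ g <= n1 by apply: ler1_powR.
have [nN|Nn] := ltnP n N0.
  left; rewrite /exp_rate; apply: (@le_trans _ _ (e * expR (- 1))).
    by rewrite /e -expRD subrr expR0.
  apply: ler_pM => //; first exact: expR_ge0.
  rewrite ler_expR lerN2; apply: le_trans Bn1; rewrite ler_wpM2l ?(ltW B0)//.
  by apply: le_trans n1g; apply: powR_nat_noninc; [exact: ltW|exact: (leqW (ltnW nN))].
right; split => //; set J := (n - N0)%N.
pose X := expR (- (B * n%:R `^ g)).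
have X0 : 0 <= X by exact: expR_ge0.
have -> : exp_rate C B g n = C * X by [].
have shift (i j : nat) : (n <= i + j + N0.+1)%N ->
    expR (- (B * i%:R `^ g)) <= E0 * X * expR (B * j%:R `^ g).
  move=> nij; rewrite /E0 /X -!expRD ler_expR.
  have h : n%:R `^ g <= i%:R `^ g + j%:R `^ g + n1.
    apply: (@le_trans _ _ ((i%:R + j%:R + n1) `^ g)).
      by rewrite -!natrD; apply: powR_nat_noninc => //; exact: ltW.
    apply: (le_trans (powR_subadd g01 (addr_ge0 (ler0n _ _) (ler0n _ _)) (ler0n _ _))).
    by rewrite lerD//; exact: powR_subadd.
  have := ler_wpM2l (ltW B0) h; lra.
have C10 : 0 <= C1 by lra.
have A0 : 0 <= L'%:R^-1 :> R by rewrite invr_ge0 ltW.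
have r_ge0 k : 0 <= r k by rewrite le_min ler01 exp_rate_ge0.
have r_le k : r k <= exp_rate C1 L'%:R^-1 g k by rewrite ge_min lexx orbT.
have r_dec k : r k.+1 <= r k.
  by apply: le_min2 => //; apply: exp_rate_noninc => //; exact: ltW.
have r0 : r 0%N = 1.
  apply/eqP; rewrite eq_le ge_min lexx/= le_min lexx /exp_rate powR0 ?gt_eqF//.
  by rewrite mulr0 oppr0 expR0 mulr1.
have sum_r : \sum_(0 <= j < J) (r j - r j.+1) * expR (B * j%:R `^ g) <= 1 + th.
  apply: (@le_trans _ _ (1 + 2 * B / B' * (C1 * (1 + S)))); last by rewrite lerD2l.
  apply: sum_exp_weights => //; first by move=> k; rewrite -AB'; exact: r_le.
  exact: hS.
have S1 : \sum_(0 <= j < J) (r j - r j.+1) * exp_rate C B g (J - j.+1) <=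
    C * (E0 * X) * (1 + th).
  have CEX : 0 <= C * (E0 * X) by rewrite !mulr_ge0// expR_ge0.
  apply: le_trans (ler_wpM2l CEX sum_r); rewrite mulr_sumr.
  apply: ler_sum_nat => j hj; rewrite /exp_rate.
  have hsh : expR (- (B * (J - j.+1)%:R `^ g)) <= E0 * X * expR (B * j%:R `^ g).
    by apply: shift; apply: renewal_index => //; case/andP: hj.
  set w := r j - _; set z := expR (B * _) in hsh *.
  have w0 : 0 <= w by rewrite subr_ge0.
  have -> : C * (E0 * X) * (w * z) = w * C * (E0 * X * z) by ring.
  by rewrite mulrA; apply: ler_wpM2l => //; exact: mulr_ge0.
have S2 : r J <= C1 * ((1 + th) * X).
  apply: (le_trans (r_le J)); apply: ler_wpM2l => //.
  apply: (@le_trans _ _ (expR (- (B * J%:R `^ g)))).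
    by rewrite ler_expR lerN2 ler_wpM2r// AB'; lra.
  apply: (le_trans (shift J 0%N _)); first by rewrite /J addn0 addnS subnK// ltnW.
  by rewrite powR0 ?gt_eqF// mulr0 expR0 mulr1 ler_wpM2r.
apply: (@le_trans _ _ ((1 - c) * (C * ((1 + th) * X) * (1 + th)) + C1 * ((1 + th) * X))).
  apply: lerD => //; apply: ler_wpM2l => //; apply: (le_trans S1).
  apply: ler_wpM2r; first by rewrite addr_ge0// ltW.
  by apply: ler_wpM2l => //; exact: ler_wpM2r.
by apply: (exp_renewal_arith (c := c)) => //; rewrite c0.
Qed.

End stretched_exponential_rate.

(** * Uniform decay for branch maps *)

Section uniform_coupling.
Context {R : realType}.
Variables (kappa K delta : R) (M : nat).
Hypothesis kappa01 : 0 <= kappa < 1.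
Hypothesis K0 : 0 <= K.
Hypothesis delta01 : 0 < delta <= 1.
Hypothesis M0 : (0 < M)%N.

(** The solution of [Q = K + kappa * Q + 1]. *)
Definition regularity : R := (K + 1) / (1 - kappa).
Local Notation Q := regularity.
Local Notation Q1 := (K + kappa * Q).
Local Notation N1 := (M * M * M)%N.

Lemma regularity_large : K + kappa * Q + 1 <= Q.
Proof.
have /andP[k0 k1] := kappa01; have k1' : 0 < 1 - kappa by lra.
have e : Q * (1 - kappa) = K + 1 by rewrite /Q divfK// gt_eqF.
lra.
Qed.

Let kappa01' : 0 <= kappa <= 1.
Proof. by have /andP[-> /ltW ->] := kappa01. Qed.

Section one_map.
Context {d : measure_display} {Y : measurableType d}.
Variables (m : set Y -> R) (F : Y -> Y) (rho : Y -> Y -> R) (a : nat -> set Y).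
Variables (tau : Y -> nat) (I : seq nat).
Hypothesis bm : branch_map m F rho a tau kappa K.

Definition return_data : Prop :=
  (forall i, i \in I -> (0 < i <= M)%N /\ delta <= m [set y | tau y = i]) /\
  \big[gcdn/0%N]_(i <- I) i = 1%N.

Lemma push_diff_rate (tl r b : nat -> R) (k0 : nat) : return_data -> (0 < k0)%N ->
  (forall k, (0 < k)%N -> forall N,
     \sum_(l < N) m [set y | (l + k < tau y)%N] <= tl k) ->
  2 * expR Q1 * tl k0 <= 1 ->
  r 0%N = 1 -> (forall k, 0 <= r k) -> (forall k, r k.+1 <= r k) ->
  (forall k, (0 < k)%N -> Num.min 1 (2 * expR Q1 * tl k) <= r k) ->
  (let c := coupled_mass kappa K Q delta k0 N1 in let N0 := (k0 + N1)%N in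
   forall n, 1 <= b n \/ (N0 <= n)%N /\ (1 - c) * (\sum_(0 <= j < n - N0)
    (r j - r j.+1) * b (n - N0 - j.+1)%N) + r (n - N0)%N <= b n) ->
  forall n nu1 nu2 A, measurable A ->
  good m rho a tau kappa K Q nu1 -> good m rho a tau kappa K Q nu2 ->
  tower_push F tau n nu1 A - tower_push F tau n nu2 A <= b n.
Proof.
move=> [HI gI] k00 Htl tlk0 r0 r_ge0 r_dec r_tl /= hb n nu1 nu2 A mA g1 g2.
have QL := regularity_large.
have [c0 [c12 _]] := coupled_mass_bounds N1 kappa01' K0 QL delta01 k00.
have HN1 j : (N1 <= j)%N -> exists2 s, {subset s <= I} & sumn s = j.
  by apply: semigroup_gcd1 => // i /HI[].
have HI' i : i \in I -> (0 < i)%N /\ delta <= m [set y | tau y = i].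
  by move=> /HI[/andP[]].
have small : expR Q1 * tl k0 <= 2^-1 by lra.
have step nu k h1 h2 h3 h4 h5 h6 := @coupling_step _ _ _ _ _ _ _ _ _ _ bm _ QL
  delta _ _ _ _ delta01 HI' HN1 (Htl k0 k00) small k00 nu k h1 h2 h3 h4 h5 h6.
have c01 : 0 <= coupled_mass kappa K Q delta k0 N1 <= 1 by rewrite (ltW c0)/=; lra.
apply: (push_diff bm (c := coupled_mass kappa K Q delta k0 N1)
  (N0 := (k0 + N1)%N) (r := r) c01 step r0 r_ge0 r_dec _ hb n mA g1 g2).
move=> nu k [nuM nu1' nut nub _].
have le1 : nu [set x | (x.2 + k < tau x.1)%N] <= 1.
  rewrite -nu1'; apply: (fm_le nuM) => //; exact: (late_measurable bm).
case: k le1 => [|k] le1; first by rewrite r0.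
apply: le_trans (r_tl k.+1 _) => //; rewrite le_min le1 /=.
apply: (tail_le bm nuM _ nub); last exact: Htl.
by rewrite mulr_ge0 ?expR_ge0.
Qed.

End one_map.

(** Taking [k0] to be the [M]-th power of an integer above [C] handles all exponents [s >= 1 / M] at
    once. *)
Lemma poly_waiting_time (C : R) : 0 <= C -> exists2 k0, (0 < k0)%N &
  forall s, M%:R^-1 <= s -> C * k0%:R `^ (- s) <= 1.
Proof.
move=> C0; pose q := (Num.bound C).+1.
have q1 : 1 <= q%:R :> R by rewrite ler1n.
have Cq : C <= q%:R by have := archi_boundP C0; rewrite /q -natr1; lra.
exists (q ^ M)%N; first by rewrite expn_gt0.
move=> s Ms; have kR : 1 <= (q ^ M)%:R :> R by rewrite ler1n expn_gt0.
have p0 : 0 < (q ^ M)%:R `^ s :> R by rewrite powR_gt0//; lra.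
rewrite powRN ler_pdivrMr// mul1r; apply: (le_trans Cq).
apply: (@le_trans _ _ ((q ^ M)%:R `^ M%:R^-1)); last exact: ler_powR.
have MR : M%:R != 0 :> R by rewrite pnatr_eq0 -lt0n.
by rewrite natrX -powR_mulrn// -powRrM divff// powRr1//; lra.
Qed.

Lemma push_diff_poly : exists2 C : R, 1 <= C &
  forall (d : measure_display) (Y : measurableType d) (m : set Y -> R)
    (F : Y -> Y) (rho : Y -> Y -> R) (a : nat -> set Y) (tau : Y -> nat)
    (I : seq nat) (s : R),
  branch_map m F rho a tau kappa K -> return_data m tau I ->
  M%:R^-1 <= s <= M%:R ->
  (forall n, (0 < n)%N -> m [set y | (n <= tau y)%N] <=
     M%:R * n%:R `^ (- (s + 1))) ->
  forall n nu1 nu2 A, measurable A ->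
  good m rho a tau kappa K Q nu1 -> good m rho a tau kappa K Q nu2 ->
  tower_push F tau n nu1 A - tower_push F tau n nu2 A <= poly_rate C s n.
Proof.
have MR : 0 < M%:R :> R by rewrite ltr0n.
(* One [M] bounds the constant of the tail, the other bounds the factor [s^-1] produced by summing
   it. *)
pose C1 : R := 2 * expR Q1 * (M%:R * M%:R).
have e0 : 0 <= 2 * expR Q1 by rewrite mulr_ge0 ?expR_ge0.
have C10 : 0 <= C1 by rewrite !mulr_ge0 ?expR_ge0 // ltW.
have [k0 k00 hk0] := poly_waiting_time C10.
have [c0 [c12 _]] := coupled_mass_bounds N1 kappa01' K0 regularity_large delta01 k00.
have c01 : 0 < coupled_mass kappa K Q delta k0 N1 <= 2^-1 by rewrite c0.
have [C C1' hC] := @poly_renewal R _ C1 (k0 + N1)%N M c01 C10.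
exists C => // d Y m F rho a tau I s bm rd /andP[Ms sM] htail.
have s0 : 0 < s by apply: lt_le_trans Ms; rewrite invr_gt0.
have siM : s^-1 <= M%:R by rewrite -[M%:R]invrK lef_pV2 ?posrE ?invr_gt0.
pose tl (k : nat) : R := M%:R * M%:R * k%:R `^ (- s).
have C1tl k : 2 * expR Q1 * tl k = C1 * k%:R `^ (- s) by rewrite /tl /C1 !mulrA.
apply: (push_diff_rate bm (tl := tl) (r := poly_rate C1 s) rd k00) => //.
- move=> k kpos N; apply: (@le_trans _ _
    (M%:R * \sum_(l < N) (l + k).+1%:R `^ (- (s + 1)))).
    rewrite mulr_sumr; apply: ler_sum => l _.
    exact: (htail (l + k).+1).
  rewrite /tl -mulrA ler_wpM2l//; apply: (le_trans (sum_powR_tail _ s0 kpos)).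
  by rewrite ler_wpM2r ?powR_ge0.
- by rewrite C1tl; exact: hk0.
- by move=> k; exact: poly_rate_ge0.
- by move=> k; apply: poly_rate_noninc => //; exact: ltW.
- by move=> k kpos; rewrite C1tl /poly_rate gtn_eqF.
- by apply: hC; rewrite s0.
Qed.

(** Reduced to the polynomial case by [expR x >= x]. *)
Lemma exp_waiting_time (C : R) : 0 <= C -> exists2 k0, (0 < k0)%N &
  forall g, M%:R^-1 <= g -> exp_rate C (2 * M)%:R^-1 g k0 <= 1.
Proof.
move=> C0; pose L : R := (2 * M)%:R.
have L0 : 0 < L by rewrite ltr0n; lia.
have CL : 0 <= C * L by rewrite mulr_ge0// ltW.
have [k0 k00 hk0] := poly_waiting_time CL.
exists k0 => // g Mg; have := hk0 g Mg; rewrite powRN.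
have p0 : 0 < k0%:R `^ g :> R by rewrite powR_gt0// ltr0n.
rewrite ler_pdivrMr// mul1r => h.
rewrite /exp_rate expRN ler_pdivrMr ?expR_gt0// mul1r.
apply: (@le_trans _ _ (L^-1 * k0%:R `^ g)).
  by rewrite mulrC ler_pdivlMr.
by have := expR_ge1Dx (L^-1 * k0%:R `^ g); lra.
Qed.

Lemma push_diff_exp : exists B C : R, [/\ 0 < B, 1 <= C &
  forall (d : measure_display) (Y : measurableType d) (m : set Y -> R)
    (F : Y -> Y) (rho : Y -> Y -> R) (a : nat -> set Y) (tau : Y -> nat)
    (I : seq nat) (g : R),
  branch_map m F rho a tau kappa K -> return_data m tau I ->
  M%:R^-1 <= g <= 1 ->
  (forall n, (0 < n)%N -> m [set y | (n <= tau y)%N] <=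
     M%:R * expR (- (M%:R^-1 * n%:R `^ g))) ->
  forall n nu1 nu2 A, measurable A ->
  good m rho a tau kappa K Q nu1 -> good m rho a tau kappa K Q nu2 ->
  tower_push F tau n nu1 A - tower_push F tau n nu2 A <= exp_rate C B g n].
Proof.
have MR : 0 < M%:R :> R by rewrite ltr0n.
have [S S0 hS] := @sum_exp_tail R M M0.
(* The added [1] ensures that the truncated rate starts at [r 0 = 1]. *)
pose C1 : R := 2 * expR Q1 * (M%:R * S) + 1.
have e0 : 0 <= 2 * expR Q1 by rewrite mulr_ge0 ?expR_ge0.
have MS0 : 0 <= M%:R * S by rewrite mulr_ge0// ltW.
have C11 : 1 <= C1 by rewrite /C1 lerDr mulr_ge0.
have C10 : 0 <= C1 by apply: le_trans C11.
have [k0 k00 hk0] := exp_waiting_time C10.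
have [c0 [c12 _]] := coupled_mass_bounds N1 kappa01' K0 regularity_large delta01 k00.
have c01 : 0 < coupled_mass kappa K Q delta k0 N1 <= 2^-1 by rewrite c0.
have L0 : (0 < 2 * M)%N by rewrite muln_gt0.
have [B [C [B0 C1' hC]]] := @exp_renewal R _ C1 (k0 + N1)%N M (2 * M)%N c01 C11 M0 L0.
exists B, C; split => // d Y m F rho a tau I g bm rd g01 htail.
have /andP[Mg g1] := g01.
have g0 : 0 < g by apply: lt_le_trans Mg; rewrite invr_gt0.
pose A : R := (2 * M)%:R^-1; have A0 : 0 <= A by rewrite invr_ge0.
pose tl (k : nat) : R := M%:R * exp_rate S A g k.
have C1tl k : 2 * expR Q1 * tl k <= exp_rate C1 A g k.
  rewrite /tl /exp_rate; set E := expR (- (A * _)).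
  have -> : 2 * expR Q1 * (M%:R * (S * E)) = 2 * expR Q1 * (M%:R * S) * E by ring.
  by apply: ler_wpM2r; [exact: expR_ge0|rewrite /C1 lerDl].
apply: (push_diff_rate bm (tl := tl) (r := fun k => Num.min 1 (exp_rate C1 A g k)) rd k00).
- move=> k kpos N; apply: (@le_trans _ _
    (M%:R * \sum_(l < N) expR (- (M%:R^-1 * (l + k).+1%:R `^ g)))).
    rewrite mulr_sumr; apply: ler_sum => l _.
    exact: (htail (l + k).+1).
  by rewrite /tl ler_wpM2l ?(ltW MR)//; exact: hS.
- exact: le_trans (C1tl k0) (hk0 g Mg).
- apply/eqP; rewrite eq_le ge_min lexx/= le_min lexx /exp_rate powR0 ?gt_eqF//.
  by rewrite mulr0 oppr0 expR0 mulr1.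
- by move=> k; rewrite le_min ler01 exp_rate_ge0.
- move=> k; apply: le_min2 => //; apply: exp_rate_noninc => //; exact: ltW.
- by move=> k kpos; exact: le_min2.
- exact: (hC g g01).
Qed.

End uniform_coupling.

(** * Uniformly expanding maps are branch maps *)

Section expanding_map.
Context {R : realType} {d : measure_display} {Y : measurableType d}.
Variables (m : probability Y R) (F : Y -> Y) (dist : Y -> Y -> R).
Variables (alpha : set (set Y)) (zeta : Y -> R) (lambda K eta : R).
Hypothesis ue : uniformly_expanding m F dist alpha zeta lambda K eta.

Local Notation mr := (fun A : set Y => fine (m A)).

Lemma dist_powR_le1 x y : dist x y `^ eta <= 1.
Proof.
have /andP[e0 e1] := ue_eta ue; have [dge _ _ _] := ue_metric ue.
have -> : 1 = 1 `^ eta by rewrite powR1.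
by apply: ge0_ler_powR; rewrite ?nnegrE ?(ltW e0)// (ue_diam ue).
Qed.

Lemma prob_fin A : measurable A -> m A = (mr A)%:E.
Proof. by move=> mA; rewrite fineK// fin_num_measure. Qed.

Lemma image_measure_isMeasure A B : bimeasurable_bij F A B ->
  exists mu : {measure set Y -> \bar R}, forall C, mu C = image_measure m F A C.
Proof.
move=> [mA mB [_ Finj _] bim].
have mim C : measurable C -> measurable (F @` (C `&` A)).
  by move=> mC; apply: bim; [exact: measurableI|exact: subIsetr].
have mu0 : image_measure m F A set0 = 0%E.
  by rewrite /image_measure set0I image_set0 measure0.
have mu_ge0 C : (0 <= image_measure m F A C)%E by exact: measure_ge0.
have mu_sigma : semi_sigma_additive (image_measure m F A).
  move=> P mP tP mUP; rewrite /image_measure setI_bigcupl image_bigcup.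
  apply: measure_semi_sigma_additive.
  - by move=> i; exact: mim.
  - move=> i j _ _ [y [[x [Px Ax] xy] [x' [Px' Ax'] xy']]].
    apply: tP => //; exists x; split => //.
    by rewrite (Finj x x') ?inE// xy xy'.
  - by apply: bigcup_measurable => i _; exact: mim.
pose mu : {measure set Y -> \bar R} := HB.pack (image_measure m F A)
  (isMeasure.Build _ _ _ (image_measure m F A) mu0 mu_ge0 mu_sigma).
by exists mu.
Qed.

Lemma jacobian_bounds a A B (l u : R) : alpha a -> A `<=` a ->
  bimeasurable_bij F A B -> 0 <= l -> (forall x, A x -> l <= zeta x <= u) ->
  l * mr B <= mr A <= u * mr B.
Proof.
move=> aa Aa bij l0 lu; have [mA mB [Ffun Finj Fsurj] bim] := bij.
have [mu muE] := image_measure_isMeasure bij.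
have [mz zpos jac] := ue_jacobian ue.
have e : m A = (\int[mu]_(x in A) (zeta x)%:E)%E.
  rewrite (jac _ _ _ aa Aa bij); congr (integral _ _ _).
  by apply/funext => C; rewrite muE.
have FA : F @` A = B.
  by apply/seteqP; split => [_ [x Ax <-]|y /Fsurj[x Ax <-]]; [exact: Ffun|exists x].
have muA : mu A = m B by rewrite muE /image_measure setIid FA.
have mzA : measurable_fun A (EFin \o zeta).
  by apply/measurable_EFinP; exact: measurable_funTS.
have zge x : A x -> (0 <= (EFin \o zeta) x)%E by move=> _; rewrite lee_fin ltW.
have lge x : A x -> (0 <= cst l%:E x)%E by move=> _; rewrite lee_fin.
have lz x : A x -> (cst l%:E x <= (EFin \o zeta) x)%E.
  by move=> /lu /andP[lx _]; rewrite lee_fin.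
have zu x : A x -> ((EFin \o zeta) x <= cst u%:E x)%E.
  by move=> /lu /andP[_ ux]; rewrite lee_fin.
have mcst (k : R) : measurable_fun A (cst k%:E) by exact: measurable_cst.
have lo : (l%:E * m B <= m A)%E.
  have := ge0_le_integral mu mA lge (mcst l) mzA lz.
  by rewrite integral_cst// muA e.
have hi : (m A <= u%:E * m B)%E.
  have := ge0_le_integral mu mA zge mzA (mcst u) zu.
  by rewrite integral_cst// muA e.
by move: lo hi; rewrite (prob_fin mA) (prob_fin mB) -!EFinM !lee_fin => -> ->.
Qed.

(** A branch is a bijection only modulo null sets, so the piece of a cell lying over [C] is replaced
    by one of equal mass that is mapped bijectively. *)
Lemma branch_restriction a C : alpha a -> measurable C ->
  exists A B, [/\ A `<=` a `&` F @^-1` C, bimeasurable_bij F A B,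
    mr (a `&` F @^-1` C) = mr A & mr C = mr B].
Proof.
move=> aa mC; have [A [B [Aa nA nB [mA mB [Ffun Finj Fsurj] bim]]]] := ue_full_branch ue aa.
have [mF _] := ue_nonsingular ue.
have mFC : measurable (F @^-1` C) by rewrite -[X in measurable X]setTI; exact: mF.
have [_ am _] := ue_partition ue.
have ma : measurable a by exact: am.
have null (S N : set Y) : measurable S -> measurable N -> m N = 0%E -> m (S `\` N) = m S.
  move=> mS mN N0; have SN : (m (S `&` N) <= 0)%E by rewrite -N0; apply: le_measure;
      rewrite ?inE//; exact: measurableI.
  have SN0 : m (S `&` N) = 0%E by apply/eqP; rewrite eq_le SN measure_ge0.
  by rewrite [RHS](measureDI m mS mN) [X in (_ + X)%E]SN0 adde0.
exists (A `&` F @^-1` C), (B `&` C); split.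
- by move=> x [Ax Cx]; split => //; exact: Aa.
- split.
  + exact: measurableI.
  + exact: measurableI.
  + split.
    * by move=> x [Ax Cx]; split => //; exact: Ffun.
    * by move=> x y; rewrite !inE => -[Ax _] [Ay _]; apply: Finj; rewrite inE.
    * move=> y [By Cy]; have [x Ax xy] := Fsurj y By.
      by exists x => //; split => //=; rewrite xy.
  + by move=> D mD DA; apply: bim => // x /DA[].
- congr fine; rewrite -(null (a `&` F @^-1` C) (a `\` A)) //; last 2 first.
  + exact: measurableI.
  + exact: measurableD.
  congr (m _); apply/seteqP; split => [x [[ax Cx] nAx]|x [Ax Cx]].
    by split => //; apply: contrapT => Ax; apply: nAx.
  by split; [split => //; exact: Aa|move=> [_]; exact].
- congr fine; rewrite -(null C (~` B)) //; last exact: measurableC.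
  by congr (m _); rewrite setDE setCK setIC.
Qed.

Lemma zeta_distortion a x y (K' r : R) : alpha a -> a x -> a y ->
  K <= K' -> 0 <= r -> dist (F x) (F y) `^ eta <= r ->
  zeta x <= expR (K' * r) * zeta y.
Proof.
move=> aa ax ay KK' r0 hr; have [_ zpos _] := ue_jacobian ue.
have K0 := ue_K ue.
rewrite -[zeta x]lnK ?posrE// -[zeta y]lnK ?posrE// -expRD ler_expR.
have := ue_distortion ue aa ax ay; rewrite ler_norml => /andP[_ h].
have : K * dist (F x) (F y) `^ eta <= K' * r by apply: ler_pM; rewrite ?powR_ge0// ltW.
lra.
Qed.

(** The Jacobian is compared pointwise and averaged twice: over [A] against its value at a fixed
    point of [A'], then over [A']. *)
Lemma jacobian_distortion a C D (K' r : R) : alpha a -> measurable C ->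
  measurable D -> K <= K' -> 0 <= r ->
  (forall x y, C x -> D y -> dist x y `^ eta <= r) ->
  mr (a `&` F @^-1` C) * mr D <= expR (K' * r) * (mr C * mr (a `&` F @^-1` D)).
Proof.
move=> aa mC mD KK' r0 CD.
have [A [B [Aa bijA -> ->]]] := branch_restriction aa mC.
have [A' [B' [Aa' bijA' -> ->]]] := branch_restriction aa mD.
have [_ zpos _] := ue_jacobian ue.
have p0 (S : set Y) : 0 <= mr S by exact: fine_ge0.
have subA : A `<=` a by move=> x /Aa[].
have subA' : A' `<=` a by move=> x /Aa'[].
have rhs0 : 0 <= expR (K' * r) * (mr B * mr A') by rewrite !mulr_ge0 ?expR_ge0.
have up y : A' y -> mr A <= expR (K' * r) * zeta y * mr B.
  move=> A'y; have /= [] := andP (jacobian_bounds (l := 0) (u := expR (K' * r) * zeta y)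
      aa subA bijA (lexx _) _) => //.
  move=> x Ax; rewrite ltW//=; apply: (zeta_distortion aa) => //.
  - exact: subA.
  - exact: subA'.
  - by apply: CD; [have [] := Aa _ Ax|have [] := Aa' _ A'y].
have [B0|Bn0] := eqVneq (mr B) 0.
  have [A'0|/set0P[y A'y]] := eqVneq A' set0.
    have e : B' = set0.
      by have [_ _ [_ _ sj] _] := bijA'; apply/seteqP; split => // y /sj[x]; rewrite A'0.
    by rewrite e measure0 mulr0.
  have := up y A'y; rewrite B0 mulr0 => A0.
  by rewrite (_ : mr A = 0) ?mul0r//; apply/eqP; rewrite eq_le A0 p0.
have Bgt : 0 < mr B by rewrite lt_neqAle eq_sym Bn0 p0.
pose l := mr A / (expR (K' * r) * mr B).
have l0 : 0 <= l by rewrite divr_ge0 ?mulr_ge0 ?expR_ge0.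
have [A'0|/set0P[y0 A'y0]] := eqVneq A' set0.
  have e : B' = set0.
    by have [_ _ [_ _ sj] _] := bijA'; apply/seteqP; split => // y /sj[x]; rewrite A'0.
  by rewrite e measure0 mulr0.
have eB : 0 < expR (K' * r) * mr B by rewrite mulr_gt0 ?expR_gt0.
have zl y : A' y -> l <= zeta y.
  by move=> A'y; rewrite ler_pdivrMr//; have := up y A'y; rewrite mulrCA mulrA.
(* Any finite upper bound serves [jacobian_bounds] here; the value at one point supplies it. *)
have zu y : A' y -> zeta y <= expR (K' * 1) * zeta y0.
  move=> A'y; apply: (zeta_distortion aa) => //; [exact: subA'|exact: subA'|exact:
      dist_powR_le1].
have /andP[h _] := jacobian_bounds aa subA' bijA' l0
  (fun y A'y => introT andP (conj (zl y A'y) (zu y A'y))).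
move: h; rewrite /l mulrAC ler_pdivrMr//; lra.
Qed.

(** By distortion, positivity of [zeta] at one point gives a positive lower bound on the whole
    piece. *)
Lemma preimage_null a D : alpha a -> a !=set0 -> measurable D ->
  mr (a `&` F @^-1` D) = 0 -> mr D = 0.
Proof.
move=> aa _ mD; have [A [B [Aa bijA -> ->]]] := branch_restriction aa mD => A0.
have [_ zpos _] := ue_jacobian ue.
have subA : A `<=` a by move=> x /Aa[].
have [A'0|/set0P[y0 Ay0]] := eqVneq A set0.
  have -> : B = set0.
    by have [_ _ [_ _ sj] _] := bijA; apply/seteqP; split => // y /sj[x]; rewrite A'0.
  by rewrite measure0.
have K0 := ue_K ue.
have z1 x y : A x -> A y -> zeta x <= expR (K * 1) * zeta y.
  move=> Ax Ay; apply: (zeta_distortion aa) => //; [exact: subA|exact: subA|exact: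
      dist_powR_le1].
pose l := zeta y0 / expR (K * 1).
have l0 : 0 < l by rewrite divr_gt0 ?expR_gt0.
have zl x : A x -> l <= zeta x.
  by move=> Ax; rewrite /l ler_pdivrMr ?expR_gt0// mulrC; exact: z1.
have /andP[h _] := jacobian_bounds aa subA bijA (ltW l0)
  (fun x Ax => introT andP (conj (zl x Ax) (z1 x y0 Ax Ay0))).
rewrite A0 in h; apply/eqP; rewrite eq_le (fine_ge0 (measure_ge0 _ _)) andbT.
by rewrite -(ler_pM2l l0) mulr0.
Qed.

Lemma branch_map_of_expanding (tau : Y -> nat) (kappa K' : R) :
  return_time m alpha tau -> lambda `^ (- eta) <= kappa <= 1 -> K <= K' ->
  exists a : nat -> set Y, (forall i, a i = set0 \/ alpha (a i)) /\
    branch_map mr F (fun x y => dist x y `^ eta) a tau kappa K'.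
Proof.
move=> rt /andP[lk k1] KK'.
have [cnt am [cov tr ne]] := ue_partition ue.
have /countable_injP[g ginj] := cnt.
have /andP[eta0 eta1] := ue_eta ue.
have [dge d0 dsym _] := ue_metric ue.
have K0 := ue_K ue; have l1 := ue_lambda ue.
(* The partition is enumerated through an injection into the integers; indices outside its range
   give empty cells. *)
pose a i := [set y | exists A, [/\ alpha A, g A = i & A y]].
have aE i A : alpha A -> g A = i -> a i = A.
  move=> aA gA; apply/seteqP; split => [y [B [aB gB By]]|y Ay]; last by exists A.
  by have <- : B = A by apply: ginj; rewrite ?inE// gB gA.
have a0 i : a i = set0 \/ alpha (a i).
  have [[A [aA gA]]|none] := pselect (exists A, alpha A /\ g A = i).
    by right; rewrite (aE i A).
  left; apply/seteqP; split => // y [A [aA gA _]]; apply: none; by exists A.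
have lpow : 0 <= lambda `^ (- eta) by exact: powR_ge0.
exists a; split => //; split.
- have h : (m setT < +oo)%E by rewrite probability_setT ltry.
  exact: (fmeas_fine h).
- by rewrite probability_setT.
- by have [] := ue_nonsingular ue.
- by move=> i; have [->|/am] := a0 i.
- move=> i j _ _ [y [[A [aA <- Ay]] [B [aB <- By]]]].
  by congr g; apply: tr => //; exists y.
- apply/seteqP; split => // y _; have : [set: Y] y by [].
  by rewrite -cov => -[A aA Ay]; exists (g A) => //; exists A.
- by move=> x y; exact: powR_ge0.
- exact: dist_powR_le1.
- by rewrite k1 andbT; exact: le_trans lk.
- by apply: le_trans KK'; exact: ltW.
- move=> i x y ax ay; have [a_0|aa] := a0 i; first by move: ax; rewrite a_0.
  have h := ue_expansion ue aa ax ay.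
  apply: (@le_trans _ _ (lambda `^ (- eta) * dist (F x) (F y) `^ eta)); last first.
    by rewrite ler_wpM2r ?powR_ge0.
  rewrite powRN ler_pdivlMl ?powR_gt0//; last lra.
  rewrite -powRM//; last lra.
  by apply: ge0_ler_powR; rewrite ?nnegrE ?mulr_ge0// ?ltW//; lra.
- move=> i C D r mC mD CD.
  have [a_0|aa] := a0 i; first by rewrite a_0 !set0I measure0 mul0r !mulr0.
  have [C0|/set0P[x0 Cx0]] := eqVneq C set0.
    by rewrite C0 preimage_set0 setI0 measure0 !mul0r mulr0.
  have [D0|/set0P[y0 Dy0]] := eqVneq D set0.
    by rewrite D0 preimage_set0 setI0 measure0 !mulr0.
  apply: jacobian_distortion => //.
  exact: le_trans (powR_ge0 _ _) (CD _ _ Cx0 Dy0).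
- move=> i D mD ane; have [a_0|aa] := a0 i.
    by move: ane; rewrite a_0 => -[].
  exact: preimage_null.
- move=> i x y ax ay; have [a_0|aa] := a0 i; first by move: ax; rewrite a_0.
  exact: (rt_constant rt aa ax ay).
- exact: rt_gt0 rt.
Qed.

End expanding_map.

(** * Hoelder observables and densities *)

Section holder_measurable.
Context {R : realType} {d : measure_display} {Y : measurableType d}.
Variables (m : set Y -> R) (F : Y -> Y) (rho : Y -> Y -> R) (a : nat -> set Y).
Variables (tau : Y -> nat) (kappa K : R).
Hypothesis bm : branch_map m F rho a tau kappa K.
Hypothesis kappa1 : kappa < 1.

Fixpoint cylinder (s : seq nat) : set Y :=
  if s is i :: s' then a i `&` F @^-1` cylinder s' else setT.

Lemma measurable_cylinder s : measurable (cylinder s).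
Proof.
elim: s => [|i s IH] /=; first exact: measurableT.
by apply: measurableI; [exact: bm_a bm i|exact: (measurable_preimage_F bm)].
Qed.

Lemma cylinder_cover n y : exists2 s, size s = n & cylinder s y.
Proof.
elim: n y => [|n IH] y; first by exists [::].
have [s sn Fs] := IH (F y); have : [set: Y] y by [].
by rewrite -(bm_cover bm) => -[i _ ay]; exists (i :: s); rewrite /= ?sn.
Qed.

Lemma cylinder_diam s x y : cylinder s x -> cylinder s y ->
  rho x y <= kappa ^+ size s.
Proof.
have /andP[k0 _] := bm_kappa bm.
elim: s x y => [|i s IH] x y /=; first by move=> _ _; exact: bm_rho1 bm x y.
move=> [ax Fx] [ay Fy]; apply: (le_trans (bm_exp bm ax ay)).
by rewrite exprS ler_wpM2l// IH.
Qed.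

Lemma measurable_bigcup_countType (T : countType) (P : set T) (C : T -> set Y) :
  (forall s, measurable (C s)) -> measurable (\bigcup_(s in P) C s).
Proof.
move=> mC; pose D n := if @unpickle T n is Some s then [set y | P s /\ C s y] else set0.
have -> : \bigcup_(s in P) C s = \bigcup_n D n.
  apply/seteqP; split => [y [s Ps Cy]|y [n _]].
    by exists (pickle s) => //; rewrite /D pickleK.
  by rewrite /D; case: unpickle => // s [Ps Cy]; exists s.
apply: bigcup_measurable => n _; rewrite /D; case: unpickle => // s.
have [Ps|nPs] := pselect (P s).
  by rewrite (_ : [set _ | _] = C s)//; apply/seteqP; split => y //= -[].
by rewrite (_ : [set _ | _] = set0)//; apply/seteqP; split => y //= -[].
Qed.

(* The metric need not generate the sigma-algebra, but cylinders are measurable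
   and shrink, so a superlevel set is a countable union of cylinders. *)
Lemma measurable_superlevel l (u : Y -> R) (H t : R) : 0 <= H ->
  (forall x y, (l < tau x)%N -> (l < tau y)%N -> `|u x - u y| <= H * rho x y) ->
  measurable [set y | (l < tau y)%N /\ t < u y].
Proof.
move=> H0 hu; set S := [set y | _].
have -> : S = \bigcup_(s in [set s | cylinder s `<=` S]) cylinder s.
  apply/seteqP; split => [y [ly ty]|y [s /= sS sy]]; last exact: sS.
  have /andP[k0 _] := bm_kappa bm.
  have [n hn] : exists n, H * kappa ^+ n < u y - t.
    have ck : `|kappa| < 1 by rewrite ger0_norm.
    have c : (fun n => H * kappa ^+ n) @ \oo --> (0 : R).
      by rewrite -[0](mulr0 H); apply: cvgMl_tmp; exact: cvg_expr.
    have [N _ hN] := cvgr_lt 0 c (u y - t) (ltac:(by rewrite subr_gt0)).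
    by exists N; apply: hN => /=.
  (* Length [n.+1] instead of [n] makes the cylinder lie in a single cell, so that [tau] is constant
     on it. *)
  have [s sn sy] := cylinder_cover n.+1 y; exists s => //= x sx.
  have txy : tau x = tau y.
    by case: s sn sy sx => // i s _ [ay _] [ax _]; exact: (bm_tau bm ax ay).
  have lx : (l < tau x)%N by rewrite txy.
  split => //; have := hu y x ly lx; rewrite ler_norml => /andP[_ h].
  have : H * rho y x <= H * kappa ^+ n.
    rewrite ler_wpM2l//; apply: (le_trans (cylinder_diam sy sx)); rewrite sn.
    by rewrite exprS ler_piMl ?exprn_ge0// ltW.
  lra.
by apply: measurable_bigcup_countType; exact: measurable_cylinder.
Qed.

Lemma measurable_holder (phi : Y * nat -> R) (H : R) : 0 <= H ->
  (forall x y, tower tau x -> tower tau y -> x.2 = y.2 ->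
     `|phi x - phi y| <= H * rho x.1 y.1) ->
  measurable_fun (tower tau) phi.
Proof.
move=> H0 h mD; apply: (measurability _ (RGenOInfty.measurableE R)) => //.
move=> _ [_ [t ->] <-]; apply: measurable_slices => l.
rewrite (_ : [set y | _] = [set y | (l < tau y)%N /\ t < phi (y, l)]).
  by apply: (measurable_superlevel (H := H)) => // x y lx ly; exact: h.
by apply/seteqP; split => y /=; rewrite in_itv/= andbT.
Qed.

End holder_measurable.

(** * Measures given by a density *)

Section density.
Context {R : realType} {d : measure_display} {T : measurableType d}.
Variables (mu : probability T R) (D : set T).
Hypothesis mD : measurable D.

Lemma fmeas_density (g : T -> R) : measurable_fun D g ->
  mu.-integrable D (EFin \o g) -> (forall x, D x -> 0 <= g x) ->
  fmeas (fun A => fine (\int[mu]_(x in A `&` D) (g x)%:E)%E).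
Proof.
move=> mg ig g0.
have fin A : measurable A -> (\int[mu]_(x in A `&` D) (g x)%:E)%E \is a fin_num.
  move=> mA; apply: integrable_fin_num; first exact: measurableI.
  by apply: (integrableS mD) => //; exact: measurableI.
split.
- by rewrite set0I integral_set0.
- by move=> A mA; apply/fine_ge0/integral_ge0 => x [_ Dx]; rewrite lee_fin g0.
move=> P mP tP; have mPD i : measurable (P i `&` D) by exact: measurableI.
have UE : (\bigcup_i P i) `&` D = \bigcup_i (P i `&` D) by rewrite setI_bigcupl.
have mU : measurable (\bigcup_i P i) by exact: bigcup_measurable.
have key : (\int[mu]_(x in (\bigcup_i P i) `&` D) (g x)%:E =
    \sum_(i <oo) \int[mu]_(x in P i `&` D) (g x)%:E)%E.
  rewrite UE; apply: ge0_integral_bigcup => //.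
  - apply/measurable_EFinP; apply: (measurable_funS mD) => //.
    by move=> x [i _ []].
  - by move=> x [i _ [_ Dx]]; rewrite lee_fin g0.
  - exact: trivIset_setIr.
have c : (fun n => (\sum_(0 <= i < n) \int[mu]_(x in P i `&` D) (g x)%:E)%E) @ \oo
    --> (\int[mu]_(x in (\bigcup_i P i) `&` D) (g x)%:E)%E.
  rewrite key; apply: is_cvg_nneseries => i _ _.
  by apply: integral_ge0 => x [_ Dx]; rewrite lee_fin g0.
rewrite -(fineK (fin _ mU)) in c; have [_] := (fine_cvgP _ _).1 c.
have -> // : fine \o (fun n => (\sum_(0 <= i < n) \int[mu]_(x in P i `&` D) (g x)%:E)%E) =
    (fun n => \sum_(i < n) fine (\int[mu]_(x in P i `&` D) (g x)%:E)%E).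
by apply/funext => n /=; rewrite big_mkord sum_fine// => i _; exact: fin.
Qed.

Lemma density_bounds (g : T -> R) (A : set T) (l u : R) : measurable_fun D g ->
  mu.-integrable D (EFin \o g) -> measurable A -> A `<=` D ->
  (forall x, A x -> l <= g x <= u) ->
  l * fine (mu A) <= fine (\int[mu]_(x in A `&` D) (g x)%:E)%E <= u * fine (mu A).
Proof.
move=> mg ig mA AD lu; rewrite (setIidl AD).
have iA : mu.-integrable A (EFin \o g) by exact: (integrableS mD).
have ic (k : R) : mu.-integrable A (EFin \o cst k).
  exact: finite_measure_integrable_cst.
have f1 : (\int[mu]_(x in A) (g x)%:E)%E \is a fin_num by exact: integrable_fin_num.
have f2 : mu A \is a fin_num by exact: fin_num_measure.
have cE (k : R) : (\int[mu]_(x in A) (EFin \o cst k) x)%E = (k * fine (mu A))%:E.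
  by rewrite EFinM fineK//; exact: (integral_cst mu mA k%:E).
apply/andP; split; rewrite -lee_fin fineK// -cE; apply: le_integral => // x.
  by rewrite inE => /lu /andP[lx _]; rewrite lee_fin.
by rewrite inE => /lu /andP[_ ux]; rewrite lee_fin.
Qed.

End density.

(** * Duality with the transfer operator *)

Section tower_densities.
Context {R : realType} {d : measure_display} {Y : measurableType d}.
Variables (m : probability Y R) (F : Y -> Y) (rho : Y -> Y -> R).
Variables (alpha : set (set Y)) (a : nat -> set Y) (tau : Y -> nat).
Variables (kappa K : R) (mD : probability (Y * nat)%type R).
Local Notation mr := (fun A : set Y => fine (m A)).
Local Notation mDr := (fun A : set (Y * nat) => fine (mD A)).
Hypothesis bm : branch_map mr F rho a tau kappa K.
Hypothesis kappa1 : kappa < 1.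
Hypothesis rt : return_time m alpha tau.
Hypothesis tm : tower_measure m tau mD.
Local Notation f := (tower_map F tau).
Local Notation Q := (regularity kappa K).
Local Notation good := (good mr rho a tau kappa K Q).

Definition mean_time : R := fine (\int[m]_y ((tau y)%:R : R)%:E)%E.

Lemma measurable_tower : measurable (tower tau).
Proof. exact: (measurable_tower_rel bm (fun l t => (l < t)%N)). Qed.

Lemma mean_time_ge1 : 1 <= mean_time.
Proof.
have it := rt_integrable rt.
have fin : (\int[m]_y ((tau y)%:R : R)%:E)%E \is a fin_num by exact: integrable_fin_num.
rewrite /mean_time -lee_fin fineK//.
have <- : (\int[m]_(x in setT) (EFin \o cst 1%R) x = 1%:E)%E.
  by rewrite (integral_cst m measurableT 1%:E) mul1e; exact: probability_setT.
apply: le_integral => //; first exact: finite_measure_integrable_cst.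
by move=> y _; rewrite lee_fin ler1n; exact: rt_gt0 rt y.
Qed.

Lemma tower_measure_level l A : measurable A -> A `<=` [set y | (l < tau y)%N] ->
  mDr (A `*` [set l]) = mean_time^-1 * mr A.
Proof.
move=> mA Al.
have h : mD (A `*` [set l]) = (mean_time^-1%:E * m A)%E := tm.2 l A mA Al.
by rewrite h fineM// fin_num_measure.
Qed.

(** The bound [2] and the log-Lipschitz constant [1] fit into the class because
    [expR (K + kappa * Q) >= 1] and [Q >= 1]. Passing from [m] to the tower divides by
    [mean_time >= 1]. *)
Lemma good_density (g : Y * nat -> R) : measurable_fun (tower tau) g ->
  mD.-integrable (tower tau) (EFin \o g) ->
  (forall x, tower tau x -> 0 <= g x <= 2) ->
  (forall i x y l, a i x -> a i y -> (l < tau x)%N ->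
     g (x, l) <= expR (rho x y) * g (y, l)) ->
  (\int[mD]_(x in tower tau) (g x)%:E = 1%:E)%E ->
  good (fun A => fine (\int[mD]_(x in A `&` tower tau) (g x)%:E)%E).
Proof.
move=> mg ig g02 hg g1; set nu := (fun A => fine (integral _ _ _)).
have mT := measurable_tower.
have t1 := mean_time_ge1; have t0 : 0 < mean_time by lra.
have ti0 : 0 < mean_time^-1 by rewrite invr_gt0.
have ti1 : mean_time^-1 <= 1 by rewrite invf_le1.
have K0 := bm_K bm; have k01 := bm_kappa bm; have /andP[k0 _] := k01.
have QL : K + kappa * Q + 1 <= Q by apply: regularity_large; rewrite ?k0.
have [Q0 Q10] := regularity_ge0 k01 K0 QL.
have Qge1 : 1 <= Q by lra.
have mm := bm_fmeas bm.
have g0 x : tower tau x -> 0 <= g x by move=> /g02/andP[].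
have nuM : fmeas nu := fmeas_density mT mg ig g0.
have lvl C l : measurable C -> C `<=` [set y | (l < tau y)%N] ->
    C `*` [set l] `<=` tower tau.
  by move=> mC Cl -[y k] [/= /Cl Cy ->].
have off (A : set (Y * nat)) : A `&` tower tau = set0 -> nu A = 0.
  by rewrite /nu => ->; rewrite integral_set0.
split => //.
- by rewrite /nu setTI g1.
- by apply: off; rewrite setICl.
- move=> l C mC; pose C' := C `&` [set y | (l < tau y)%N].
  have mC' : measurable C' by apply: measurableI => //; exact: (measurable_tau bm (fun t
      => (l < t)%N)).
  have C'l : C' `<=` [set y | (l < tau y)%N] by move=> y [].
  have -> : nu (C `*` [set l]) = nu (C' `*` [set l]).
    rewrite /nu; congr (fine (integral _ _ _)).
    apply/seteqP; split => -[y k] [[/= Cy ->]]; rewrite /tower /= => h; split => //.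
    by case: Cy.
  have CT := lvl _ l mC' C'l.
  have /andP[_ h] := density_bounds mT mg ig (measurable_level l mC') CT
    (fun x h => g02 x (CT x h)).
  apply: (le_trans h); rewrite (tower_measure_level mC' C'l) -mulrA ler_wpM2l//.
  have CC : mr C' <= mr C by apply: (fm_le mm) => // y [].
  have p0 : 0 <= mr C' by exact: (fm_ge0 mm mC').
  have e1 : 1 <= expR (K + kappa * Q) by rewrite -[1 in leLHS]expR0 ler_expR.
  apply: ler_pM => //; [exact: ltW|exact: le_trans e1].
apply: (regular_of_le1 bm) => // i l C D r mC mD' Ca Da /andP[r0 r1] CDr.
have rhs0 : 0 <= expR (Q * r) * (mr C * nu (D `*` [set l])).
  rewrite !mulr_ge0 ?expR_ge0// ?(fm_ge0 mm mC)// (fm_ge0 nuM)//.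
  exact: measurable_level.
have [[y0 ay0 ly0]|none] := pselect (exists2 y, a i y & (l < tau y)%N); last first.
  rewrite (off (C `*` [set l])) ?mul0r//.
  apply/seteqP; split => // -[y k] [[/= Cy ->]]; rewrite /tower /= => ly.
  by apply: none; exists y => //; exact: Ca.
have lt y : a i y -> (l < tau y)%N by move=> ay; rewrite (bm_tau bm ay ay0).
have Cl : C `<=` [set y | (l < tau y)%N] by move=> y /Ca; exact: lt.
have Dl : D `<=` [set y | (l < tau y)%N] by move=> y /Da; exact: lt.
have CT := lvl _ l mC Cl; have DT := lvl _ l mD' Dl.
pose c0 := mean_time^-1.
have mC0 := fm_ge0 mm mC; have mD0 := fm_ge0 mm mD'.
have up y : D y -> nu (C `*` [set l]) <= expR r * g (y, l) * (c0 * mr C).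
  move=> Dy; rewrite -(tower_measure_level mC Cl).
  have gb x : (C `*` [set l]) x -> 0 <= g x <= expR r * g (y, l).
    move: x => -[x k] [/= Cx ->]; rewrite (g0 _ (CT (x, l) (conj Cx erefl))) /=.
    apply: (le_trans (hg i x y l (Ca _ Cx) (Da _ Dy) (Cl _ Cx))).
    by rewrite ler_wpM2r ?ler_expR ?CDr//; apply: g0; exact: Dl.
  by have /andP[] := density_bounds mT mg ig (measurable_level l mC) CT gb.
have [D0|/set0P[y1 Dy1]] := eqVneq D set0.
  by move: rhs0; rewrite D0 measure0 mulr0.
have [C0|Cn0] := eqVneq (mr C) 0.
  have := up y1 Dy1; rewrite C0 mulr0 mulr0 => n0.
  have -> : nu (C `*` [set l]) = 0.
    by apply/eqP; rewrite eq_le n0 (fm_ge0 nuM)//; exact: measurable_level.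
  by rewrite mul0r mul0r mulr0.
have Cgt : 0 < mr C by rewrite lt_neqAle eq_sym Cn0.
pose p := nu (C `*` [set l]) / (expR r * (c0 * mr C)).
have den : 0 < expR r * (c0 * mr C) by rewrite !mulr_gt0 ?expR_gt0.
have low : p * (c0 * mr D) <= nu (D `*` [set l]).
  rewrite -(tower_measure_level mD' Dl).
  have gb x : (D `*` [set l]) x -> p <= g x <= 2.
    move: x => -[x k] [/= Dx ->]; have := g02 (x, l) (DT (x, l) (conj Dx erefl)).
    by move=> /andP[_ ->]; rewrite andbT ler_pdivrMr// mulrCA mulrA; exact: up.
  by have /andP[] := density_bounds mT mg ig (measurable_level l mD') DT gb.
have er : expR r <= expR (Q * r) by rewrite ler_expR ler_peMl.
have nuD : 0 <= nu (D `*` [set l]) by rewrite (fm_ge0 nuM)//; exact: measurable_level.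
apply: (@le_trans _ _ (expR r * (mr C * nu (D `*` [set l])))); last first.
  by rewrite ler_wpM2r// mulr_ge0.
have -> : nu (C `*` [set l]) * mr D = expR r * (mr C * (p * (c0 * mr D))).
  rewrite /p; field; rewrite !gt_eqF ?expR_gt0//.
by rewrite ler_wpM2l ?expR_ge0// ler_wpM2l.
Qed.

Variables (eta H : R) (phi : Y * nat -> R).
Hypothesis phi_measurable : measurable_fun (tower tau) phi.
Hypothesis H0 : 0 <= H.
Hypothesis phi_bound : forall x, tower tau x -> `|phi x| <= H.
Hypothesis phi_holder : forall x y l, (l < tau x)%N -> (l < tau y)%N ->
  `|phi (x, l) - phi (y, l)| <= H * rho x y.
Hypothesis phi_mean0 : (\int[mD]_(x in tower tau) (phi x)%:E = 0)%E.

Lemma phi_integrable : mD.-integrable (tower tau) (EFin \o phi).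
Proof.
apply: measurable_bounded_integrable => //; first exact: measurable_tower.
  by apply: (le_lt_trans (probability_le1 _ measurable_tower)); rewrite ltry.
exists H; split; first exact: num_real.
by move=> M HM x /= tx; apply: (le_trans (phi_bound tx)); exact: ltW.
Qed.

(* With [c = 1 / (2 H)] the function [1 + c * phi] takes values in [1/2, 3/2],
   has mean 1, and its logarithm is 1-Lipschitz along the Hoelder scale. *)
Lemma good_perturbation : 0 < H ->
  good (fun A => fine (\int[mD]_(x in A `&` tower tau) (1 + phi x / (2 * H))%:E)%E).
Proof.
move=> Hgt.
have mT := measurable_tower; have iphi := phi_integrable.
have H2 : 0 < 2 * H by lra.
have i1 : mD.-integrable (tower tau) (EFin \o cst (1 : R)).
  exact: finite_measure_integrable_cst.
have i2 : mD.-integrable (tower tau) (fun x => ((2 * H)^-1%:E * (EFin \o phi) x)%E).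
  exact: integrableZl.
have e : (fun x => (1 + phi x / (2 * H))%:E) =
    ((EFin \o cst 1%R) \+ (fun x => ((2 * H)^-1%:E * (EFin \o phi) x)))%E.
  by apply/funext => x /=; rewrite -EFinM -EFinD mulrC.
have b x : tower tau x -> - (1 / 2) <= phi x / (2 * H) <= 1 / 2.
  move=> /phi_bound; rewrite ler_norml => /andP[h1 h2].
  by rewrite ler_pdivrMr// ler_pdivlMr//; lra.
apply: good_density.
- apply: measurable_funD; first exact: measurable_cst.
  by apply: measurable_funM => //; exact: measurable_cst.
- by rewrite [X in _.-integrable _ X]e; exact: integrableD.
- by move=> x /b; lra.
- move=> i x y l ax ay lx.
  have ly : (l < tau y)%N by rewrite (bm_tau bm ay ax).
  have := phi_holder lx ly; rewrite ler_norml => /andP[_ h].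
  have r0 := bm_rho0 bm x y.
  have /andP[by1 _] := b (y, l) ly.
  have h' : phi (x, l) / (2 * H) - phi (y, l) / (2 * H) <= rho x y / 2.
    by rewrite -mulrBl ler_pdivrMr//; lra.
  have := expR_ge1Dx (rho x y); set E := expR _; nra.
- rewrite [X in integral _ _ X]e integralD// integralZl// phi_mean0 mule0 adde0.
  by rewrite (integral_cst mD mT 1%:E) mul1e; exact: tm.1.
Qed.

Lemma good_constant : good (fun A => fine (\int[mD]_(x in A `&` tower tau) (cst 1 x)%:E)%E).
Proof.
apply: good_density.
- exact: measurable_cst.
- by apply: finite_measure_integrable_cst; exact: measurable_tower.
- by move=> x _ /=; lra.
- by move=> i x y l _ _ _ /=; rewrite mulr1 -[1 in leLHS]expR0 ler_expR (bm_rho0 bm).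
- by rewrite (integral_cst mD measurable_tower 1%:E) mul1e; exact: tm.1.
Qed.

Lemma integral_phi_le n A (e : R) : measurable A -> 0 <= e ->
  (forall nu1 nu2 A, measurable A -> good nu1 -> good nu2 ->
    tower_push F tau n nu1 A - tower_push F tau n nu2 A <= e) ->
  (\int[mD]_(x in iter n f @^-1` A `&` tower tau) (phi x)%:E <= (2 * H * e)%:E)%E.
Proof.
move=> mA e0 h; set S := _ `&` _.
have mT := measurable_tower.
have mS : measurable S by apply: measurableI => //; exact: (measurable_preimage_iter bm).
have ST : S `<=` tower tau by move=> x [].
(* Normalising by [2 * H] is impossible for [H = 0], but then [phi] vanishes on the tower. *)
have [Hz|Hn0] := eqVneq H 0.
  rewrite (_ : (\int[mD]_(x in S) (phi x)%:E)%E = 0%E); first by rewrite Hz mulr0 mul0r.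
  rewrite -[RHS](integral0 mD S); apply: eq_integral => x; rewrite inE => /ST /phi_bound.
  by rewrite Hz normr_le0 => /eqP ->.
have Hgt : 0 < H by rewrite lt_neqAle eq_sym Hn0.
have iphi : mD.-integrable S (EFin \o phi) by exact: (integrableS mT mS ST phi_integrable).
have i1 : mD.-integrable S (EFin \o cst (1 : R)) by exact: finite_measure_integrable_cst.
have i2 : mD.-integrable S (fun x => ((2 * H)^-1%:E * (EFin \o phi) x)%E) by exact:
    integrableZl.
have := h _ _ A mA (good_perturbation Hgt) good_constant.
rewrite /tower_push -/S.
have -> : (\int[mD]_(x in S) (1 + phi x / (2 * H))%:E =
    mD S + (2 * H)^-1%:E * \int[mD]_(x in S) (phi x)%:E)%E.
  rewrite -integralZl// -[X in (X + _)%E]mul1e -(integral_cst mD mS 1%:E) -integralD//.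
  by apply: eq_integral => x _ /=; rewrite -EFinM -EFinD mulrC.
rewrite (integral_cst mD mS 1%:E) mul1e.
have fS : mD S \is a fin_num by exact: fin_num_measure.
have fp : (\int[mD]_(x in S) (phi x)%:E)%E \is a fin_num by exact: integrable_fin_num.
rewrite -(fineK fp) -(fineK fS) -EFinM -EFinD /= lee_fin addrAC subrr add0r mulrC.
rewrite ler_pdivrMr; last by lra.
by rewrite mulrC.
Qed.

Variable L : (Y * nat -> R) -> (Y * nat -> R).
Hypothesis Ltr : transfer_operator mD (tower tau) f L.

Lemma transfer_iter n : mD.-integrable (tower tau) (EFin \o iter n L phi) /\
  forall psi : Y * nat -> R, measurable_fun (tower tau) psi ->
    (forall x, tower tau x -> `|psi x| <= 1) ->
    (\int[mD]_(x in tower tau) (iter n L phi x * psi x)%:E =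
     \int[mD]_(x in tower tau) (phi x * psi (iter n f x))%:E)%E.
Proof.
have mT := measurable_tower.
elim: n => [|n [iL dual]]; first by split => //; exact: phi_integrable.
have [iL' dual'] := Ltr iL; split => // psi mpsi psi1.
rewrite iterS dual'; last first.
  by split => //; exists 1; exact: aeW.
have fT x : tower tau x -> tower tau (f x) by move=> tx; exact: (iter_tower_invariant bm 1 tx).
rewrite (dual (fun x => psi (f x))) //; last by move=> x /fT; exact: psi1.
apply: (measurable_comp (F := tower tau)) => //.
  by move=> _ [x tx <-]; exact: fT.
by apply: measurable_funTS; exact: (measurable_tower_map bm).
Qed.

(** Testing against the sign of the iterate reduces the norm to the integral of [phi] over one set
    and its complement. As [phi] has mean zero these are opposite, so the one-sided bound
    [2 * H * e] is doubled. *)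
Lemma transfer_bound n (e : R) : 0 <= e ->
  (forall nu1 nu2 A, measurable A -> good nu1 -> good nu2 ->
    tower_push F tau n nu1 A - tower_push F tau n nu2 A <= e) ->
  (\int[mD]_(x in tower tau) (`|iter n L phi x|)%:E <= (4 * H * e)%:E)%E.
Proof.
move=> e0 h; have mT := measurable_tower.
have [iL dual] := transfer_iter n; set u := iter n L phi in iL dual *.
have mu : measurable_fun (tower tau) u.
  by have /integrableP[/measurable_EFinP] := iL.
pose E := tower tau `&` u @^-1` `[0, +oo[.
have mE : measurable E by apply: mu => //; exact: measurable_itv.
pose psi x : R := 2 * \1_E x - 1.
have psi1 x : E x -> psi x = 1 by move=> Ex; rewrite /psi indicE mem_set// mulr1; ring.
have psiN1 x : ~ E x -> psi x = -1 by move=> Ex; rewrite /psi indicE memNset// mulr0 sub0r.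
have mpsi : measurable_fun (tower tau) psi.
  apply: measurable_funB; last exact: measurable_cst.
  by apply: measurable_funM; [exact: measurable_cst|exact: measurable_indic].
have -> : (\int[mD]_(x in tower tau) (`|u x|)%:E =
    \int[mD]_(x in tower tau) (phi x * psi (iter n f x))%:E)%E.
  rewrite -dual//; last first.
    move=> x _; have [/psi1 ->|/psiN1 ->] := pselect (E x); first by rewrite normr1.
    by rewrite normrN1.
  apply: eq_integral => x; rewrite inE => tx; congr EFin.
  have [hx|hx] := leP 0 (u x).
    by rewrite psi1 ?mulr1 ?ger0_norm//; split => //=; rewrite in_itv/= hx.
  by rewrite psiN1 ?mulrN1 ?ltr0_norm// => -[_ /=]; rewrite in_itv/= andbT leNgt hx.
set S := iter n f @^-1` E `&` tower tau.
have mS : measurable S by apply: measurableI => //; exact: (measurable_preimage_iter bm).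
have iphi := phi_integrable.
have ST : S `<=` tower tau by move=> x [].
pose S' := tower tau `\` S.
have mS' : measurable S' by exact: measurableD.
have S'T : S' `<=` tower tau by move=> x [].
have iS := integrableS mT mS ST iphi.
have iS' := integrableS mT mS' S'T iphi.
have TE : tower tau = S `|` S' by rewrite setDUK.
have dis : [disjoint S & S'] by apply/disj_setPS => x [Sx [_ /(_ Sx)]].
have s0 : (\int[mD]_(x in S) (phi x)%:E + \int[mD]_(x in S') (phi x)%:E = 0)%E.
  by rewrite -integral_setU// -TE//; have /integrableP[] := iphi.
have tn x : tower tau x -> tower tau (iter n f x) by exact: (iter_tower_invariant bm).
have eS : (\int[mD]_(x in S) (phi x * psi (iter n f x))%:E = \int[mD]_(x in S) (phi x)%:E)%E.
  by apply: eq_integral => x; rewrite inE => -[/= Ex _]; rewrite psi1// mulr1.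
have eS' : (\int[mD]_(x in S') (phi x * psi (iter n f x))%:E =
    - \int[mD]_(x in S') (phi x)%:E)%E.
  rewrite -integralN; last exact: integrable_add_def.
  apply: eq_integral => x; rewrite inE => -[tx nS].
  by rewrite psiN1 ?mulrN1// => Ex; apply: nS.
have mprod : measurable_fun (S `|` S') (fun x => (phi x * psi (iter n f x))%:E : \bar R).
  rewrite -TE; apply/measurable_EFinP; apply: measurable_funM => //.
  apply: (measurable_comp (F := tower tau)) => //.
    by move=> _ [x tx <-]; exact: tn.
  by apply: measurable_funTS; exact: (measurable_iter_tower bm).
rewrite TE integral_setU// eS eS'.
have fS : (\int[mD]_(x in S) (phi x)%:E)%E \is a fin_num by exact: integrable_fin_num.
have fS' : (\int[mD]_(x in S') (phi x)%:E)%E \is a fin_num by exact: integrable_fin_num.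
have hS := integral_phi_le mE e0 h.
rewrite -/S in hS; move: s0 hS.
rewrite -(fineK fS) -(fineK fS') -EFinD -EFinN -EFinD !lee_fin => -[s0] hS.
lra.
Qed.

End tower_densities.

(** * Uniform constants *)

Section continuous_majorant.
Context {R : realType}.
Variable G : nat -> R.
Hypothesis G0 : forall k, 0 <= G k.

(** A ramp: twice [G k] times the positive part of [x - k + 2]. It is continuous and exceeds [G k]
    once [x >= k - 1], in particular for [k = truncn x + 1]. *)
Let term (k : nat) (x : R) : R := G k * (`|x - k%:R + 2| + (x - k%:R + 2)).

(* The terms with [k >= x + 2] vanish, so the sum is locally finite. *)
Definition majorant (x : R) : R := 1 + \sum_(k < (Num.truncn x).+3) term k x.

Let term_ge0 k x : 0 <= term k x.
Proof. by rewrite mulr_ge0//; have := ler_norm (- (x - k%:R + 2)); rewrite normrN; lra. Qed.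

Let majorantE x K : ((Num.truncn x).+3 <= K)%N ->
  majorant x = 1 + \sum_(k < K) term k x.
Proof.
move=> xK; rewrite /majorant -(subnKC xK); congr (1 + _).
elim: (K - _)%N => [|j IH]; first by rewrite addn0.
rewrite addnS [RHS]big_ord_recr /= -IH; set N := (Num.truncn x).+3.
rewrite [term _ _](_ : _ = 0) ?addr0//.
have xN : x < (Num.truncn x).+1%:R by apply: real_truncnS_gt; exact: num_real.
have h : x - (N + j)%:R + 2 <= 0.
  have : (Num.truncn x).+3%:R <= (N + j)%:R :> R by rewrite ler_nat leq_addr.
  by rewrite -addn2 natrD; lra.
by rewrite /term ler0_norm// addNr mulr0.
Qed.

Lemma majorant_ge1 x : 1 <= majorant x.
Proof. by rewrite /majorant lerDl sumr_ge0. Qed.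

Lemma majorant_ge x : 0 <= x -> G (Num.truncn x).+1 <= majorant x.
Proof.
move=> x0; set N := Num.truncn x.
have Nx : N%:R <= x by rewrite truncn_le.
rewrite /majorant -/N big_ord_recr big_ord_recr /=.
have s0 : 0 <= \sum_(i < N.+1) term i x by apply: sumr_ge0.
have t2 := term_ge0 N.+2 x.
suff : G N.+1 <= term N.+1 x by lra.
have h : 1 <= x - N.+1%:R + 2 by rewrite -natr1; lra.
rewrite /term ger0_norm; last by lra.
by rewrite ler_peMr//; lra.
Qed.

Lemma majorant_continuous : continuous majorant.
Proof.
(* This number of terms suffices for every [x <= x0 + 1], so near [x0] the function is a fixed
   finite sum. *)
move=> x0; set K := (Num.truncn (x0 + 1)).+3.
have cK j : (fun x => 1 + \sum_(k < j) term k x) @ x0 --> 1 + \sum_(k < j) term k x0.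
  apply: cvgD; first exact: cvg_cst.
  elim: j => [|j IH].
    by rewrite big_ord0; under eq_fun do rewrite big_ord0; exact: cvg_cst.
  rewrite big_ord_recr /=; under eq_fun do rewrite big_ord_recr /=.
  apply: cvgD => //; apply: cvgMl_tmp.
  have c : (fun x : R => x - j%:R + 2) @ x0 --> x0 - j%:R + 2.
    by apply: cvgD; [apply: cvgB; [exact: cvg_id|exact: cvg_cst]|exact: cvg_cst].
  by apply: cvgD => //; exact: cvg_norm.
have near0 : \forall x \near x0, x <= x0 + 1.
  by apply: (cvgr_le x0 cvg_id); lra.
have near1 : \forall x \near x0, majorant x = 1 + \sum_(k < K) term k x.
  near=> x; apply: majorantE; rewrite /K !ltnS; apply: le_truncn.
  by near: x; exact: near0.
rewrite /continuous_at (majorantE (K := K)); last by rewrite /K !ltnS le_truncn//; lra.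
apply: cvg_trans (cK K); apply: near_eq_cvg.
by near=> x; apply/esym; near: x.
Unshelve. all: by end_near.
Qed.

End continuous_majorant.

(** * Norm decay for a single expanding tower *)

Section expanding_tower.
Context {R : realType} {d : measure_display} {Y : measurableType d}.
Variables (m : probability Y R) (F : Y -> Y) (dist : Y -> Y -> R).
Variables (alpha : set (set Y)) (zeta : Y -> R) (lambda K eta : R).
Variables (tau : Y -> nat) (mD : probability (Y * nat)%type R).
Variables (L : (Y * nat -> R) -> (Y * nat -> R)) (phi : Y * nat -> R).
Hypothesis ue : uniformly_expanding m F dist alpha zeta lambda K eta.
Hypothesis rt : return_time m alpha tau.
Hypothesis tm : tower_measure m tau mD.
Hypothesis Ltr : transfer_operator mD (tower tau) (tower_map F tau) L.
Hypothesis phi_fin : (holder_norm dist tau eta phi < +oo)%E.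
Hypothesis phi_mean0 : (\int[mD]_(x in tower tau) (phi x)%:E = 0)%E.

Local Notation rho := (fun x y => dist x y `^ eta).

Lemma holder_norm_bounds : exists H : R,
  [/\ holder_norm dist tau eta phi = H%:E, 0 <= H,
    forall x, tower tau x -> `|phi x| <= H &
    forall x y l, (l < tau x)%N -> (l < tau y)%N ->
      `|phi (x, l) - phi (y, l)| <= H * rho x y].
Proof.
(* A point of the tower is needed because the supremum over the empty set is minus infinity. *)
have [y0 _] : [set: Y] !=set0.
  apply/set0P/eqP => Y0; have := @probability_setT _ _ _ m.
  by rewrite Y0 measure0 => /eqP; rewrite eq_sym onee_eq0.
have ty0 : tower tau (y0, 0%N) by exact: rt_gt0 rt y0.
have Nlt := phi_fin; set N := holder_norm _ _ _ _ in Nlt *.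
have semi0 : (0 <= holder_seminorm dist tau eta phi)%E by rewrite /holder_seminorm le_max lexx.
have sup_ge x : tower tau x -> ((`|phi x|)%:E <= sup_norm tau phi)%E.
  by move=> tx; apply: ereal_sup_ubound; exists x.
have sup0 : (0 <= sup_norm tau phi)%E.
  by apply: le_trans (sup_ge _ ty0); rewrite lee_fin.
have N0 : (0 <= N)%E by rewrite adde_ge0.
have Nfin : N \is a fin_num by rewrite ge0_fin_numE.
have supN : (sup_norm tau phi <= N)%E by rewrite /N /holder_norm leeDr.
have semiN : (holder_seminorm dist tau eta phi <= N)%E by rewrite /N /holder_norm leeDl.
exists (fine N); rewrite fineK//; split => //.
- exact: fine_ge0.
- by move=> x tx; rewrite -lee_fin fineK//; exact: le_trans (sup_ge x tx) supN.
move=> x y l lx ly; have [->|xy] := pselect (x = y).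
  by rewrite subrr normr0 mulr_ge0 ?powR_ge0// fine_ge0.
have [dge d0 _ _] := ue_metric ue.
have dpos : 0 < dist x y.
  by rewrite lt_neqAle dge andbT; apply/eqP => /esym /(d0 x y).1.
have p0 : 0 < rho x y by rewrite powR_gt0.
rewrite -ler_pdivrMr// -lee_fin fineK//; apply: le_trans semiN.
rewrite /holder_seminorm le_max; apply/orP; right; apply: ereal_sup_ubound.
exists (x, l), (y, l); split => //; first by case.
by rewrite /tower_dist /= eqxx.
Qed.

Lemma expanding_tower_bound (kappa K' : R) : lambda `^ (- eta) <= kappa < 1 ->
  K <= K' -> exists a (H : R),
  [/\ branch_map (fun A : set Y => fine (m A)) F rho a tau kappa K',
    holder_norm dist tau eta phi = H%:E, 0 <= H &
    forall n e, 0 <= e -> (forall nu1 nu2 A, measurable A ->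
      good (fun A : set Y => fine (m A)) rho a tau kappa K' (regularity kappa K') nu1 ->
      good (fun A : set Y => fine (m A)) rho a tau kappa K' (regularity kappa K') nu2 ->
      tower_push F tau n nu1 A - tower_push F tau n nu2 A <= e) ->
    (\int[mD]_(x in tower tau) (`|iter n L phi x|)%:E <= (4 * H * e)%:E)%E].
Proof.
move=> /andP[lk k1] KK'.
have lk1 : lambda `^ (- eta) <= kappa <= 1 by rewrite lk ltW.
have [a [_ bm]] := branch_map_of_expanding ue rt lk1 KK'.
have [H [HE H0 phib phih]] := holder_norm_bounds.
exists a, H; split => // n e e0 h.
have mphi : measurable_fun (tower tau) phi.
  apply: (measurable_holder bm k1 H0) => -[x l] [y l'] tx ty /= ll.
  by move: ty; rewrite -ll => ty; exact: phih.
exact: (transfer_bound bm k1 rt tm mphi H0 phib phih phi_mean0 Ltr e0 h).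
Qed.

End expanding_tower.

(** * Constants depending on one integer bound *)

Section uniform_constants.
Variable R : realType.

(** The weakest contraction compatible with [lambda >= 1 + 1 / M] and [eta >= 1 / M]. *)
Definition contraction (M : nat) : R := (1 + M%:R^-1) `^ (- M%:R^-1).

Lemma contraction_lt1 (M : nat) : (0 < M)%N -> 0 <= contraction M < 1.
Proof.
move=> M0; have Mi : 0 < M%:R^-1 :> R by rewrite invr_gt0 ltr0n.
have b1 : 1 < 1 + M%:R^-1 :> R by rewrite ltrDl.
have b0 : 0 < 1 + M%:R^-1 :> R by lra.
rewrite powR_ge0/= /contraction powRN invf_lt1 ?powR_gt0//.
rewrite -[X in X < _](powRr0 (1 + M%:R^-1)) /powR gt_eqF//.
by rewrite ltr_expR mul0r mulr_gt0// ln_gt0.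
Qed.

Lemma contraction_ge (M : nat) (lambda eta : R) : (0 < M)%N ->
  1 + M%:R^-1 <= lambda -> M%:R^-1 <= eta -> lambda `^ (- eta) <= contraction M.
Proof.
move=> M0 hl he; have Mi : 0 < M%:R^-1 :> R by rewrite invr_gt0 ltr0n.
have l0 : 0 < lambda by lra.
have b0 : 0 < 1 + M%:R^-1 :> R by lra.
rewrite /contraction !powRN lef_pV2 ?posrE ?powR_gt0//.
apply: (@le_trans _ _ (lambda `^ M%:R^-1)); last by apply: ler_powR => //; lra.
by apply: ge0_ler_powR; rewrite ?nnegrE//; lra.
Qed.

Lemma return_data_of_mixing {d : measure_display} {Y : measurableType d}
    (m : probability Y R) (tau : Y -> nat) (I : seq nat) (delta : R) (M : nat) :
  mixing_data m tau I delta -> (\max_(i <- I) i <= M)%N -> M%:R^-1 <= delta ->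
  (forall n, measurable [set y | tau y = n]) ->
  return_data M%:R^-1 M (fun A : set Y => fine (m A)) tau I.
Proof.
move=> [d0 Ipos Igcd Im] IM Md mt; split => // i iI; split.
  by rewrite Ipos//=; apply: leq_trans IM; exact: (leq_bigmax_seq (F := id)).
apply: (le_trans Md); rewrite -lee_fin fineK; first exact: Im.
by rewrite fin_num_measure.
Qed.

Definition poly_decay_with (M : nat) (C : R) : Prop :=
  forall (d : measure_display) (Y : measurableType d)
    (m : probability Y R) (F : Y -> Y) (dist : Y -> Y -> R)
    (alpha : set (set Y)) (zeta : Y -> R) (lambda K eta : R)
    (tau : Y -> nat) (mD : probability (Y * nat)%type R)
    (L : (Y * nat -> R) -> (Y * nat -> R))
    (I : seq nat) (delta : R) (phi : Y * nat -> R) (beta Ctau : R),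
  uniformly_expanding m F dist alpha zeta lambda K eta ->
  return_time m alpha tau ->
  tower_measure m tau mD ->
  transfer_operator mD (tower tau) (tower_map F tau) L ->
  mixing_data m tau I delta ->
  (holder_norm dist tau eta phi < +oo)%E ->
  (\int[mD]_(x in tower tau) (phi x)%:E = 0)%E ->
  (forall n : nat, (0 < n)%N ->
    (m [set y | (n <= tau y)%N] <= (Ctau * n%:R `^ (- beta))%:E)%E) ->
  1 + M%:R^-1 <= lambda -> K <= M%:R -> M%:R^-1 <= eta ->
  (\max_(i <- I) i <= M)%N -> M%:R^-1 <= delta ->
  M%:R^-1 <= beta - 1 <= M%:R -> Ctau <= M%:R ->
  forall n : nat, (1 <= n)%N ->
    (\int[mD]_(x in tower tau) (`|iter n L phi x|)%:E <=
     C%:E * holder_norm dist tau eta phi * (n%:R `^ (- (beta - 1)))%:E)%E.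

Lemma poly_decay (M : nat) : (0 < M)%N ->
  exists2 C : R, 0 <= C & poly_decay_with M C.
Proof.
move=> M0; have MR : 1 <= M%:R :> R by rewrite ler1n.
have Mi : 0 < (M%:R : R)^-1 <= 1 by rewrite invr_gt0 invf_le1; lra.
have k01 := contraction_lt1 M0.
have [C C1 hC] := push_diff_poly k01 (ler0n R M) Mi M0.
exists (4 * C); first by lra.
move=> d Y m F dist alpha zeta lambda K eta tau mD L I delta phi beta Ctau.
move=> ue rt tm Ltr md pf p0 htail hl hK he hI hd hb hCt n n1.
have lk : lambda `^ (- eta) <= contraction M < 1.
  by rewrite contraction_ge//; have /andP[] := k01.
have [a [H [bm -> H0 bound]]] := expanding_tower_bound ue rt tm Ltr pf p0 lk hK.
have rd := return_data_of_mixing md hI hd (fun n => measurable_tau bm (fun t => t = n)).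
have tail j : (0 < j)%N -> fine (m [set y | (j <= tau y)%N]) <=
    M%:R * j%:R `^ (- (beta - 1 + 1)).
  move=> j0; rewrite subrK; apply: (@le_trans _ _ (Ctau * j%:R `^ (- beta))).
    rewrite -lee_fin fineK; first exact: htail.
    by rewrite fin_num_measure//; exact: (measurable_tau bm (fun t => (j <= t)%N)).
  by rewrite ler_wpM2r ?powR_ge0.
apply: (le_trans (bound n (poly_rate C (beta - 1) n) _ _)).
- by apply: poly_rate_ge0; lra.
- by move=> nu1 nu2 A mA g1 g2; exact: (hC _ _ _ _ _ _ _ _ _ bm rd hb tail).
- rewrite -!EFinM lee_fin.
  have := poly_rate_le C (beta - 1) n1; set x := poly_rate _ _ _; set y := _ `^ _ => h.
  have -> : 4 * C * H * y = 4 * H * (C * y) by ring.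
  by rewrite ler_wpM2l// mulr_ge0.
Qed.

(** Every rate [B' <= B] is allowed because the final continuous rate only lies below the discrete
    constants. *)
Definition exp_decay_with (M : nat) (B C : R) : Prop :=
  forall (d : measure_display) (Y : measurableType d)
    (m : probability Y R) (F : Y -> Y) (dist : Y -> Y -> R)
    (alpha : set (set Y)) (zeta : Y -> R) (lambda K eta : R)
    (tau : Y -> nat) (mD : probability (Y * nat)%type R)
    (L : (Y * nat -> R) -> (Y * nat -> R))
    (I : seq nat) (delta : R) (phi : Y * nat -> R) (A gamma Ctau : R),
  uniformly_expanding m F dist alpha zeta lambda K eta ->
  return_time m alpha tau ->
  tower_measure m tau mD ->
  transfer_operator mD (tower tau) (tower_map F tau) L ->
  mixing_data m tau I delta ->
  (holder_norm dist tau eta phi < +oo)%E ->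
  (\int[mD]_(x in tower tau) (phi x)%:E = 0)%E ->
  (forall n : nat, (0 < n)%N ->
    (m [set y | (n <= tau y)%N] <=
     (Ctau * expR (- (A * n%:R `^ gamma)))%:E)%E) ->
  1 + M%:R^-1 <= lambda -> K <= M%:R -> M%:R^-1 <= eta ->
  (\max_(i <- I) i <= M)%N -> M%:R^-1 <= delta ->
  M%:R^-1 <= A -> M%:R^-1 <= gamma <= 1 -> Ctau <= M%:R ->
  forall (n : nat) B', B' <= B ->
    (\int[mD]_(x in tower tau) (`|iter n L phi x|)%:E <=
     C%:E * holder_norm dist tau eta phi * (expR (- (B' * n%:R `^ gamma)))%:E)%E.

Lemma exp_decay (M : nat) : (0 < M)%N ->
  exists B C : R, [/\ 0 < B, 0 <= C & exp_decay_with M B C].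
Proof.
move=> M0; have MR : 1 <= M%:R :> R by rewrite ler1n.
have Mi : 0 < (M%:R : R)^-1 <= 1 by rewrite invr_gt0 invf_le1; lra.
have k01 := contraction_lt1 M0.
have [B [C [B0 C1 hC]]] := push_diff_exp k01 (ler0n R M) Mi M0.
exists B, (4 * C); split => //; first by lra.
move=> d Y m F dist alpha zeta lambda K eta tau mD L I delta phi A gamma Ctau.
move=> ue rt tm Ltr md pf p0 htail hl hK he hI hd hA hg hCt n B' BB'.
have lk : lambda `^ (- eta) <= contraction M < 1.
  by rewrite contraction_ge//; have /andP[] := k01.
have [a [H [bm -> H0 bound]]] := expanding_tower_bound ue rt tm Ltr pf p0 lk hK.
have rd := return_data_of_mixing md hI hd (fun n => measurable_tau bm (fun t => t = n)).
have tail j : (0 < j)%N -> fine (m [set y | (j <= tau y)%N]) <=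
    M%:R * expR (- (M%:R^-1 * j%:R `^ gamma)).
  move=> j0; apply: (@le_trans _ _ (Ctau * expR (- (A * j%:R `^ gamma)))).
    rewrite -lee_fin fineK; first exact: htail.
    by rewrite fin_num_measure//; exact: (measurable_tau bm (fun t => (j <= t)%N)).
  apply: (@le_trans _ _ (M%:R * expR (- (A * j%:R `^ gamma)))).
    by rewrite ler_wpM2r ?expR_ge0.
  by rewrite ler_wpM2l// ler_expR lerN2 ler_wpM2r ?powR_ge0.
apply: (le_trans (bound n (exp_rate C B gamma n) _ _)).
- by apply: exp_rate_ge0; lra.
- by move=> nu1 nu2 S mS g1 g2; exact: (hC _ _ _ _ _ _ _ _ _ bm rd hg tail).
- rewrite -!EFinM lee_fin /exp_rate.
  have h : expR (- (B * n%:R `^ gamma)) <= expR (- (B' * n%:R `^ gamma)).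
    by rewrite ler_expR lerN2 ler_wpM2r ?powR_ge0.
  set x := expR _ in h *; set y := expR _ in h *.
  have -> : 4 * C * H * y = 4 * H * C * y by ring.
  by rewrite [4 * H * (C * x)]mulrA ler_wpM2l// !mulr_ge0//; lra.
Qed.

End uniform_constants.

(** * Continuity in the parameters *)

Section parameters.
Context {R : realType}.

Lemma cvg_fst_comp {T U V : topologicalType} (g : T -> U * V) (p : T) :
  g @ p --> g p -> (fun x => (g x).1) @ p --> (g p).1.
Proof. by move=> cg; apply: (@cvg_comp _ _ _ g fst _ _ _ cg); exact: cvg_fst. Qed.

Lemma cvg_snd_comp {T U V : topologicalType} (g : T -> U * V) (p : T) :
  g @ p --> g p -> (fun x => (g x).2) @ p --> (g p).2.
Proof. by move=> cg; apply: (@cvg_comp _ _ _ g snd _ _ _ cg); exact: cvg_snd. Qed.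

Lemma cvg_natr_comp {T : topologicalType} (g : T -> nat) (p : T) :
  g @ p --> g p -> (fun x => (g x)%:R : R) @ p --> ((g p)%:R : R).
Proof.
move=> cg; apply: (@cvg_comp _ _ _ g (fun k => k%:R) _ _ _ cg) => A nA.
change (nbhs (g p) [set k : nat | A k%:R]).
by apply: (filterS _ (discrete_set1 (g p))) => k ->; exact: (nbhs_singleton nA).
Qed.

Lemma cvg_inv_comp {T : topologicalType} (g : T -> R) (p : T) : 0 < g p ->
  g @ p --> g p -> (fun x => (g x)^-1) @ p --> (g p)^-1.
Proof. by move=> gp cg; apply: cvgV => //; rewrite gt_eqF. Qed.

Lemma cvg_sub1_comp {T : topologicalType} (g : T -> R) (p : T) :
  g @ p --> g p -> (fun x => g x - 1) @ p --> g p - 1.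
Proof. by move=> cg; apply: cvgB => //; exact: cvg_cst. Qed.

(** The summands are nonnegative, so a bound on the sum bounds each of them. Inverses keep a
    parameter away from the edge of its domain; [beta - 1] also occurs directly, because the rates
    are uniform only for exponents in [[1 / M, M]]. *)
Definition poly_complexity (p : R * R * R * nat * R * R * R) : R :=
  (p.1.1.1.1.1.1 - 1)^-1 + p.1.1.1.1.1.2 + (p.1.1.1.1.2)^-1 + (p.1.1.1.2)%:R +
  (p.1.1.2)^-1 + (p.1.2 - 1)^-1 + (p.1.2 - 1) + p.2.

Lemma poly_complexity_continuous p : poly_params R p ->
  poly_complexity @ p --> poly_complexity p.
Proof.
case: p => [[[[[[lambda K] eta] N] delta] beta] Ctau].
move=> [[l1 K0 /andP[e0 e1]] [N0 d0 b1 c0]]; set p := (X in X @ _ --> _).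
have c7 := @cvg_id _ (nbhs (lambda, K, eta, N, delta, beta, Ctau)).
have c6 := cvg_fst_comp c7; have c5 := cvg_fst_comp c6.
have c4 := cvg_fst_comp c5; have c3 := cvg_fst_comp c4.
have c2 := cvg_fst_comp c3; have c1 := cvg_fst_comp c2.
rewrite /p /poly_complexity.
apply: cvgD; last exact: (cvg_snd_comp c7).
apply: cvgD; last exact: (cvg_sub1_comp (cvg_snd_comp c6)).
apply: cvgD; last first.
  by apply: cvg_inv_comp; [rewrite subr_gt0|exact: (cvg_sub1_comp (cvg_snd_comp c6))].
apply: cvgD; last by apply: cvg_inv_comp => //; exact: (cvg_snd_comp c5).
apply: cvgD; last by apply: cvg_natr_comp; exact: (cvg_snd_comp c4).
apply: cvgD; last by apply: cvg_inv_comp => //; exact: (cvg_snd_comp c3).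
apply: cvgD; last exact: (cvg_snd_comp c2).
by apply: cvg_inv_comp; [rewrite subr_gt0|exact: (cvg_sub1_comp c1)].
Qed.

Definition exp_complexity (p : R * R * R * nat * R * R * R * R) : R :=
  (p.1.1.1.1.1.1.1 - 1)^-1 + p.1.1.1.1.1.1.2 + (p.1.1.1.1.1.2)^-1 +
  (p.1.1.1.1.2)%:R + (p.1.1.1.2)^-1 + (p.1.1.2)^-1 + (p.1.2)^-1 + p.2.

Lemma exp_complexity_continuous p : exp_params R p ->
  exp_complexity @ p --> exp_complexity p.
Proof.
case: p => [[[[[[[lambda K] eta] N] delta] A] gamma] Ctau].
move=> [[l1 K0 /andP[e0 e1]] [N0 d0 A0 /andP[g0 g1] c0]]; set p := (X in X @ _ --> _).
have c8 := @cvg_id _ (nbhs (lambda, K, eta, N, delta, A, gamma, Ctau)).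
have c7 := cvg_fst_comp c8; have c6 := cvg_fst_comp c7.
have c5 := cvg_fst_comp c6; have c4 := cvg_fst_comp c5.
have c3 := cvg_fst_comp c4; have c2 := cvg_fst_comp c3.
have c1 := cvg_fst_comp c2.
rewrite /p /exp_complexity.
apply: cvgD; last exact: (cvg_snd_comp c8).
apply: cvgD; last by apply: cvg_inv_comp => //; exact: (cvg_snd_comp c7).
apply: cvgD; last by apply: cvg_inv_comp => //; exact: (cvg_snd_comp c6).
apply: cvgD; last by apply: cvg_inv_comp => //; exact: (cvg_snd_comp c5).
apply: cvgD; last by apply: cvg_natr_comp; exact: (cvg_snd_comp c4).
apply: cvgD; last by apply: cvg_inv_comp => //; exact: (cvg_snd_comp c3).
apply: cvgD; last exact: (cvg_snd_comp c2).
by apply: cvg_inv_comp; [rewrite subr_gt0|exact: (cvg_sub1_comp c1)].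
Qed.

Lemma inv_le_swap (x : R) (M : nat) : 0 < x -> x^-1 <= M%:R -> M%:R^-1 <= x.
Proof.
move=> x0 xM; rewrite -[x]invrK lef_pV2 ?posrE ?invr_gt0//.
by apply: lt_le_trans xM; rewrite invr_gt0.
Qed.

Lemma complexity_truncn (x : R) : x <= (Num.truncn x).+1%:R.
Proof. by apply/ltW/real_truncnS_gt; exact: num_real. Qed.

Lemma poly_complexity_bounds lambda K eta N delta beta Ctau (M : nat) :
  [/\ 1 < lambda, 0 < K & 0 < eta] -> [/\ 0 < delta, 1 < beta & 0 <= Ctau] ->
  poly_complexity (lambda, K, eta, N, delta, beta, Ctau) <= M%:R ->
  [/\ 1 + M%:R^-1 <= lambda, K <= M%:R & M%:R^-1 <= eta] /\
  [/\ (N <= M)%N, M%:R^-1 <= delta, M%:R^-1 <= beta - 1 <= M%:R & Ctau <= M%:R].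
Proof.
move=> [l1 K0 e0] [d0 b1 c0]; rewrite /poly_complexity /=.
have il : 0 < (lambda - 1)^-1 by rewrite invr_gt0 subr_gt0.
have ie : 0 < eta^-1 by rewrite invr_gt0.
have id : 0 < delta^-1 by rewrite invr_gt0.
have ib : 0 < (beta - 1)^-1 by rewrite invr_gt0 subr_gt0.
have b0 : 0 < beta - 1 by rewrite subr_gt0.
have n0 : 0 <= N%:R :> R by [].
move=> h; split; split.
- by rewrite addrC -lerBrDr; apply: inv_le_swap; lra.
- lra.
- by apply: inv_le_swap => //; lra.
- by rewrite -(ler_nat R); lra.
- by apply: inv_le_swap => //; lra.
- by rewrite inv_le_swap//=; lra.
- lra.
Qed.

Lemma exp_complexity_bounds lambda K eta N delta A gamma Ctau (M : nat) :
  [/\ 1 < lambda, 0 < K & 0 < eta] ->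
  [/\ 0 < delta, 0 < A, 0 < gamma & 0 <= Ctau] ->
  exp_complexity (lambda, K, eta, N, delta, A, gamma, Ctau) <= M%:R ->
  [/\ 1 + M%:R^-1 <= lambda, K <= M%:R & M%:R^-1 <= eta] /\
  [/\ (N <= M)%N, M%:R^-1 <= delta, M%:R^-1 <= A, M%:R^-1 <= gamma &
      Ctau <= M%:R].
Proof.
move=> [l1 K0 e0] [d0 A0 g0 c0]; rewrite /exp_complexity /=.
have il : 0 < (lambda - 1)^-1 by rewrite invr_gt0 subr_gt0.
have ie : 0 < eta^-1 by rewrite invr_gt0.
have id : 0 < delta^-1 by rewrite invr_gt0.
have iA : 0 < A^-1 by rewrite invr_gt0.
have ig : 0 < gamma^-1 by rewrite invr_gt0.
have n0 : 0 <= N%:R :> R by [].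
move=> h; split; split.
- by rewrite addrC -lerBrDr; apply: inv_le_swap; lra.
- lra.
- by apply: inv_le_swap => //; lra.
- by rewrite -(ler_nat R); lra.
- by apply: inv_le_swap => //; lra.
- by apply: inv_le_swap => //; lra.
- by apply: inv_le_swap => //; lra.
- lra.
Qed.

Lemma poly_complexity_ge0 lambda K eta N delta beta Ctau :
  [/\ 1 < lambda, 0 < K & 0 < eta] -> [/\ 0 < delta, 1 < beta & 0 <= Ctau] ->
  0 <= poly_complexity (lambda, K, eta, N, delta, beta, Ctau).
Proof.
move=> [l1 K0 e0] [d0 b1 c0]; rewrite /poly_complexity /=.
have il : 0 < (lambda - 1)^-1 by rewrite invr_gt0 subr_gt0.
have ie : 0 < eta^-1 by rewrite invr_gt0.
have id : 0 < delta^-1 by rewrite invr_gt0.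
have ib : 0 < (beta - 1)^-1 by rewrite invr_gt0 subr_gt0.
have n0 : 0 <= N%:R :> R by [].
lra.
Qed.

Lemma exp_complexity_ge0 lambda K eta N delta A gamma Ctau :
  [/\ 1 < lambda, 0 < K & 0 < eta] ->
  [/\ 0 < delta, 0 < A, 0 < gamma & 0 <= Ctau] ->
  0 <= exp_complexity (lambda, K, eta, N, delta, A, gamma, Ctau).
Proof.
move=> [l1 K0 e0] [d0 A0 g0 c0]; rewrite /exp_complexity /=.
have il : 0 < (lambda - 1)^-1 by rewrite invr_gt0 subr_gt0.
have ie : 0 < eta^-1 by rewrite invr_gt0.
have id : 0 < delta^-1 by rewrite invr_gt0.
have iA : 0 < A^-1 by rewrite invr_gt0.
have ig : 0 < gamma^-1 by rewrite invr_gt0.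
have n0 : 0 <= N%:R :> R by [].
lra.
Qed.

End parameters.

Unset Implicit Arguments.
Set Strict Implicit.
Set Printing Implicit Defensive.

Theorem theorem2p7 (R : realType) :
  (exists C : R * R * R * nat * R * R * R -> R,
    [/\ {within poly_params R, continuous C},
        forall p, poly_params R p -> 0 < C p &
        forall (d : measure_display) (Y : measurableType d)
          (m : probability Y R) (F : Y -> Y) (dist : Y -> Y -> R)
          (alpha : set (set Y)) (zeta : Y -> R) (lambda K eta : R)
          (tau : Y -> nat) (mD : probability (Y * nat)%type R)
          (L : (Y * nat -> R) -> (Y * nat -> R))
          (I : seq nat) (delta : R) (phi : Y * nat -> R) (beta Ctau : R),
          uniformly_expanding m F dist alpha zeta lambda K eta ->
          return_time m alpha tau ->
          tower_measure m tau mD ->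
          transfer_operator mD (tower tau) (tower_map F tau) L ->
          mixing alpha tau ->
          mixing_data m tau I delta ->
          (holder_norm dist tau eta phi < +oo)%E ->
          (\int[mD]_(x in tower tau) (phi x)%:E = 0)%E ->
          1 < beta ->
          (forall n : nat, (0 < n)%N ->
            (m [set y | (n <= tau y)%N] <= (Ctau * n%:R `^ (- beta))%:E)%E) ->
          forall n : nat, (1 <= n)%N ->
            (\int[mD]_(x in tower tau) (`|iter n L phi x|)%:E <=
             (C (lambda, K, eta, (\max_(i <- I) i)%N, delta, beta, Ctau))%:E *
             holder_norm dist tau eta phi *
             (n%:R `^ (- (beta - 1)))%:E)%E])
  /\
  (exists B C : R * R * R * nat * R * R * R * R -> R,
    [/\ {within exp_params R, continuous B},
        {within exp_params R, continuous C},
        forall p, exp_params R p -> 0 < B p /\ 0 < C p &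
        forall (d : measure_display) (Y : measurableType d)
          (m : probability Y R) (F : Y -> Y) (dist : Y -> Y -> R)
          (alpha : set (set Y)) (zeta : Y -> R) (lambda K eta : R)
          (tau : Y -> nat) (mD : probability (Y * nat)%type R)
          (L : (Y * nat -> R) -> (Y * nat -> R))
          (I : seq nat) (delta : R) (phi : Y * nat -> R) (A gamma Ctau : R),
          uniformly_expanding m F dist alpha zeta lambda K eta ->
          return_time m alpha tau ->
          tower_measure m tau mD ->
          transfer_operator mD (tower tau) (tower_map F tau) L ->
          mixing alpha tau ->
          mixing_data m tau I delta ->
          (holder_norm dist tau eta phi < +oo)%E ->
          (\int[mD]_(x in tower tau) (phi x)%:E = 0)%E ->
          0 < A -> 0 < gamma <= 1 ->
          (forall n : nat, (0 < n)%N ->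
            (m [set y | (n <= tau y)%N] <=
             (Ctau * expR (- (A * n%:R `^ gamma)))%:E)%E) ->
          forall n : nat,
            (\int[mD]_(x in tower tau) (`|iter n L phi x|)%:E <=
             (C (lambda, K, eta, (\max_(i <- I) i)%N, delta, A, gamma, Ctau))%:E *
             holder_norm dist tau eta phi *
             (expR (- (B (lambda, K, eta, (\max_(i <- I) i)%N, delta,
                          A, gamma, Ctau) * n%:R `^ gamma)))%:E)%E]).
Proof.
split.
(* The value at [M = 0] is a dummy; only integers [truncn x + 1] are used. *)
- have ex M : exists C : R, 0 <= C /\ ((0 < M)%N -> poly_decay_with M C).
    by case: M => [|M]; [exists 0|have [C C0 hC] := @poly_decay R M.+1 isT; exists C].
  have [G hG] := choice ex.
  have G0 k : 0 <= G k by have [] := hG k.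
  exists (fun p => majorant G (poly_complexity p)); split.
  + apply: continuous_in_subspaceT => p; rewrite inE => pp.
    apply: (@cvg_comp _ _ _ poly_complexity (majorant G) _ _ _
        (poly_complexity_continuous pp)).
    exact: majorant_continuous.
  + by move=> p _; apply: lt_le_trans (majorant_ge1 G0 _).
  move=> d Y m F dist alpha zeta lambda K eta tau mD L I delta phi beta Ctau.
  move=> ue rt tm Ltr _ md pf p0 b1 htail n n1.
  have l1 := ue_lambda ue; have K0 := ue_K ue; have /andP[e0 _] := ue_eta ue.
  have [d0 _ _ _] := md.
  have Ct0 : 0 <= Ctau.
    have h := htail 1%N isT; rewrite powR1 mulr1 in h.
    by rewrite -lee_fin; apply: le_trans h; exact: measure_ge0.
  have u3 : [/\ 1 < lambda, 0 < K & 0 < eta] by [].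
  have v3 : [/\ 0 < delta, 1 < beta & 0 <= Ctau] by [].
  have c0 := poly_complexity_ge0 (\max_(i <- I) i)%N u3 v3.
  have [[hl hK he] [hI hd hb hC]] := poly_complexity_bounds u3 v3
    (complexity_truncn (poly_complexity
      (lambda, K, eta, (\max_(i <- I) i)%N, delta, beta, Ctau))).
  have [_ dec] := hG (Num.truncn (poly_complexity
    (lambda, K, eta, (\max_(i <- I) i)%N, delta, beta, Ctau))).+1.
  have h := dec isT _ _ _ _ _ _ _ _ _ _ _ _ _ _ _ _ _ _ ue rt tm Ltr md
    pf p0 htail hl hK he hI hd hb hC n n1.
  apply: (le_trans h).
  have [H [-> H0 _ _]] := holder_norm_bounds ue rt pf.
  rewrite -!EFinM lee_fin ler_wpM2r ?powR_ge0// ler_wpM2r//.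
  exact: majorant_ge.
have ex M : exists BC : R * R, [/\ 0 < BC.1, 0 <= BC.2 &
    (0 < M)%N -> exp_decay_with M BC.1 BC.2].
  case: M => [|M]; first by exists (1, 0).
  by have [B [C [B0 C0 hC]]] := @exp_decay R M.+1 isT; exists (B, C).
have [G hG] := choice ex.
have G20 k : 0 <= (G k).2 by have [] := hG k.
have G10 k : 0 <= ((G k).1)^-1 by have [h _ _] := hG k; rewrite invr_ge0 ltW.
(* A continuous positive minorant of the rates is the inverse of a continuous majorant of their
   inverses. *)
exists (fun p => (majorant (fun k => ((G k).1)^-1) (exp_complexity p))^-1).
exists (fun p => majorant (fun k => (G k).2) (exp_complexity p)).
have pos1 x : 0 < majorant (fun k => ((G k).1)^-1) x.
  exact: lt_le_trans (majorant_ge1 G10 x).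
split.
- apply: continuous_in_subspaceT => p; rewrite inE => pp.
  apply: cvgV; first by rewrite gt_eqF.
  apply: (@cvg_comp _ _ _ exp_complexity (majorant _) _ _ _ (exp_complexity_continuous pp)).
  exact: majorant_continuous.
- apply: continuous_in_subspaceT => p; rewrite inE => pp.
  apply: (@cvg_comp _ _ _ exp_complexity (majorant _) _ _ _ (exp_complexity_continuous pp)).
  exact: majorant_continuous.
- by move=> p _; rewrite invr_gt0; split => //; exact: lt_le_trans (majorant_ge1 G20 _).
move=> d Y m F dist alpha zeta lambda K eta tau mD L I delta phi A gamma Ctau.
move=> ue rt tm Ltr _ md pf p0 A0 /andP[g0 g1] htail n.
have l1 := ue_lambda ue; have K0 := ue_K ue; have /andP[e0 _] := ue_eta ue.
have [d0 _ _ _] := md.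
have Ct0 : 0 <= Ctau.
  rewrite -(pmulr_lge0 _ (expR_gt0 (- (A * 1%:R `^ gamma)))) -lee_fin.
  by apply: le_trans (htail 1%N isT); exact: measure_ge0.
have u3 : [/\ 1 < lambda, 0 < K & 0 < eta] by [].
have v3 : [/\ 0 < delta, 0 < A, 0 < gamma & 0 <= Ctau] by [].
have c0 := exp_complexity_ge0 (\max_(i <- I) i)%N u3 v3.
have [[hl hK he] [hI hd hA hg hC]] := exp_complexity_bounds u3 v3
  (complexity_truncn (exp_complexity
    (lambda, K, eta, (\max_(i <- I) i)%N, delta, A, gamma, Ctau))).
set x := exp_complexity (lambda, K, eta, (\max_(i <- I) i)%N, delta, A, gamma, Ctau)
  in c0 hl hK he hI hd hA hg hC *.
have [B0 _ dec] := hG (Num.truncn x).+1.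
have hg' : (Num.truncn x).+1%:R^-1 <= gamma <= 1 by rewrite hg.
have BB : (majorant (fun k => ((G k).1)^-1) x)^-1 <= (G (Num.truncn x).+1).1.
  by rewrite -[leRHS]invrK lef_pV2 ?posrE ?invr_gt0//; exact: (majorant_ge G10 c0).
have h := dec isT _ _ _ _ _ _ _ _ _ _ _ _ _ _ _ _ _ _ _ ue rt tm Ltr md
  pf p0 htail hl hK he hI hd hA hg' hC n _ BB.
apply: (le_trans h).
have [H [-> H0 _ _]] := holder_norm_bounds ue rt pf.
rewrite -!EFinM lee_fin ler_wpM2r ?expR_ge0// ler_wpM2r//.
exact: (majorant_ge G20 c0).
Qed.
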